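(* Let $(X_i,\mu_i)$ and $(Y_i,\nu_i)$ be standard measure spaces and $\kappa_i\subseteq X_i\times Y_i$ be $\omega$-closed sets, $i=1,2$. Let $\rho:(X_1\times Y_1)\times(X_2\times Y_2)\to(X_1\times X_2)\times(Y_1\times Y_2)$ be given by $\rho((x_1,y_1),(x_2,y_2))=((x_1,x_2),(y_1,y_2))$. The set $\rho(\kappa_1\times\kappa_2)$ is an operator $M$-set (resp. operator $M_1$-set) if and only if both $\kappa_1$ and $\kappa_2$ are operator $M$-sets (resp. operator $M_1$-sets).
   Context: Standard measure space: a ($\sigma$-finite) regular Borel measure with respect to some complete (separable) metrisable topology; $X_1\times X_2$ and $Y_1\times Y_2$ carry the product measures. For standard measure spaces $(X,\mu),(Y,\nu)$: a rectangle is $\alpha\times\beta$ with measurable sides; a subset of $X\times Y$ is marginally null if contained in $(X_0\times Y)\cup(X\times Y_0)$ with $\mu(X_0)=\nu(Y_0)=0$; a set is $\omega$-open if it differs by a marginally null set from a countable union of rectangles; $\omega$-closed means complement $\omega$-open. $\Gamma(X,Y)=L^2(X,\mu)\hat\otimes L^2(Y,\nu)$ is viewed as functions $h(x,y)=\sum_if_i(x)g_i(y)$, $\sum\|f_i\|_2^2,\sum\|g_i\|_2^2<\infty$, modulo marginally null sets; its dual is $\mathcal B(L^2(X,\mu),L^2(Y,\nu))$ via $\langle T,f\otimes g\rangle=(Tf,\bar g)$. For $\omega$-closed $\kappa\subseteq X\times Y$, $\Phi(\kappa)$ is the set of $h\in\Gamma(X,Y)$ vanishing marginally almost everywhere on $\kappa$,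 $\Psi(\kappa)$ the norm closure of the set of $h\in\Gamma(X,Y)$ vanishing on an $\omega$-open neighbourhood of $\kappa$, $\mathfrak M_{\min}(\kappa)=\Phi(\kappa)^\perp$, $\mathfrak M_{\max}(\kappa)=\Psi(\kappa)^\perp$. $\kappa$ is an operator $M$-set (resp. operator $M_1$-set) if $\mathfrak M_{\max}(\kappa)$ (resp. $\mathfrak M_{\min}(\kappa)$) contains a non-zero compact operator. *)

(* Defs.v *)
From HB Require Import structures.
From mathcomp Require Import all_boot all_order all_algebra.
From mathcomp Require Import all_classical all_reals all_analysis.
From mathcomp Require Export complex.

Set Implicit Arguments.
Unset Strict Implicit.
Unset Printing Implicit Defensive.

Import Order.TTheory GRing.Theory Num.Theory.
Import numFieldNormedType.Exports.

Local Open Scope classical_set_scope.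
Local Open Scope ring_scope.
Local Open Scope complex_scope.
Local Open Scope ereal_scope.

(* The topology is carried by a separate type P and transported to X along the
   bijection phi; the sigma-algebra of X is the Borel one of that topology. *)
Definition standard_measure_space (R : realType) (d : measure_display)
    (X : measurableType d) (mu : {sigma_finite_measure set X -> \bar R}) : Prop :=
  exists (P : completePseudoMetricType R) (phi : X -> P),
    [/\ bijective phi,
        hausdorff_space P /\ (exists2 D : set P, countable D & dense D),
        (forall A : set X, measurable A <-> <<s @open P >> (phi @` A)),
        (forall A : set X, measurable A ->
           mu A = ereal_inf [set mu (phi @^-1` U) |
                             U in [set U : set P | open U /\ phi @` A `<=` U]])
      & (forall A : set X, measurable A ->
           mu A = ereal_sup [set mu (phi @^-1` K) |
                             K in [set K : set P | compact K /\ K `<=` phi @` A]])].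

Section complex_L2.
Context (R : realType) (d : measure_display) (X : measurableType d).
Variable mu : {measure set X -> \bar R}.

Definition cmeasurable (f : X -> R[i]) : Prop :=
  measurable_fun setT (fun x => complex.Re (f x)) /\
  measurable_fun setT (fun x => complex.Im (f x)).

Definition L2norm (f : X -> R[i]) : \bar R :=
  Lnorm mu 2%:E (fun x => (ComplexField.Normc.normc (f x))%:E).

(* Elements are functions, not classes: equality in L^2 is equality
   mu-almost everywhere. *)
Definition L2 : set (X -> R[i]) :=
  [set f | cmeasurable f /\ L2norm f < +oo].

Definition cintegral (f : X -> R[i]) : R[i] :=
  (\int[mu]_x complex.Re (f x))%R +i* (\int[mu]_x complex.Im (f x))%R.

Definition L2inner (f g : X -> R[i]) : R[i] :=
  cintegral (fun x => f x * ((g x)^*)%C)%R.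

End complex_L2.

Definition cseries (R : realType) (u : nat -> R[i]) : R[i] :=
  (limn (series (fun i => complex.Re (u i))))
    +i* (limn (series (fun i => complex.Im (u i)))).

Section two_spaces.
Context (R : realType) (d d' : measure_display).
Context (X : measurableType d) (Y : measurableType d').
Variables (mu : {measure set X -> \bar R}) (nu : {measure set Y -> \bar R}).

Definition marginally_null (E : set (X * Y)) : Prop :=
  exists (X0 : set X) (Y0 : set Y),
    [/\ measurable X0, mu X0 = 0, measurable Y0, nu Y0 = 0
      & E `<=` (X0 `*` setT) `|` (setT `*` Y0)].

Definition omega_open (E : set (X * Y)) : Prop :=
  exists (A : nat -> set X) (B : nat -> set Y),
    [/\ (forall n, measurable (A n)), (forall n, measurable (B n))
      & marginally_null (E `+` \bigcup_n (A n `*` B n))].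

Definition omega_closed (E : set (X * Y)) : Prop := omega_open (~` E).

(* An operator on L^2 classes is given by its action on representatives.
   Linearity and boundedness make it compatible with almost everywhere
   equality; its values outside L2 mu are irrelevant. *)
Definition bounded_operator (T : (X -> R[i]) -> (Y -> R[i])) : Prop :=
  [/\ (forall f, L2 mu f -> L2 nu (T f)),
      (forall (a : R[i]) f g, L2 mu f -> L2 mu g ->
         T (fun x => a * f x + g x)%R
           = (fun y => a * T f y + T g y)%R %[ae nu])
    & (exists M : R, forall f, L2 mu f ->
         L2norm nu (T f) <= M%:E * L2norm mu f)].

Definition compact_operator (T : (X -> R[i]) -> (Y -> R[i])) : Prop :=
  bounded_operator T /\
  forall u : nat -> X -> R[i],
    (forall n, L2 mu (u n) /\ L2norm mu (u n) <= 1) ->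
    exists (s : nat -> nat) (v : Y -> R[i]),
      [/\ {homo s : m n / (m < n)%N}, L2 nu v
        & L2norm nu (fun y => T (u (s n)) y - v y)%R @[n --> \oo] --> 0].

Definition nonzero_operator (T : (X -> R[i]) -> (Y -> R[i])) : Prop :=
  exists2 f, L2 mu f & ~ (T f = (fun=> 0%R) %[ae nu]).

(* h = \sum_i f_i (x) g_i marginally almost everywhere; the two summability
   conditions make the series converge absolutely off a marginally null set. *)
Definition represents (f : nat -> X -> R[i]) (g : nat -> Y -> R[i])
    (h : X * Y -> R[i]) : Prop :=
  [/\ (forall i, L2 mu (f i)), (forall i, L2 nu (g i)),
      \sum_(0 <= i <oo) L2norm mu (f i) ^+ 2 < +oo,
      \sum_(0 <= i <oo) L2norm nu (g i) ^+ 2 < +oo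
    & marginally_null
        [set z | h z <> cseries (fun i => f i z.1 * g i z.2)%R]].

Definition Gamma : set (X * Y -> R[i]) :=
  [set h | exists f g, represents f g h].

(* the norm of the projective tensor product *)
Definition Gamma_norm (h : X * Y -> R[i]) : \bar R :=
  ereal_inf [set \sum_(0 <= i <oo) L2norm mu (fg.1 i) * L2norm nu (fg.2 i) |
             fg in [set fg | represents fg.1 fg.2 h]].

(* <T, h> for h = \sum_i f_i (x) g_i; the paired functions determine the value
   only through h. *)
Definition pairing (T : (X -> R[i]) -> (Y -> R[i]))
    (f : nat -> X -> R[i]) (g : nat -> Y -> R[i]) : R[i] :=
  cseries (fun i => L2inner nu (T (f i)) (fun y => ((g i y)^*)%C)).

Definition annihilator (S : set (X * Y -> R[i])) :
    set ((X -> R[i]) -> (Y -> R[i])) :=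
  [set T | bounded_operator T /\
     forall h f g, S h -> represents f g h -> pairing T f g = 0%R].

Definition vanishes_on (E : set (X * Y)) (h : X * Y -> R[i]) : Prop :=
  marginally_null (E `&` [set z | h z <> 0%R]).

Definition Phi (kappa : set (X * Y)) : set (X * Y -> R[i]) :=
  [set h | Gamma h /\ vanishes_on kappa h].

Definition vanishes_near (kappa : set (X * Y)) (h : X * Y -> R[i]) : Prop :=
  exists E, [/\ omega_open E, kappa `<=` E & vanishes_on E h].

Definition Psi (kappa : set (X * Y)) : set (X * Y -> R[i]) :=
  [set h | Gamma h /\
     forall e : R, (0 < e)%R ->
       exists h0, [/\ Gamma h0, vanishes_near kappa h0
                    & Gamma_norm (fun z => h z - h0 z)%R < e%:E]].

Definition M_min (kappa : set (X * Y)) := annihilator (Phi kappa).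

Definition M_max (kappa : set (X * Y)) := annihilator (Psi kappa).

Definition operator_M_set (kappa : set (X * Y)) : Prop :=
  omega_closed kappa /\
  exists T, [/\ M_max kappa T, compact_operator T & nonzero_operator T].

Definition operator_M1_set (kappa : set (X * Y)) : Prop :=
  omega_closed kappa /\
  exists T, [/\ M_min kappa T, compact_operator T & nonzero_operator T].

End two_spaces.

Definition rho (X1 X2 Y1 Y2 : Type) (z : (X1 * Y1) * (X2 * Y2)) :
    (X1 * X2) * (Y1 * Y2) :=
  ((z.1.1, z.2.1), (z.1.2, z.2.2)).

(* Main.v *)
From HB Require Import structures.
Require Import Defs.
From mathcomp Require Import all_boot all_order all_algebra.
From mathcomp Require Import all_classical all_reals all_analysis.
From mathcomp Require Import ring lra.
From mathcomp Require Import measurable_realfun.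

Set Implicit Arguments.
Unset Strict Implicit.
Unset Printing Implicit Defensive.

Import Order.TTheory GRing.Theory Num.Theory.
Import numFieldNormedType.Exports.

Local Open Scope classical_set_scope.
Local Open Scope ring_scope.

(* If T is a compact operator annihilating Psi(kappa) (resp. Phi(kappa)) with kappa =
   rho(kappa1 x kappa2), choose a, b in L^2 of the second coordinates such that the partial matrix
   coefficient f |-> \int T(f (x) a)(., y2) b(y2) dy2 does not vanish; it is compact, and it
   annihilates Psi(kappa1) (resp. Phi(kappa1)), because h |-> h (x) (a (x) b) maps this space to the
   corresponding one for kappa.

   Conversely T1 (x) T2 is compact and nonzero. For M_1-sets, expand T1 along an orthonormal
   sequence e_k: <T1 (x) T2, h> = <T2, R>, where R(x2, y2) = <T1, h((., x2), (., y2))> vanishes on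
   kappa2 since the slices of h vanish on kappa1. For M-sets, let h vanish on an omega-open E that
   contains kappa. Then E, together with rectangles on which T1 (x) 1 or 1 (x) T2 vanishes, covers
   everything up to a marginally null set. As the measures are tight, large compact rectangles
   K x L have finite subcovers, whence <T1 (x) T2, 1_(K x L) h> = 0 by cutting K x L into finitely
   many rectangles, and K x L exhausts the space. *)

(** * Semi-inner product spaces *)

(** [L2] consists of functions, not classes, and [pairing] is evaluated on a chosen representation
    of h. Hence all arguments live in spaces with a semi-inner product, up to vectors of norm 0, and
    the pairing has to be shown to depend on h alone, up to marginally null sets ([hpair_additive]);
    this is what allows h to be cut and approximated. The slice argument for M_1-sets does not carry
    over to M-sets. If h vanishes on E containing kappa, it shows that R vanishes on kappa2, but T2
    annihilates Psi(kappa2), and an omega-open neighbourhood of kappa2 on which R vanishes is not at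
    hand. The covering argument needs a finite cover, since cutting along infinitely many rectangles
    gives pieces whose sum need not converge in Gamma. The sides of the rectangles are merely
    measurable; compactness becomes usable after shrinking K and L until these sides are relatively
    open in them. Both factors provide rectangles that kill T1 (x) T2, because the complement of
    kappa is the union of the pullbacks of the complements of kappa1 and kappa2. *)

Notation Re := complex.Re.
Notation Im := complex.Im.
Notation cmod := ComplexField.Normc.normc.

Section complex_modulus.
Variable R : realType.
Implicit Types z w : R[i].

Lemma cmod_sqr z : cmod z ^+ 2 = Re z ^+ 2 + Im z ^+ 2.
Proof. by case: z => a b /=; rewrite sqr_sqrtr// addr_ge0// sqr_ge0. Qed.

Lemma cmod_ge0 z : 0 <= cmod z.
Proof. by case: z => a b /=; rewrite sqrtr_ge0. Qed.

Lemma cmodD z w : cmod (z + w) <= cmod z + cmod w.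
Proof. exact: le_normcD. Qed.

Lemma cmodN z : cmod (- z) = cmod z.
Proof. exact: normcN. Qed.

Lemma cmod_conj z : cmod (conjc z) = cmod z.
Proof. by case: z => a b /=; rewrite sqrrN. Qed.

Lemma cmodR (r : R) : cmod (r%:C)%C = `|r|.
Proof. by rewrite /= expr0n/= addr0 sqrtr_sqr. Qed.

Lemma normr_Re z : `|Re z| <= cmod z.
Proof.
by case: z => a b /=; rewrite -sqrtr_sqr ler_sqrt ?addr_ge0 ?sqr_ge0// lerDl sqr_ge0.
Qed.

Lemma normr_Im z : `|Im z| <= cmod z.
Proof.
by case: z => a b /=; rewrite -sqrtr_sqr ler_sqrt ?addr_ge0 ?sqr_ge0// lerDr sqr_ge0.
Qed.

Lemma cmod_le z : cmod z <= `|Re z| + `|Im z|.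
Proof.
rewrite -(@ler_pXn2r _ 2)// ?nnegrE ?addr_ge0 ?cmod_ge0//.
rewrite cmod_sqr sqrrD !real_normK ?num_real// lerD2r lerDl.
by rewrite mulrn_wge0// mulr_ge0.
Qed.

Lemma mulcJ z : z * conjc z = ((cmod z ^+ 2)%:C)%C.
Proof.
rewrite cmod_sqr; case: z => a b.
by apply/eqP; rewrite eq_complex /=; apply/andP; split; apply/eqP; ring.
Qed.

Lemma cmod_eq0 z : cmod z = 0 -> z = 0.
Proof. exact: ComplexField.Normc.eq0_normc. Qed.

Lemma ReD z w : Re (z + w) = Re z + Re w. Proof. by case: z; case: w. Qed.
Lemma ImD z w : Im (z + w) = Im z + Im w. Proof. by case: z; case: w. Qed.
Lemma ReN z : Re (- z) = - Re z. Proof. by case: z. Qed.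
Lemma ImN z : Im (- z) = - Im z. Proof. by case: z. Qed.
Lemma ReM z w : Re (z * w) = Re z * Re w - Im z * Im w.
Proof. by case: z; case: w. Qed.
Lemma ImM z w : Im (z * w) = Re z * Im w + Im z * Re w.
Proof. by case: z; case: w. Qed.
Lemma ReJ z : Re (conjc z) = Re z. Proof. by case: z. Qed.
Lemma ImJ z : Im (conjc z) = - Im z. Proof. by case: z. Qed.

Lemma complex_eq z w : Re z = Re w -> Im z = Im w -> z = w.
Proof. by case: z => a b; case: w => c d /= -> ->. Qed.

Lemma Re_sum I (r : seq I) (P : pred I) (F : I -> R[i]) :
  Re (\sum_(i <- r | P i) F i) = \sum_(i <- r | P i) Re (F i).
Proof. exact: (big_morph _ ReD). Qed.

Lemma Im_sum I (r : seq I) (P : pred I) (F : I -> R[i]) :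
  Im (\sum_(i <- r | P i) F i) = \sum_(i <- r | P i) Im (F i).
Proof. exact: (big_morph _ ImD). Qed.

Lemma cmod_sum I (r : seq I) (P : pred I) (F : I -> R[i]) :
  cmod (\sum_(i <- r | P i) F i) <= \sum_(i <- r | P i) cmod (F i).
Proof.
apply: (big_ind2 (fun a b => cmod a <= b)); first by rewrite ComplexField.Normc.normc0.
- by move=> a b c d ab cd; rewrite (le_trans (cmodD _ _))// lerD.
- by [].
Qed.

End complex_modulus.

(** * Subsequences and diagonal extraction *)

Definition increasing_nat (s : nat -> nat) := {homo s : m n / (m < n)%N}.

Lemma increasing_nat_ge s n : increasing_nat s -> (n <= s n)%N.
Proof. by move=> si; elim: n => // n IH; exact: leq_ltn_trans IH (si _ _ (ltnSn n)). Qed.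

Lemma increasing_natS s : (forall n, (s n < s n.+1)%N) -> increasing_nat s.
Proof. by move=> si; exact: (homo_ltn ltn_trans). Qed.

Lemma increasing_nat_comp s t :
  increasing_nat s -> increasing_nat t -> increasing_nat (s \o t).
Proof. by move=> si ti m n mn; apply: si; exact: ti. Qed.

(** Cantor's diagonal argument for properties [P k] that pass to subsequences and depend only on
    tails. The diagonal of the nested extractions is, from index k on, a subsequence of the k-th
    one. *)
Lemma diagonal_extraction (P : nat -> (nat -> nat) -> Prop) :
  (forall k s, increasing_nat s -> exists2 t, increasing_nat t & P k (s \o t)) ->
  (forall k s t, increasing_nat t -> P k s -> P k (s \o t)) ->
  (forall k m s, P k (fun n => s (n + m)%N) -> P k s) ->
  exists2 s, increasing_nat s & forall k, P k s.
Proof.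
move=> Pex Psub Pshift.
have /choice[next nextP] : forall ks : nat * (nat -> nat), exists t,
    increasing_nat ks.2 -> increasing_nat t /\ P ks.1 (ks.2 \o t).
  move=> [k s]; have [si|nsi] := pselect (increasing_nat s); last by exists id.
  by have [t ti tP] := Pex k s si; exists t.
pose fix S k := if k is k'.+1 then S k' \o next (k, S k') else next (0%N, id).
have Si k : increasing_nat (S k).
  elim: k => [|k IH] /=; first by have [] := nextP (0%N, id) (fun _ _ h => h).
  by apply: increasing_nat_comp => //; have [] := nextP (k.+1, S k) IH.
have SP k : P k (S k).
  case: k => [|k]; first by have [_] := nextP (0%N, id) (fun _ _ h => h).
  by have [_] := nextP (k.+1, S k) (Si k).
have nexti k : increasing_nat (next (k.+1, S k)).
  by have [] := nextP (k.+1, S k) (Si k).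
exists (fun n => S n n).
  apply: increasing_natS => n /=; apply: Si.
  exact: (increasing_nat_ge n.+1 (nexti n)).
move=> k; apply: (Pshift k k).
(* [T n] collects the refinements made between stages k and k + n, so that [S (k + n)] is [S k]
   composed with [T n]. *)
pose fix T n := if n is n'.+1 then T n' \o next ((k + n').+1, S (k + n')%N) else id.
have Ti n : increasing_nat (T n).
  elim: n => [|n IH]; first by move=> i j.
  exact: increasing_nat_comp IH (nexti _).
have ST n : S (k + n)%N = S k \o T n.
  elim: n => [|n IH]; first by rewrite addn0.
  by rewrite addnS /= [X in X \o _ = _]IH.
have -> : (fun n => S (n + k) (n + k)%N) = S k \o (fun n => T n (n + k)%N).
  by apply/funext => n; rewrite -[RHS]/((S k \o T n) (n + k)%N) -ST (addnC k n).
apply: Psub => //; apply: increasing_natS => n /=; apply: Ti.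
by rewrite addSn; exact: (increasing_nat_ge (n + k).+1 (nexti _)).
Qed.

(* Not separated: a vector of norm 0 need not be 0. *)
Record semiHilbert (R : realType) := SemiHilbert {
  shcar :> lmodType R[i] ;
  ip : shcar -> shcar -> R[i] ;
  ipDZl : forall a x y z, ip (a *: x + y) z = a * ip x z + ip y z ;
  ipC : forall x y, ip y x = conjc (ip x y) ;
  ip_ge0 : forall x, 0 <= Re (ip x x) }.

Section semiHilbert_theory.
Variables (R : realType) (H : semiHilbert R).
Implicit Types (x y z : H) (a b : R[i]).

Definition hn x : R := Num.sqrt (Re (ip x x)).

Lemma ip0l z : ip 0 z = 0.
Proof.
have := ipDZl (-1) (0 : H) 0 z.
by rewrite scaler0 addr0 mulN1r addNr.
Qed.

Lemma ipDl x y z : ip (x + y) z = ip x z + ip y z.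
Proof. by have := ipDZl 1 x y z; rewrite scale1r mul1r. Qed.

Lemma ipZl a x z : ip (a *: x) z = a * ip x z.
Proof. by have := ipDZl a x 0 z; rewrite addr0 ip0l addr0. Qed.

Lemma ipNl x z : ip (- x) z = - ip x z.
Proof. by rewrite -scaleN1r ipZl mulN1r. Qed.

Lemma ipBl x y z : ip (x - y) z = ip x z - ip y z.
Proof. by rewrite ipDl ipNl. Qed.

Lemma ipDr x y z : ip z (x + y) = ip z x + ip z y.
Proof. by rewrite ipC ipDl rmorphD /= -!ipC. Qed.

Lemma ipZr a x z : ip z (a *: x) = conjc a * ip z x.
Proof. by rewrite ipC ipZl rmorphM /= -ipC. Qed.

Lemma ipNr x z : ip z (- x) = - ip z x.
Proof. by rewrite ipC ipNl rmorphN /= -ipC. Qed.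

Lemma ipBr x y z : ip z (x - y) = ip z x - ip z y.
Proof. by rewrite ipDr ipNr. Qed.

Lemma ip_suml I (r : seq I) (P : pred I) (F : I -> H) z :
  ip (\sum_(i <- r | P i) F i) z = \sum_(i <- r | P i) ip (F i) z.
Proof. by apply: (big_morph (fun x => ip x z)) => [x y|]; rewrite ?ipDl ?ip0l. Qed.

Lemma hn_ge0 x : 0 <= hn x. Proof. exact: sqrtr_ge0. Qed.

Lemma hn_sqr x : hn x ^+ 2 = Re (ip x x).
Proof. by rewrite sqr_sqrtr// ip_ge0. Qed.

Lemma ipxx x : ip x x = ((hn x ^+ 2)%:C)%C.
Proof.
have := ipC x x; rewrite hn_sqr; case: (ip x x) => a b [] /= /eqP.
by rewrite -subr_eq0 opprK -mulr2n mulrn_eq0/= => /eqP ->.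
Qed.

Lemma hn_sqrDZ a x y : hn (a *: x + y) ^+ 2 =
  cmod a ^+ 2 * hn x ^+ 2 + (Re (a * ip x y)) *+ 2 + hn y ^+ 2.
Proof.
rewrite hn_sqr ipDl !ipDr !ipZl !ipZr (ipC x y) !ipxx cmod_sqr.
case: a => a b; case: (ip x y) => c d; rewrite !(ReM, ImM, ReD, ReJ, ImJ) /=.
by ring.
Qed.

Lemma hnZ a x : hn (a *: x) = cmod a * hn x.
Proof.
apply/eqP; rewrite -(@eqrXn2 _ 2)// ?mulr_ge0 ?cmod_ge0 ?hn_ge0//.
rewrite exprMn -[a *: x]addr0 hn_sqrDZ (hn_sqr 0) (ipC 0 x) !ip0l/= oppr0 mulr0.
by rewrite addr0 mul0rn addr0.
Qed.

Lemma hn0 : hn 0 = 0. Proof. by rewrite /hn ip0l sqrtr0. Qed.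

Lemma hnN x : hn (- x) = hn x.
Proof. by rewrite -scaleN1r hnZ cmodN ComplexField.Normc.normc1 mul1r. Qed.

Lemma hnB x y : hn (x - y) = hn (y - x).
Proof. by rewrite -opprB hnN. Qed.

Lemma cauchy_schwarz x y : cmod (ip x y) <= hn x * hn y.
Proof.
rewrite -(@ler_pXn2r _ 2)// ?nnegrE ?mulr_ge0 ?cmod_ge0 ?hn_ge0// exprMn.
set c := ip x y; set A := hn x ^+ 2; set B := hn y ^+ 2; set D := cmod c ^+ 2.
have D0 : 0 <= D by rewrite sqr_ge0.
have B0 : 0 <= B by rewrite sqr_ge0.
have A0 : 0 <= A by rewrite sqr_ge0.
have key (t : R) : 0 <= t ^+ 2 * D * B - t * D *+ 2 + A.
  have := sqr_ge0 (hn ((- t%:C%C * c) *: y + x)).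
  rewrite hn_sqrDZ ComplexField.Normc.normcM cmodN cmodR exprMn real_normK ?num_real//.
  rewrite (ipC x y) -/c mulNr mulNr -mulrA mulcJ -/D ReN ReM/=.
  by rewrite mulNrn mulr0 subr0.
(* The quadratic in t is minimal at 1 / B. If B = 0, which can happen for a nonzero y, it is affine
   in t with slope -2 D, and t = (A + 1) / D makes it negative unless D = 0. *)
have [B1|B1] := ltP 0 B.
  have := key B^-1; rewrite -mulrA [D * B]mulrC mulrA.
  have -> : B^-1 ^+ 2 * B = B^-1 by rewrite expr2 -mulrA mulVf ?mulr1// gt_eqF.
  rewrite mulr2n opprD addrA subrr add0r addrC subr_ge0.
  by rewrite mulrC ler_pdivrMr.
have {B1 B0}BE : B = 0 by apply/eqP; rewrite eq_le B0 B1.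
rewrite BE mulr0; rewrite leNgt; apply/negP => D1.
have := key ((A + 1) / D); rewrite BE mulr0 add0r divfK ?gt_eqF//.
by move=> h; nra.
Qed.

Lemma hnD x y : hn (x + y) <= hn x + hn y.
Proof.
rewrite -(@ler_pXn2r _ 2)// ?nnegrE ?addr_ge0 ?hn_ge0//.
rewrite -[x in hn (x + _)]scale1r hn_sqrDZ ComplexField.Normc.normc1 expr1n !mul1r sqrrD.
rewrite lerD2r lerD2l lerMn2r /= (le_trans (ler_norm _))//.
by rewrite (le_trans (normr_Re _))// cauchy_schwarz.
Qed.

Lemma hn_triangle x y z : hn (x - z) <= hn (x - y) + hn (y - z).
Proof. by rewrite -(subrKA y x) hnD. Qed.

Lemma hn_sum I (r : seq I) (P : pred I) (F : I -> H) :
  hn (\sum_(i <- r | P i) F i) <= \sum_(i <- r | P i) hn (F i).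
Proof.
elim/big_rec2: _ => [|i s x _ xs]; first by rewrite hn0.
by rewrite (le_trans (hnD _ _))// lerD.
Qed.

Lemma hn_null_eq x y : hn (x - y) = 0 -> hn x = hn y.
Proof.
move=> xy; apply/eqP; rewrite eq_le; apply/andP; split.
  by rewrite -{1}[x](subrK y) (le_trans (hnD _ _))// xy add0r.
by rewrite -{1}[y](subrK x) (le_trans (hnD _ _))// hnB xy add0r.
Qed.

Lemma ip_nulll x y : hn x = 0 -> ip x y = 0.
Proof.
move=> x0; apply: cmod_eq0; apply/eqP; rewrite eq_le cmod_ge0 andbT.
by rewrite (le_trans (cauchy_schwarz _ _))// x0 mul0r.
Qed.

Lemma ip_nullr x y : hn y = 0 -> ip x y = 0.
Proof. by move=> y0; rewrite ipC ip_nulll// conjc0. Qed.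

Definition hcv (u : nat -> H) x := forall e : R, 0 < e ->
  exists N, forall n, (N <= n)%N -> hn (u n - x) < e.

Definition hcauchy (u : nat -> H) := forall e : R, 0 < e ->
  exists N, forall m n, (N <= m)%N -> (N <= n)%N -> hn (u m - u n) < e.

Lemma hcv_cauchy u x : hcv u x -> hcauchy u.
Proof.
move=> ux e e0; have [N hN] := ux (e / 2) (divr_gt0 e0 (ltr0Sn _ 1)).
exists N => m n /hN h1 /hN h2; rewrite (le_lt_trans (hn_triangle _ x _))//.
by rewrite [hn (x - _)]hnB (splitr e) ltrD.
Qed.

Lemma hcv_sub u x s : increasing_nat s -> hcv u x -> hcv (u \o s) x.
Proof.
move=> si ux e /ux[N hN]; exists N => n Nn; apply: hN.
exact: leq_trans Nn (increasing_nat_ge n si).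
Qed.

Lemma hcv_shift u x m : hcv (fun n => u (n + m)%N) x -> hcv u x.
Proof.
move=> ux e /ux[N hN]; exists (N + m)%N => n Nn.
have mn : (m <= n)%N by apply: leq_trans Nn; rewrite leq_addl.
by have := hN (n - m)%N; rewrite subnK//; apply; rewrite leq_subRL// addnC.
Qed.

Lemma hcvP u x : hcv u x <-> (fun n => hn (u n - x)) @ \oo --> (0 : R).
Proof.
split=> [ux|/cvgrPdist_lt ux].
  apply/cvgrPdist_lt => e /ux[N hN]; exists N => // n /hN.
  by rewrite sub0r normrN ger0_norm// hn_ge0.
move=> e /ux[N _ hN]; exists N => n /hN.
by rewrite sub0r normrN ger0_norm// hn_ge0.
Qed.

Definition orthosys (e : nat -> H) :=
  (forall i j, i <> j -> ip (e i) (e j) = 0) /\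
  (forall i, hn (e i) = 0 \/ hn (e i) = 1).

Definition proj (e : nat -> H) K x := \sum_(k < K) ip x (e k) *: e k.

Lemma projDZ e K a x y : proj e K (a *: x + y) = a *: proj e K x + proj e K y.
Proof.
rewrite /proj scaler_sumr -big_split/=; apply: eq_bigr => k _.
by rewrite ipDZl scalerDl scalerA.
Qed.

Lemma projB e K x y : proj e K (x - y) = proj e K x - proj e K y.
Proof. by rewrite addrC -scaleN1r projDZ scaleN1r addrC. Qed.

Section orthosys_theory.
Variables (e : nat -> H) (oe : orthosys e).

Lemma orthosys_ip x i : ip x (e i) * ip (e i) (e i) = ip x (e i).
Proof.
have [_ /(_ i)[h|h]] := oe; first by rewrite (ip_nullr _ h) mul0r.
by rewrite ipxx h expr1n mulr1.
Qed.

Lemma ip_proj K x j : ip (proj e K x) (e j) = if (j < K)%N then ip x (e j) else 0.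
Proof.
rewrite ip_suml; under eq_bigr do rewrite ipZl.
have [oe1 _] := oe; case: ifPn => [jK|].
  rewrite (bigD1 (Ordinal jK))//= orthosys_ip big1 ?addr0// => i ij.
  by rewrite oe1 ?mulr0// => h; move: ij; rewrite -val_eqE /= h eqxx.
rewrite -leqNgt => Kj; rewrite big1// => i _; rewrite oe1 ?mulr0// => h.
by move: Kj; rewrite -h leqNgt ltn_ord.
Qed.

Lemma ip_sub_proj K x y : ip (x - proj e K x) (proj e K y) = 0.
Proof.
rewrite ipC ip_suml big1 ?conjc0// => i _.
by rewrite ipZl [ip (e i) _]ipC ipBl ip_proj ltn_ord subrr conjc0 mulr0.
Qed.

Lemma hn_proj_sqr K x : hn (proj e K x) ^+ 2 = \sum_(k < K) cmod (ip x (e k)) ^+ 2.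
Proof.
rewrite hn_sqr {1}/proj ip_suml Re_sum; apply: eq_bigr => i _.
by rewrite ipZl [ip (e i) _]ipC ip_proj ltn_ord mulcJ.
Qed.

Lemma pythagoras K x :
  hn x ^+ 2 = \sum_(k < K) cmod (ip x (e k)) ^+ 2 + hn (x - proj e K x) ^+ 2.
Proof.
rewrite -[x in LHS](subrK (proj e K x)) -[x - _ in LHS]scale1r hn_sqrDZ.
rewrite ip_sub_proj ComplexField.Normc.normc1 expr1n mul1r mulr0 /= mul0rn addr0.
by rewrite hn_proj_sqr addrC.
Qed.

Lemma bessel K x : \sum_(k < K) cmod (ip x (e k)) ^+ 2 <= hn x ^+ 2.
Proof. by rewrite (pythagoras K x) lerDl sqr_ge0. Qed.

Lemma hn_sub_proj_le K x : hn (x - proj e K x) <= hn x.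
Proof.
rewrite -(@ler_pXn2r _ 2)// ?nnegrE ?hn_ge0// [leRHS](pythagoras K) lerDr.
by rewrite sumr_ge0// => i _; rewrite sqr_ge0.
Qed.

Lemma hn_sub_proj_mono K L x : (K <= L)%N ->
  hn (x - proj e L x) <= hn (x - proj e K x).
Proof.
move=> KL; rewrite -(@ler_pXn2r _ 2)// ?nnegrE ?hn_ge0//.
rewrite -(lerD2l (\sum_(k < L) cmod (ip x (e k)) ^+ 2)) -pythagoras.
rewrite {1}(pythagoras K) lerD2r.
rewrite -!(big_mkord xpredT (fun k => cmod (ip x (e k)) ^+ 2)).
rewrite (big_cat_nat (n := K) (p := L))//= lerDl sumr_ge0// => i _.
by rewrite sqr_ge0.
Qed.

(** As y equals its projection up to norm 0, x and x - y have the same residual, and taking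
    residuals is a contraction. *)
Lemma best_approx K x y : hn (y - proj e K y) = 0 ->
  hn (x - proj e K x) <= hn (x - y).
Proof.
move=> y0; apply: le_trans (hn_sub_proj_le K (x - y)); rewrite projB.
rewrite le_eqVlt; apply/orP; left; apply/eqP/hn_null_eq.
by rewrite -y0 opprB addrA subrKA opprB addrC subrKA.
Qed.

End orthosys_theory.
End semiHilbert_theory.

Section gram_schmidt.
Variables (R : realType) (H : semiHilbert R).
Implicit Types (x y z : H) (s : seq H).

Let projs s x := \sum_(y <- s) ip x y *: y.

(** If the remainder w has norm 0, the inverse is 0 by convention and the next vector is 0, one of
    the two cases of [orthosys]. *)
Let gs_next (c : seq H -> H) s :=
  let w := c s - projs s (c s) in ((hn w)^-1%:C)%C *: w.

Let gs c := fix gs k := if k is k'.+1 then rcons (gs k') (gs_next c (gs k')) else [::].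

(* Adaptive: the next vector [c l] may depend on the vectors [l] constructed so far. *)
Lemma gram_schmidt (c : seq H -> H) : exists2 e : nat -> H, orthosys e &
  forall k, hn (c (mkseq e k) - proj e k.+1 (c (mkseq e k))) = 0.
Proof.
pose e k := gs_next c (gs c k).
have gsE k : gs c k = mkseq e k.
  by elim: k => // k IH; rewrite mkseqS -IH.
have projsE k x : projs (gs c k) x = proj e k x.
  by rewrite gsE /projs big_map -[k in iota _ k]subn0 -/(index_iota 0 k) big_mkord.
have eE k : e k = ((hn (c (gs c k) - proj e k (c (gs c k))))^-1%:C)%C *:
    (c (gs c k) - proj e k (c (gs c k))).
  by rewrite {1}/e /gs_next projsE.
have en k : hn (e k) = 0 \/ hn (e k) = 1.
  rewrite eE hnZ cmodR; set t := hn _.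
  have [->|t0] := eqVneq t 0; first by left; rewrite mulr0.
  by right; rewrite ger0_norm ?invr_ge0 ?hn_ge0// mulVf.
have eo k : forall i j, (i < k)%N -> (j < k)%N -> i <> j -> ip (e i) (e j) = 0.
  elim: k => // k IH.
  have IHk i : (i < k)%N -> ip (e k) (e i) = 0.
    move=> ik; rewrite eE ipZl ipBl ip_suml.
    rewrite (bigD1 (Ordinal ik))//= big1 ?addr0.
      have [h|h] := en i; first by rewrite !(ip_nullr _ h) subr0 mulr0.
      by rewrite ipZl ipxx h expr1n mulr1 subrr mulr0.
    move=> j ji; rewrite ipZl IH ?mulr0// => h.
    by move: ji; rewrite -val_eqE /= h eqxx.
  move=> i j; rewrite ltnS leq_eqVlt => /orP[/eqP->|ik];
    rewrite ltnS leq_eqVlt => /orP[/eqP->|jk] ij.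
  - by case: (ij erefl).
  - exact: IHk.
  - by rewrite ipC IHk// conjc0.
  - exact: IH.
exists e.
  split=> // i j; exact: (eo (maxn i j).+1 i j (leq_maxl _ _) (leq_maxr _ _)).
move=> k; rewrite -gsE; set v := c _.
rewrite /proj big_ord_recr /= -/(proj e k v) opprD addrA.
set w := v - proj e k v.
have -> : ip v (e k) = ip w (e k).
  rewrite ipBl [X in _ = _ - X]ip_suml big1 ?subr0// => i _.
  rewrite ipZl (eo k.+1)// ?mulr0 ?ltnS 1?ltnW// => ik.
  by have := ltn_ord i; rewrite ik ltnn.
rewrite eE -/v -/w ipZr ipxx scalerA conjc_real.
(* A remainder of norm 0 yields the vector 0, and the residual is w itself; otherwise the component
   along [e k] is exactly w. *)
have [t0|t0] := eqVneq (hn w) 0.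
  by rewrite t0 invr0 !mul0r scale0r subr0.
rewrite -!rmorphM /= (_ : _ * _ = 1) ?scale1r ?subrr ?hn0//.
by field.
Qed.

(** The plain process: the index of the vector to be treated is the number of vectors constructed so
    far. *)
Lemma gram_schmidt_seq (v : nat -> H) : exists2 e : nat -> H, orthosys e &
  forall k K, (k < K)%N -> hn (v k - proj e K (v k)) = 0.
Proof.
have [e oe ev] := gram_schmidt (fun s => v (size s)).
exists e => // k K kK; apply/eqP; rewrite eq_le hn_ge0 andbT.
have := ev k; rewrite size_mkseq => <-; exact: hn_sub_proj_mono.
Qed.

End gram_schmidt.

(** * Bounded and compact maps *)

Section bounded_maps.
Variable R : realType.

(* Vectors are functions rather than classes, so linearity holds up to vectors of norm 0. *)
Definition blinear (V W : semiHilbert R) (A : V -> W) (M : R) :=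
  [/\ forall a x y, hn (A (a *: x + y) - (a *: A x + A y)) = 0,
      0 <= M & forall x, hn (A x) <= M * hn x].

Definition hcompact (V W : semiHilbert R) (A : V -> W) :=
  forall u : nat -> V, (forall n, hn (u n) <= 1) ->
    exists s v, increasing_nat s /\ hcv (A \o u \o s) v.

Section one_map.
Variables (V W : semiHilbert R) (A : V -> W) (M : R) (bA : blinear A M).

Lemma blinear_comb a x y : hn (A (a *: x + y) - (a *: A x + A y)) = 0.
Proof. by have [h _ _] := bA. Qed.

Lemma blinear_le x : hn (A x) <= M * hn x.
Proof. by have [_ _ h] := bA. Qed.

Lemma blinear_null x : hn x = 0 -> hn (A x) = 0.
Proof.
by move=> x0; apply/eqP; rewrite eq_le hn_ge0 andbT (le_trans (blinear_le x))// x0 mulr0.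
Qed.

Lemma blinearB x y : hn (A (x - y) - (A x - A y)) = 0.
Proof. by have := blinear_comb (-1) y x; rewrite !scaleN1r [- y + x]addrC [- A y + _]addrC. Qed.

Lemma blinearD x y : hn (A (x + y) - (A x + A y)) = 0.
Proof. by have := blinear_comb 1 x y; rewrite !scale1r. Qed.

Lemma blinearZ a x : hn (A (a *: x) - a *: A x) = 0.
Proof.
have := blinear_comb a x 0; rewrite addr0 opprD addrA => h.
have h0 : hn (A 0) = 0 by apply: blinear_null; exact: hn0.
by rewrite (@hn_null_eq _ _ _ (A (a *: x) - a *: A x - A 0))// subKr.
Qed.

Lemma blinear_sub_le x y : hn (A x - A y) <= M * hn (x - y).
Proof. by rewrite -(hn_null_eq (blinearB x y)) blinear_le. Qed.

Lemma blinear_hcv u x : hcv u x -> hcv (A \o u) (A x).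
Proof.
have [_ M0 _] := bA => ux e e0.
have M1 : 0 < M + 1 by rewrite ltr_wpDl.
have [N hN] := ux (e / (M + 1)) (divr_gt0 e0 M1).
exists N => n /hN; rewrite ltr_pdivlMr// mulrC => h.
rewrite (le_lt_trans (blinear_sub_le _ _))// (le_lt_trans _ h)//.
by rewrite ler_wpM2r ?hn_ge0// lerDl.
Qed.

Lemma blinear_sum I (r : seq I) (P : pred I) (F : I -> V) :
  hn (A (\sum_(i <- r | P i) F i) - \sum_(i <- r | P i) A (F i)) = 0.
Proof.
elim/big_rec2: _ => [|i y x _ xy]; first by rewrite subr0; apply: blinear_null; exact: hn0.
apply/eqP; rewrite eq_le hn_ge0 andbT.
rewrite (le_trans (hn_triangle _ (A (F i) + A x) _))// blinearD add0r.
by rewrite opprD addrA [A (F i) + A x]addrC addrK xy.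
Qed.

(** The system is built greedily: each new vector comes from a point of the unit ball whose image
    has, up to a factor 2, the largest residual off the span reached so far. By compactness two of
    these images are close, and the later one then has a small residual; hence so have all
    others. *)
Lemma hcompact_approx : hcompact A -> exists2 e : nat -> W, orthosys e &
  forall d : R, 0 < d -> exists K, forall x, hn (A x - proj e K (A x)) <= d * hn x.
Proof.
move=> cA; have [_ M0 _] := bA.
have /choice[c cP] : forall s : seq W, exists x : V, hn x <= 1 /\
    forall y : V, hn y <= 1 -> hn (A y - \sum_(w <- s) ip (A y) w *: w) <=
      hn (A x - \sum_(w <- s) ip (A x) w *: w) *+ 2.
  move=> s; pose f x := hn (A x - \sum_(w <- s) ip (A x) w *: w).
  pose S := [set f x | x in [set x : V | hn x <= 1]].
  pose B := M + \sum_(w <- s) M * hn w * hn w.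
  have SB : ubound S B.
    move=> _ [x x1 <-]; rewrite /f (le_trans (hnD _ _))// hnN.
    have AxM : hn (A x) <= M by rewrite (le_trans (blinear_le x))// ler_piMr.
    rewrite lerD// (le_trans (hn_sum _ _ _))// ler_sum// => w _.
    rewrite hnZ ler_wpM2r ?hn_ge0// (le_trans (cauchy_schwarz _ _))//.
    by rewrite ler_wpM2r ?hn_ge0.
  have S0 : S (f 0) by exists 0 => //=; rewrite hn0.
  have hS : has_sup S by split; [exists (f 0)|exists B].
  (* If the supremum is not positive, all residuals vanish and the point 0 will do; otherwise some
     residual exceeds half of it, whence the factor 2. *)
  have [sS|sS] := leP (sup S) 0.
    exists 0; rewrite hn0; split => // y y1.
    have /ub_le_sup : has_ubound S by exists B.
    move=> /(_ (f y)) h; rewrite (le_trans (h _))//; first by exists y.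
    by rewrite (le_trans sS)// mulrn_wge0// hn_ge0.
  have [_ [x /= x1 <-] fx] := @sup_adherent _ S (sup S / 2) (divr_gt0 sS (ltr0Sn _ 1)) hS.
  exists x; split=> // y y1.
  have /ub_le_sup : has_ubound S by exists B.
  move=> /(_ (f y)) h; have {}h : f y <= sup S by apply: h; exists y.
  rewrite -/(f y) -/(f x) mulr2n; lra.
have [e oe ev] := gram_schmidt (fun s => A (c s)); exists e => // d d0.
pose u k := c (mkseq e k).
have u1 k : hn (u k) <= 1 by have [] := cP (mkseq e k).
have uP k y : hn y <= 1 -> hn (A y - proj e k (A y)) <= hn (A (u k) - proj e k (A (u k))) *+ 2.
  move=> y1; have [_ /(_ y y1)] := cP (mkseq e k).
  by rewrite !big_map -[k in iota _ k]subn0 -/(index_iota 0 k) !big_mkord.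
have [s [v [si /hcv_cauchy Auv]]] := cA u u1.
have d20 : 0 < d / 2 by rewrite divr_gt0.
have [N hN] := Auv _ d20; exists (s N.+1) => x.
(* Since s N < s N.+1, the image of [u (s N)] lies in the span of the first [s N.+1] vectors, so the
   residual is at most the distance between the two images. *)
have {}hN : hn (A (u (s N.+1)) - proj e (s N.+1) (A (u (s N.+1)))) < d / 2.
  apply: le_lt_trans (hN N.+1 N _ _) => //=; apply: (best_approx oe).
  apply/eqP; rewrite eq_le hn_ge0 andbT -(ev (s N)).
  exact: (hn_sub_proj_mono oe _ (si _ _ (ltnSn N))).
have main y : hn y <= 1 -> hn (A y - proj e (s N.+1) (A y)) <= d.
  by move=> /uP h; rewrite (le_trans (h _))// mulr2n; lra.
(* The bound is known on the unit ball and extends by scaling; vectors of norm 0 cannot be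
   normalised and are treated apart. *)
have [x0|x0] := eqVneq (hn x) 0.
  by rewrite (le_trans (hn_sub_proj_le oe _ _))// blinear_null// mulr_ge0 ?hn_ge0 ?ltW.
have xn0 : 0 < hn x by rewrite lt_def x0 hn_ge0.
set t := (((hn x)^-1)%:C)%C.
have ct : cmod t = (hn x)^-1 by rewrite cmodR ger0_norm// invr_ge0 hn_ge0.
have := main (t *: x); rewrite hnZ ct mulVf// lexx => /(_ isT).
set K := s N.+1 => h.
have : hn (t *: (A x - proj e K (A x))) <= d.
  apply: le_trans h; rewrite le_eqVlt; apply/orP; left; apply/eqP/hn_null_eq.
  have -> : t *: (A x - proj e K (A x)) - (A (t *: x) - proj e K (A (t *: x))) =
      (t *: A x - A (t *: x)) - proj e K (t *: A x - A (t *: x)).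
    have pZ : proj e K (t *: A x) = t *: proj e K (A x).
      by have := projDZ e K t (A x) 0; rewrite !addr0 /proj [X in _ + X]big1 ?addr0// => i _;
        rewrite ip0l scale0r.
    by rewrite projB pZ scalerBr !opprB addrACA [RHS]addrACA; congr (_ + _); rewrite addrC.
  apply/eqP; rewrite eq_le hn_ge0 andbT -(blinearZ t x) [leRHS]hnB.
  exact: hn_sub_proj_le.
by rewrite hnZ ct mulrC ler_pdivrMr.
Qed.

End one_map.
End bounded_maps.

(** * Square integrable functions *)

Section L2_functions.
Context (R : realType) (d : measure_display) (X : measurableType d).
Variable mu : {measure set X -> \bar R}.
Implicit Types f g h : X -> R[i].

Lemma cmeasurable_cst (c : R[i]) : cmeasurable (fun _ : X => c).
Proof. by split; exact: measurable_cst. Qed.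

Lemma cmeasurableD f g : cmeasurable f -> cmeasurable g ->
  cmeasurable (fun x => f x + g x).
Proof.
move=> [f1 f2] [g1 g2]; split.
  by under eq_fun do rewrite ReD; exact: measurable_funD.
by under eq_fun do rewrite ImD; exact: measurable_funD.
Qed.

Lemma cmeasurableM f g : cmeasurable f -> cmeasurable g ->
  cmeasurable (fun x => f x * g x).
Proof.
move=> [f1 f2] [g1 g2]; split.
  by under eq_fun do rewrite ReM; apply: measurable_funB; exact: measurable_funM.
by under eq_fun do rewrite ImM; apply: measurable_funD; exact: measurable_funM.
Qed.

Lemma cmeasurableZ (c : R[i]) f : cmeasurable f -> cmeasurable (fun x => c * f x).
Proof. by apply: cmeasurableM; exact: cmeasurable_cst. Qed.

Lemma cmeasurableN f : cmeasurable f -> cmeasurable (fun x => - f x).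
Proof.
move=> mf; under eq_fun do rewrite -mulN1r.
exact: cmeasurableZ.
Qed.

Lemma cmeasurableB f g : cmeasurable f -> cmeasurable g ->
  cmeasurable (fun x => f x - g x).
Proof. by move=> mf mg; apply: cmeasurableD => //; exact: cmeasurableN. Qed.

Lemma cmeasurableJ f : cmeasurable f -> cmeasurable (fun x => conjc (f x)).
Proof.
move=> [f1 f2]; split; first by under eq_fun do rewrite ReJ.
by under eq_fun do rewrite ImJ; exact: measurableT_comp.
Qed.

Lemma measurable_cmod2 f : cmeasurable f ->
  measurable_fun setT (fun x => cmod (f x) ^+ 2).
Proof.
move=> [f1 f2]; under eq_fun do rewrite cmod_sqr.
by apply: measurable_funD; exact: measurable_funX.
Qed.

Lemma measurable_cmod f : cmeasurable f -> measurable_fun setT (fun x => cmod (f x)).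
Proof.
move=> mf; rewrite [X in measurable_fun _ X](_ : _ = fun x => (cmod (f x) ^+ 2) `^ 2^-1); last first.
  by apply/funext => x; rewrite powR12_sqrt ?sqr_ge0// sqrtr_sqr ger0_norm// cmod_ge0.
rewrite -[X in measurable_fun _ X]/((@powR R ^~ 2^-1) \o (fun x => cmod (f x) ^+ 2)).
apply: measurableT_comp; [exact: measurable_powR|exact: measurable_cmod2].
Qed.

Lemma measurable_ecmod2 f : cmeasurable f ->
  measurable_fun setT (fun x => (cmod (f x) ^+ 2)%:E).
Proof. by move=> mf; apply/measurable_EFinP; exact: measurable_cmod2. Qed.

Definition cindic (A : set X) : X -> R[i] := fun x => ((\1_A x)%:C)%C.

Lemma cmeasurable_indic A : measurable A -> cmeasurable (cindic A).
Proof. by move=> mA; split => /=; [exact: measurable_indic|exact: measurable_cst]. Qed.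

(** The squared norm with values in the extended reals: Tonelli's theorem applies to it before
    membership in [L2] is known. *)
Definition nsq f : \bar R := (\int[mu]_x (cmod (f x) ^+ 2)%:E)%E.

Lemma nsq_ge0 f : (0 <= nsq f)%E.
Proof. by apply: integral_ge0 => x _; rewrite lee_fin sqr_ge0. Qed.

Lemma L2norm_nsq f : L2norm mu f = (nsq f `^ 2^-1)%E.
Proof.
rewrite /L2norm unlock; congr (_ `^ _)%E; apply: eq_integral => x _.
rewrite abse_EFin poweR_EFin -[2%R]/(2%:R) powR_mulrn ?normr_ge0//.
by rewrite ger0_norm// cmod_ge0.
Qed.

Lemma L2P f : L2 mu f <-> cmeasurable f /\ (nsq f < +oo)%E.
Proof.
suff H : (L2norm mu f < +oo)%E <-> (nsq f < +oo)%E.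
  by split=> -[? ?]; split=> //; exact/H.
rewrite L2norm_nsq; case: (nsq f) (nsq_ge0 f) => [r|_|//].
  by rewrite poweR_EFin !ltry.
by rewrite poweRyr ?invr_neq0.
Qed.

Lemma L2_cmeasurable f : L2 mu f -> cmeasurable f. Proof. by case. Qed.

Lemma nsqZ (c : R[i]) f : cmeasurable f ->
  nsq (fun x => c * f x) = ((cmod c ^+ 2)%:E * nsq f)%E.
Proof.
move=> mf; rewrite /nsq.
under eq_integral do rewrite ComplexField.Normc.normcM exprMn EFinM.
rewrite ge0_integralZl_EFin ?sqr_ge0//; first by move=> x _; rewrite lee_fin sqr_ge0.
exact: measurable_ecmod2.
Qed.

Lemma cmodD_sqr (z w : R[i]) : cmod (z + w) ^+ 2 <= 2 * (cmod z ^+ 2 + cmod w ^+ 2).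
Proof.
rewrite !cmod_sqr ReD ImD.
have := sqr_ge0 (Re z - Re w); have := sqr_ge0 (Im z - Im w); nra.
Qed.

Lemma nsqD f g : cmeasurable f -> cmeasurable g ->
  (nsq (fun x => f x + g x)%R <= 2%:E * (nsq f + nsq g))%E.
Proof.
move=> mf mg; rewrite /nsq -ge0_integralD//.
- rewrite -ge0_integralZl_EFin//.
  + apply: ge0_le_integral => //.
    * by move=> x _; rewrite lee_fin sqr_ge0.
    * by apply: measurable_ecmod2; exact: cmeasurableD.
    * apply: measurable_funeM; apply: emeasurable_funD; exact: measurable_ecmod2.
    * by move=> x _; rewrite -EFinD -EFinM lee_fin cmodD_sqr.
  + by move=> x _; rewrite -EFinD lee_fin addr_ge0// sqr_ge0.
  + apply: emeasurable_funD; exact: measurable_ecmod2.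
- by move=> x _; rewrite lee_fin sqr_ge0.
- exact: measurable_ecmod2.
- by move=> x _; rewrite lee_fin sqr_ge0.
- exact: measurable_ecmod2.
Qed.

Lemma nsq_le f g : cmeasurable f -> cmeasurable g ->
  (forall x, cmod (f x) <= cmod (g x)) -> (nsq f <= nsq g)%E.
Proof.
move=> mf mg fg; apply: ge0_le_integral => //.
- by move=> x _; rewrite lee_fin sqr_ge0.
- exact: measurable_ecmod2.
- exact: measurable_ecmod2.
- by move=> x _; rewrite lee_fin lerXn2r// nnegrE cmod_ge0.
Qed.

Lemma L2_le f g : cmeasurable f -> L2 mu g ->
  (forall x, cmod (f x) <= cmod (g x)) -> L2 mu f.
Proof.
move=> mf /L2P[mg lg] fg; apply/L2P; split=> //.
by rewrite (le_lt_trans _ lg)// nsq_le.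
Qed.

Lemma L2_0 : L2 mu (fun=> 0).
Proof.
apply/L2P; split; first exact: cmeasurable_cst.
rewrite /nsq; under eq_integral do rewrite ComplexField.Normc.normc0 expr0n/=.
by rewrite integral0 ltry.
Qed.

Lemma L2D f g : L2 mu f -> L2 mu g -> L2 mu (fun x => f x + g x).
Proof.
move=> /L2P[mf lf] /L2P[mg lg]; apply/L2P; split; first exact: cmeasurableD.
rewrite (le_lt_trans (nsqD mf mg))// lte_mul_pinfty//.
by rewrite lte_add_pinfty.
Qed.

Lemma L2Z (c : R[i]) f : L2 mu f -> L2 mu (fun x => c * f x).
Proof.
move=> /L2P[mf lf]; apply/L2P; split; first exact: cmeasurableZ.
by rewrite nsqZ// lte_mul_pinfty// lee_fin sqr_ge0.
Qed.

Lemma L2N f : L2 mu f -> L2 mu (fun x => - f x).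
Proof. by move=> lf; under eq_fun do rewrite -mulN1r; exact: L2Z. Qed.

Lemma L2B f g : L2 mu f -> L2 mu g -> L2 mu (fun x => f x - g x).
Proof. by move=> lf lg; apply: L2D => //; exact: L2N. Qed.

Lemma L2J f : L2 mu f -> L2 mu (fun x => conjc (f x)).
Proof.
move=> lf; apply: (@L2_le _ f) => [|//|x]; last by rewrite cmod_conj.
by apply: cmeasurableJ; exact: L2_cmeasurable lf.
Qed.

Definition cintegrable f :=
  mu.-integrable setT (fun x => (Re (f x))%:E) /\
  mu.-integrable setT (fun x => (Im (f x))%:E).

Lemma cintegrableP f : cmeasurable f ->
  (\int[mu]_x (cmod (f x))%:E < +oo)%E -> cintegrable f.
Proof.
move=> mf lf; have mcmod : measurable_fun setT (fun x => (cmod (f x))%:E).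
  by apply/measurable_EFinP; exact: measurable_cmod.
have H : mu.-integrable setT (fun x => (cmod (f x))%:E).
  apply/integrableP; split=> //.
  by under eq_integral do rewrite abse_EFin ger0_norm ?cmod_ge0//.
have [f1 f2] := mf; split; apply: le_integrable H => //.
- exact/measurable_EFinP.
- by move=> x _; rewrite !abse_EFin lee_fin (ger0_norm (cmod_ge0 _)) normr_Re.
- exact/measurable_EFinP.
- by move=> x _; rewrite !abse_EFin lee_fin (ger0_norm (cmod_ge0 _)) normr_Im.
Qed.

Lemma L2_cintegrableM f g : L2 mu f -> L2 mu g -> cintegrable (fun x => f x * g x).
Proof.
move=> /L2P[mf lf] /L2P[mg lg]; apply: cintegrableP; first exact: cmeasurableM.
apply: (@le_lt_trans _ _ (nsq f + nsq g)%E); last by rewrite lte_add_pinfty.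
rewrite /nsq -ge0_integralD//; try exact: measurable_ecmod2;
  try by move=> x _; rewrite lee_fin sqr_ge0.
have mfg := cmeasurableM mf mg.
apply: ge0_le_integral => //.
- by move=> x _; rewrite lee_fin cmod_ge0.
- by apply/measurable_EFinP; exact: measurable_cmod.
- apply: emeasurable_funD; exact: measurable_ecmod2.
- move=> x _; rewrite -EFinD lee_fin ComplexField.Normc.normcM.
  have := sqr_ge0 (cmod (f x) - cmod (g x)); have := cmod_ge0 (f x); have := cmod_ge0 (g x); nra.
Qed.

End L2_functions.

Section complex_integral.
Context (R : realType) (d : measure_display) (X : measurableType d).
Variable mu : {measure set X -> \bar R}.
Implicit Types f g h : X -> R[i].

Lemma cintegralE f : cintegral mu f =
  Complex (\int[mu]_x Re (f x)) (\int[mu]_x Im (f x)).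
Proof. by []. Qed.

Lemma eq_cintegral f g : (forall x, f x = g x) -> cintegral mu f = cintegral mu g.
Proof. by move=> fg; congr cintegral; exact/funext. Qed.

Lemma cintegralDZ (c : R[i]) f g : cintegrable mu f -> cintegrable mu g ->
  cintegral mu (fun x => c * f x + g x) = c * cintegral mu f + cintegral mu g.
Proof.
move=> [f1 f2] [g1 g2].
have iZ (r : R) (h : X -> R) : mu.-integrable setT (EFin \o h) ->
    mu.-integrable setT (EFin \o (fun x => r * h x)).
  by move=> hi; rewrite [X in _.-integrable _ X](_ : _ = fun x => (r%:E * (h x)%:E)%E)//;
    exact: integrableZl.
have iB (h k : X -> R) : mu.-integrable setT (EFin \o h) ->
    mu.-integrable setT (EFin \o k) -> mu.-integrable setT (EFin \o (fun x => h x - k x)).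
  move=> hi ki; rewrite (_ : _ \o _ = ((EFin \o h) \- (EFin \o k))%E)//.
  exact: integrableB.
have iD (h k : X -> R) : mu.-integrable setT (EFin \o h) ->
    mu.-integrable setT (EFin \o k) -> mu.-integrable setT (EFin \o (fun x => h x + k x)).
  move=> hi ki; rewrite (_ : _ \o _ = ((EFin \o h) \+ (EFin \o k))%E)//.
  exact: integrableD.
apply: complex_eq; rewrite ?ReD ?ImD ?ReM ?ImM /=.
- under eq_Rintegral do rewrite ReD ReM.
  rewrite RintegralD ?RintegralB ?RintegralZl//; try exact: iZ.
  by apply: iB; exact: iZ.
- under eq_Rintegral do rewrite ImD ImM.
  rewrite RintegralD ?RintegralD ?RintegralZl//; try exact: iZ.
  by apply: iD; exact: iZ.
Qed.

Lemma cintegrable0 : cintegrable mu (fun=> 0).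
Proof. by split; exact: integrable0. Qed.

Lemma cintegral0 : cintegral mu (fun=> 0) = 0.
Proof. by rewrite cintegralE /= /Rintegral !integral0. Qed.

Lemma cintegralZ (c : R[i]) f : cintegrable mu f ->
  cintegral mu (fun x => c * f x) = c * cintegral mu f.
Proof.
move=> fi; have := cintegralDZ c fi cintegrable0.
by rewrite cintegral0 addr0; under eq_fun do rewrite addr0.
Qed.

Lemma cintegral_conj f : cintegrable mu f ->
  cintegral mu (fun x => conjc (f x)) = conjc (cintegral mu f).
Proof.
move=> [f1 f2]; apply: complex_eq; rewrite /= ?ReJ ?ImJ.
  by under eq_Rintegral do rewrite ReJ.
under eq_Rintegral do rewrite ImJ -mulN1r.
by rewrite RintegralZl// mulN1r.
Qed.

Lemma ae_eq_cintegral f g : cmeasurable f -> cmeasurable g ->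
  (\forall x \ae mu, f x = g x) -> cintegral mu f = cintegral mu g.
Proof.
move=> [f1 f2] [g1 g2] fg; rewrite !cintegralE /Rintegral.
congr (Complex (fine _) (fine _)); apply: ae_eq_integral => //.
- exact/measurable_EFinP.
- exact/measurable_EFinP.
- by move: fg; apply: filterS => x ->.
- exact/measurable_EFinP.
- exact/measurable_EFinP.
- by move: fg; apply: filterS => x ->.
Qed.

Lemma ae_eq_nsq f g : cmeasurable f -> cmeasurable g ->
  (\forall x \ae mu, f x = g x) -> nsq mu f = nsq mu g.
Proof.
move=> mf mg fg; apply: ae_eq_integral => //; try exact: measurable_ecmod2.
by move: fg; apply: filterS => x ->.
Qed.

Lemma nsq_eq0 f : cmeasurable f -> nsq mu f = 0%E <-> (\forall x \ae mu, f x = 0).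
Proof.
move=> mf; have := ae_eq_integral_abs mu measurableT (measurable_ecmod2 mf).
have -> : (\int[mu]_x `|(cmod (f x) ^+ 2)%:E|)%E = nsq mu f.
  by apply: eq_integral => x _; rewrite abse_EFin ger0_norm// sqr_ge0.
move=> ->; split; apply: filterS => x.
  by move=> /(_ I) [] /eqP; rewrite expf_eq0/= => /eqP/cmod_eq0.
by move=> -> _; rewrite ComplexField.Normc.normc0 expr0n.
Qed.

End complex_integral.

Section L2_space.
Context (R : realType) (d : measure_display) (X : measurableType d).
Variable mu : {measure set X -> \bar R}.

Record L2T := MkL2T { L2fun :> X -> R[i] ; L2funP : L2 mu L2fun }.

HB.instance Definition _ := gen_eqMixin L2T.
HB.instance Definition _ := gen_choiceMixin L2T.

Lemma L2T_eq (f g : L2T) : (forall x, f x = g x) -> f = g.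
Proof.
case: f => f fP; case: g => g gP /= fg.
have {}fg : f = g by exact/funext.
by subst g; congr MkL2T; exact: Prop_irrelevance.
Qed.

Let L2T0 := MkL2T (L2_0 mu).
Let L2Topp (f : L2T) := MkL2T (L2N (L2funP f)).
Let L2Tadd (f g : L2T) := MkL2T (L2D (L2funP f) (L2funP g)).
Let L2Tscale (c : R[i]) (f : L2T) := MkL2T (L2Z c (L2funP f)).

Let L2TaddA : associative L2Tadd.
Proof. by move=> f g h; apply: L2T_eq => x /=; rewrite addrA. Qed.
Let L2TaddC : commutative L2Tadd.
Proof. by move=> f g; apply: L2T_eq => x /=; rewrite addrC. Qed.
Let L2Tadd0 : left_id L2T0 L2Tadd.
Proof. by move=> f; apply: L2T_eq => x /=; rewrite add0r. Qed.
Let L2TaddN : left_inverse L2T0 L2Topp L2Tadd.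
Proof. by move=> f; apply: L2T_eq => x /=; rewrite addNr. Qed.

HB.instance Definition _ := GRing.isZmodule.Build L2T L2TaddA L2TaddC L2Tadd0 L2TaddN.

Let L2TscaleA (a b : R[i]) f : L2Tscale a (L2Tscale b f) = L2Tscale (a * b) f.
Proof. by apply: L2T_eq => x /=; rewrite mulrA. Qed.
Let L2Tscale1 : left_id 1 L2Tscale.
Proof. by move=> f; apply: L2T_eq => x /=; rewrite mul1r. Qed.
Let L2TscaleDr : right_distributive L2Tscale +%R.
Proof. by move=> a f g; apply: L2T_eq => x /=; rewrite mulrDr. Qed.
Let L2TscaleDl f : {morph L2Tscale^~ f : a b / a + b}.
Proof. by move=> a b; apply: L2T_eq => x /=; rewrite mulrDl. Qed.

HB.instance Definition _ := GRing.Zmodule_isLmodule.Build R[i] L2T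
  L2TscaleA L2Tscale1 L2TscaleDr L2TscaleDl.

Let L2ip (f g : L2T) : R[i] := L2inner mu f g.

Lemma L2T_mulJ_cintegrable (f g : L2T) : cintegrable mu (fun x => f x * conjc (g x)).
Proof. by apply: L2_cintegrableM; [exact: L2funP|apply: L2J; exact: L2funP]. Qed.

Let L2ipDZl (a : R[i]) (f g h : L2T) : L2ip (a *: f + g) h = a * L2ip f h + L2ip g h.
Proof.
rewrite /L2ip /L2inner -cintegralDZ; try exact: L2T_mulJ_cintegrable.
by apply: eq_cintegral => x /=; rewrite mulrDl mulrA.
Qed.

Let L2ipC (f g : L2T) : L2ip g f = conjc (L2ip f g).
Proof.
rewrite /L2ip /L2inner -cintegral_conj; last exact: L2T_mulJ_cintegrable.
by apply: eq_cintegral => x /=; rewrite rmorphM/= conjcK mulrC.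
Qed.

Let L2ipE (f : L2T) : Re (L2ip f f) = fine (nsq mu f).
Proof.
rewrite /L2ip /L2inner /= /Rintegral; congr fine.
by apply: eq_integral => x _; rewrite mulcJ.
Qed.

Let L2ip_ge0 (f : L2T) : 0 <= Re (L2ip f f).
Proof. by rewrite L2ipE fine_ge0// nsq_ge0. Qed.

Definition L2S : semiHilbert R := SemiHilbert L2ipDZl L2ipC L2ip_ge0.

Lemma ip_L2 (f g : L2S) : ip f g = cintegral mu (fun x => (f : L2T) x * conjc ((g : L2T) x)).
Proof. by []. Qed.

Lemma nsq_hn (f : L2S) : nsq mu (f : L2T) = (hn f ^+ 2)%:E.
Proof.
rewrite hn_sqr [ip f f]/(L2ip f f) L2ipE fineK// ge0_fin_numE ?nsq_ge0//.
by have /L2P[] := L2funP f.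
Qed.

Lemma L2norm_hn (f : L2S) : L2norm mu (f : L2T) = (hn f)%:E.
Proof.
rewrite L2norm_nsq nsq_hn poweR_EFin powR12_sqrt ?sqr_ge0// sqrtr_sqr ger0_norm//.
exact: hn_ge0.
Qed.

Lemma hn_eq0 (f : L2S) : hn f = 0 <-> (\forall x \ae mu, (f : L2T) x = 0).
Proof.
rewrite -(@nsq_eq0 _ _ _ mu (f : L2T)); last by apply: L2_cmeasurable; exact: L2funP.
rewrite nsq_hn; split=> [->|[] /eqP]; first by rewrite expr0n.
by rewrite expf_eq0/= => /eqP.
Qed.

Lemma hn_sub_eq0 (f g : L2S) :
  hn (f - g) = 0 <-> (\forall x \ae mu, (f : L2T) x = (g : L2T) x).
Proof.
rewrite hn_eq0; split; apply: filterS => x /=; first by move/eqP; rewrite subr_eq0 => /eqP.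
by move=> ->; rewrite subrr.
Qed.

End L2_space.

(** * Completeness of L^2 *)

Section L2_complete.
Context (R : realType) (d : measure_display) (X : measurableType d).
Variable mu : {measure set X -> \bar R}.

Lemma ge0_integral_lty_ae (f : X -> \bar R) : measurable_fun setT f ->
  (forall x, 0 <= f x)%E -> (\int[mu]_x f x < +oo)%E ->
  \forall x \ae mu, (f x < +oo)%E.
Proof.
move=> mf f0 foo; have fi : mu.-integrable setT f.
  apply/integrableP; split=> //.
  by under eq_integral do rewrite gee0_abs//.
have := integrable_ae measurableT fi; apply: filterS => x /(_ I).
by rewrite ge0_fin_numE.
Qed.

(** Fatou's lemma for squared moduli. The bound is needed for large n, since only the lower limit of
    the integrals enters. *)
Lemma nsq_fatou (f : nat -> X -> R[i]) (g : X -> R[i]) (e : \bar R) :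
  (forall n, cmeasurable (f n)) ->
  (forall x, (fun n => Re (f n x)) @ \oo --> Re (g x)) ->
  (forall x, (fun n => Im (f n x)) @ \oo --> Im (g x)) ->
  (\forall n \near \oo, nsq mu (f n) <= e)%E -> (nsq mu g <= e)%E.
Proof.
move=> mf fg1 fg2 fe.
have fgx x : (fun n => (cmod (f n x) ^+ 2)%:E) @ \oo --> (cmod (g x) ^+ 2)%:E.
  apply: cvg_EFin; first exact: nearW.
  rewrite [X in X @ _ --> _](_ : _ = fun n => Re (f n x) ^+ 2 + Im (f n x) ^+ 2).
    by rewrite cmod_sqr; apply: cvgD; rewrite expr2 -?[X in nbhs (_ + X)]expr2;
      under eq_fun do rewrite expr2; apply: cvgM.
  by apply/funext => n /=; rewrite cmod_sqr.
have := @fatou _ _ _ mu setT measurableT (fun n x => (cmod (f n x) ^+ 2)%:E).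
move=> /(_ (fun n => measurable_ecmod2 (mf n))).
have f0 n x : setT x -> (0 <= (cmod (f n x) ^+ 2)%:E)%E.
  by move=> _; rewrite lee_fin sqr_ge0.
move=> /(_ f0); under eq_integral => x _.
  rewrite is_cvg_limn_einfE; last by apply/cvg_ex; eexists; exact: fgx.
  rewrite (cvg_lim _ (fgx x))//.
  over.
move=> /le_trans; apply; rewrite limn_einf_lim.
apply: lime_le; first exact: is_cvg_einfs.
move: fe => [N _ hN]; exists N => // n Nn; rewrite /einfs.
apply: le_trans (hN n Nn); apply: ereal_inf_lbound; exists n => //=.
Qed.

Theorem L2_complete (u : nat -> L2S mu) : hcauchy u -> exists v, hcv u v.
Proof.
move=> cu.
(* Increments of norm below 4^-k have squares of integral at most 16^-k, which stay summable with
   the weights 4^k. Where the weighted sum is finite, the k-th increment is at most a constant times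
   2^-k, so the sequence converges there. *)
pose q : R := 4^-1.
have q0 k : 0 < q ^+ k by rewrite exprn_gt0// invr_gt0.
have /choice[N HN] : forall k, exists N, forall m n, (N <= m)%N -> (N <= n)%N ->
    hn (u m - u n) < q ^+ k by move=> k; exact: cu.
pose s := fix s k := if k is k'.+1 then maxn (N k) (s k').+1 else N 0%N.
have sN k : (N k <= s k)%N by case: k => //= k; rewrite leq_maxl.
have si k : (s k < s k.+1)%N by rewrite /= leq_max leqnn orbT.
have sm : {homo s : m n / (m <= n)%N} by apply: homo_leq leq_trans _ => // k; exact: ltnW.
pose w k : L2T mu := u (s k).
have mw k : cmeasurable (w k) by apply: L2_cmeasurable; exact: L2funP.
pose dd k x := w k.+1 x - w k x.
have md k : cmeasurable (dd k) by exact: cmeasurableB.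
pose S x := (\sum_(0 <= k <oo) ((4 ^+ k)%:E * (cmod (dd k x) ^+ 2)%:E))%E.
have t0 k x : (0 <= (4 ^+ k)%:E * (cmod (dd k x) ^+ 2)%:E)%E.
  by rewrite -EFinM lee_fin mulr_ge0// ?exprn_ge0// ?cmod_ge0.
have mt k : measurable_fun setT (fun x => (4 ^+ k)%:E * (cmod (dd k x) ^+ 2)%:E)%E.
  by apply: measurable_funeM; exact: measurable_ecmod2.
have mS : measurable_fun setT S by apply: ge0_emeasurable_sum => // k x _ _; exact: t0.
have Soo : \forall x \ae mu, (S x < +oo)%E.
  apply: ge0_integral_lty_ae => // [x|]; first by apply: nneseries_ge0 => k _ _; exact: t0.
  rewrite integral_nneseries//.
  have lek k : (\int[mu]_x ((4 ^+ k)%:E * (cmod (dd k x) ^+ 2)%:E) <= (q ^+ k)%:E)%E.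
    have f0 x : setT x -> (0 <= (cmod (dd k x) ^+ 2)%:E)%E by rewrite lee_fin sqr_ge0.
    rewrite ge0_integralZl_EFin ?exprn_ge0//; last exact: measurable_ecmod2.
    rewrite -[X in (_ * X)%E]/(nsq mu (((u (s k.+1) - u (s k)) : L2S mu) : L2T mu)).
      rewrite nsq_hn -EFinM lee_fin.
      have h : hn (u (s k.+1) - u (s k)) < q ^+ k.
        by apply: HN; rewrite ?sN// (leq_trans (sN k))// ltnW.
      rewrite -(@ler_pM2l _ (q ^+ k))// mulrA -exprMn mulVf// expr1n mul1r -expr2.
      by rewrite lerXn2r ?nnegrE ?hn_ge0// ltW.
  apply: (@le_lt_trans _ _ (\sum_(0 <= k <oo) (q ^+ k)%:E)%E).
    by apply: lee_nneseries => // k _ _; apply: integral_ge0 => x _; exact: t0.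
  apply: (@le_lt_trans _ _ ((1 - q)^-1)%:E); last by rewrite ltry.
  apply: lime_le; first by apply: is_cvg_nneseries => k _ _; rewrite lee_fin ltW.
  apply: nearW => n; rewrite sumEFin lee_fin.
  have q1 : `|q| < 1 by rewrite ger0_norm ?invr_ge0// invf_lt1// ltr1n.
  have := geometric_le_lim n ler01 (q0 1%N) q1; rewrite mul1r; apply: le_trans.
  by rewrite -exprn_geometric.
pose D := [set x | (S x < +oo)%E].
have mD : measurable D.
  rewrite -[D]setTI.
  exact: emeasurable_fun_infty_o.
have wcv x : D x -> cvgn (fun k => Re (w k x)) /\ cvgn (fun k => Im (w k x)).
  move=> Dx; have Sfin : S x = (fine (S x))%:E.
    by rewrite fineK// ge0_fin_numE// nneseries_ge0// => k _ _; exact: t0.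
  set c := fine (S x) in Sfin.
  have c0 : 0 <= c by rewrite -lee_fin -Sfin nneseries_ge0// => k _ _; exact: t0.
  have bnd k : cmod (dd k x) <= Num.sqrt c * 2^-1 ^+ k.
    have h : ((4 ^+ k)%:E * (cmod (dd k x) ^+ 2)%:E <= c%:E)%E.
      rewrite -Sfin; apply: le_trans (nneseries_lim_ge k.+1 _); last first.
        by move=> n _ _; exact: t0.
      by rewrite big_nat_recr//= leeDr// sume_ge0// => n _; exact: t0.
    move: h; rewrite -EFinM lee_fin => h.
    rewrite -(@ler_pXn2r _ 2)// ?nnegrE ?cmod_ge0 ?mulr_ge0 ?sqrtr_ge0 ?exprn_ge0//.
    rewrite exprMn sqr_sqrtr// -exprM mulnC exprM exprVn -[X in X^-1]natrX.
    by rewrite exprVn ler_pdivlMr ?exprn_gt0// mulrC.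
  have main (p : R[i] -> R) : (forall z w, p (z - w) = p z - p w) ->
      (forall z, `|p z| <= cmod z) -> cvgn (fun k => p (w k x)).
    move=> pB ple.
    have -> : (fun k => p (w k x)) = (fun n => p (w 0%N x) + series (fun k => p (dd k x)) n).
      apply/funext => n; rewrite [LHS](eq_sum_telescope (fun k => p (w k x))).
      by congr (_ + series _ n); apply/funext => k; rewrite /telescope /dd pB.
    apply: is_cvgD; first exact: is_cvg_cst.
    apply: normed_cvg; apply: (@series_le_cvg _ _ (geometric (Num.sqrt c) 2^-1)).
    - by move=> n /=.
    - by move=> n; rewrite /= mulr_ge0 ?sqrtr_ge0// exprn_ge0// invr_ge0.
    - by move=> n; rewrite (le_trans (ple _))// bnd.
    - by apply: is_cvg_geometric_series; rewrite ger0_norm ?invr_ge0// invf_lt1// ltr1n.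
  split; apply: main => *; rewrite ?ReD ?ReN ?ImD ?ImN//; [exact: normr_Re|exact: normr_Im].
(* Setting the functions to 0 outside D makes the limit exist everywhere, which gives the
   measurability of v. *)
pose w' k x := cindic R D x * w k x.
have mw' k : cmeasurable (w' k) by apply: cmeasurableM => //; exact: cmeasurable_indic.
have w'D k x : D x -> w' k x = w k x.
  by move=> Dx; rewrite /w' /cindic indicE mem_set// mul1r.
have w'ND k x : ~ D x -> w' k x = 0.
  by move=> Dx; rewrite /w' /cindic indicE memNset// mul0r.
have w'cv x : cvgn (fun k => Re (w' k x)) /\ cvgn (fun k => Im (w' k x)).
  have [Dx|Dx] := pselect (D x).
    by under eq_fun do rewrite w'D//; under [X in _ /\ cvgn X]eq_fun do rewrite w'D//;
       exact: wcv.
  by under eq_fun do rewrite w'ND//; under [X in _ /\ cvgn X]eq_fun do rewrite w'ND//;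
     split; exact: is_cvg_cst.
pose v x := Complex (limn (fun k => Re (w' k x))) (limn (fun k => Im (w' k x))).
have vcv x : (fun k => Re (w' k x)) @ \oo --> Re (v x) by have [] := w'cv x.
have vcv2 x : (fun k => Im (w' k x)) @ \oo --> Im (v x) by have [] := w'cv x.
have mv : cmeasurable v.
  split; apply: measurable_fun_cvg.
  - by move=> k; have [h _] := mw' k; exact: h.
  - by move=> x _; exact: vcv.
  - by move=> k; have [_ h] := mw' k; exact: h.
  - by move=> x _; exact: vcv2.
(* Fatou's lemma, applied in k, turns the Cauchy bound between [w n] and [w k] into a bound between
   [w n] and v. *)
have wv n : (nsq mu (fun x => w n x - v x)%R <= ((q ^+ n) ^+ 2)%:E)%E.
  rewrite (@ae_eq_nsq _ _ _ mu _ (fun x => w' n x - v x)); first last.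
  - by move: Soo; apply: filterS => x Sx; rewrite w'D.
  - exact: cmeasurableB.
  - exact: cmeasurableB.
  apply: (@nsq_fatou (fun k x => w' n x - w' k x)).
  - by move=> k; exact: cmeasurableB.
  - move=> x; under eq_fun do rewrite ReD ReN; rewrite ReD ReN.
    by apply: cvgB; [exact: cvg_cst|exact: vcv].
  - move=> x; under eq_fun do rewrite ImD ImN; rewrite ImD ImN.
    by apply: cvgB; [exact: cvg_cst|exact: vcv2].
  exists n => // k /= nk.
  rewrite (@ae_eq_nsq _ _ _ mu _ (fun x => w n x - w k x)); first last.
  - by move: Soo; apply: filterS => x Sx; rewrite !w'D.
  - exact: cmeasurableB.
  - exact: cmeasurableB.
  rewrite -[X in (X <= _)%E]/(nsq mu (((u (s n) - u (s k)) : L2S mu) : L2T mu)).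
  rewrite nsq_hn lee_fin lerXn2r ?nnegrE ?hn_ge0// ?ltW//.
  by apply: HN; rewrite ?sN// (leq_trans (sN n))// sm.
have Lwv n : L2 mu (fun x => w n x - v x).
  by apply/L2P; split; [exact: cmeasurableB|rewrite (le_lt_trans (wv n))// ltry].
have Lv : L2 mu v.
  have := L2B (L2funP (w 0%N)) (Lwv 0%N).
  by under eq_fun do rewrite subKr.
exists (MkL2T Lv) => e e0.
have [k hk] : exists k, q ^+ k < e / 2.
  have : geometric 1 q @ \oo --> (0 : R).
    by apply: cvg_geometric; rewrite ger0_norm ?invr_ge0// invf_lt1// ltr1n.
  move=> /cvgrPdist_lt /(_ (e / 2) (divr_gt0 e0 (ltr0Sn _ 1)))[k _ /(_ k)] /= h.
  exists k; have := h (leqnn _); rewrite sub0r normrN mul1r ger0_norm//.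
  by rewrite exprn_ge0// invr_ge0.
exists (N k) => n Nn; rewrite (le_lt_trans (hn_triangle _ (u (s k)) _))//.
rewrite (splitr e) ltrD// (le_lt_trans _ hk)//.
  by rewrite ltW// HN.
rewrite -(@ler_pXn2r _ 2)// ?nnegrE ?hn_ge0 ?exprn_ge0 ?invr_ge0//.
by rewrite -lee_fin -nsq_hn; exact: wv.
Qed.

End L2_complete.

(** * Product measures and density of elementary tensors *)

Section orthogonal_density.
Variables (R : realType) (H : semiHilbert R).
Hypothesis Hc : forall u : nat -> H, hcauchy u -> exists v, hcv u v.
Variable V : H -> Prop.
Hypothesis V0 : V 0.
Hypothesis VDZ : forall a x y, V x -> V y -> V (a *: x + y).
Hypothesis Vcl : forall x, (forall e : R, 0 < e -> exists2 y, V y & hn (x - y) < e) -> V x.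

(** The parallelogram law for x - v and x - w; half of their sum is the vector from the midpoint of
    v and w to x. *)
Lemma parallelogram (x v w : H) :
  hn (v - w) ^+ 2 = (hn (x - v) ^+ 2 + hn (x - w) ^+ 2) *+ 2
    - 4 * hn (x - (((2^-1)%:C)%C *: v + ((2^-1)%:C)%C *: w)) ^+ 2.
Proof.
pose a := x - v; pose b := x - w.
have e1 : v - w = - 1 *: a + b by rewrite scaleN1r opprB addrC /b addrC subrKA.
pose h : R[i] := ((2^-1)%:C)%C.
have half2 : h + h = 1 by rewrite /h -rmorphD /= -[2^-1]mul1r -splitr.
rewrite -/h; have e2 : x - (h *: v + h *: w) = h *: (1 *: a + b).
  rewrite scale1r !scalerDr !scalerN addrACA -opprD; congr (_ - _).
  by rewrite -scalerDl half2 scale1r.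
have c2 : cmod h ^+ 2 = 4^-1 by rewrite /h cmodR real_normK ?num_real//; field.
rewrite e1 e2 hnZ exprMn c2 !hn_sqrDZ cmodN ComplexField.Normc.normc1 expr1n !mul1r mulN1r ReN.
set t := Re _; set p := hn a ^+ 2; set r := hn b ^+ 2.
by field.
Qed.

(** The projection theorem: a minimising sequence for the distance from x to V converges to a point
    y of V, and x - y is orthogonal to V, hence of norm 0. *)
Lemma orthogonal_dense :
  (forall y, (forall v, V v -> ip y v = 0) -> hn y = 0) -> forall x, V x.
Proof.
move=> Vorth x.
pose S := [set hn (x - v) ^+ 2 | v in V].
have S0 : S (hn (x - 0) ^+ 2) by exists 0.
have Slb : lbound S 0 by move=> _ [v _ <-]; rewrite sqr_ge0.
have hS : has_inf S by split; [exists (hn (x - 0) ^+ 2)|exists 0].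
set dd := inf S.
have ddle v : V v -> dd <= hn (x - v) ^+ 2.
  by move=> Vv; apply: ge_inf; [exists 0|exists v].
have /choice[v vP] : forall n : nat, exists v, V v /\ hn (x - v) ^+ 2 < dd + n.+1%:R^-1.
  move=> n; have n0 : 0 < n.+1%:R^-1 :> R by rewrite invr_gt0.
  have [_ [v Vv <-] h] := @inf_adherent _ S _ n0 hS.
  by exists v.
(* The midpoint of [v m] and [v n] lies in V, so its squared distance to x is at least the
   infimum. *)
have par m n : hn (v m - v n) ^+ 2 <= (m.+1%:R^-1 + n.+1%:R^-1) *+ 2.
  rewrite (parallelogram x).
  have [Vm hm] := vP m; have [Vn hm'] := vP n.
  have := ddle (((2^-1)%:C)%C *: v m + ((2^-1)%:C)%C *: v n).
  have VV : V (((2^-1)%:C)%C *: v m + ((2^-1)%:C)%C *: v n).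
    by apply: VDZ => //; rewrite -[_ *: _]addr0; exact: VDZ.
  move=> /(_ VV); move: hm hm'.
  set p := hn (x - v m) ^+ 2; set r := hn (x - v n) ^+ 2; set q := hn (x - _) ^+ 2.
  set a := m.+1%:R^-1; set b := n.+1%:R^-1; rewrite !mulr2n.
  by move=> h1 h2 h3; lra.
have cv : hcauchy v.
  move=> e e0; have e2 : 0 < e ^+ 2 / 4 by rewrite divr_gt0// exprn_gt0.
  pose N := Num.truncn (e ^+ 2 / 4)^-1.
  have hN n : (N <= n)%N -> n.+1%:R^-1 < e ^+ 2 / 4.
    move=> Nn; rewrite invf_plt ?posrE//.
    by rewrite (lt_le_trans (truncnS_gt _))// ler_nat.
  exists N => m n /hN hm /hN hn'.
  rewrite -(@ltr_pXn2r _ 2)// ?nnegrE ?hn_ge0 ?(ltW e0)//.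
  rewrite (le_lt_trans (par m n))//; move: hm hn'; rewrite mulr2n.
  by set p := m.+1%:R^-1; set q := n.+1%:R^-1; lra.
have [y vy] := Hc cv.
have Vy : V y.
  apply: Vcl => e /vy[N hN]; exists (v N); first by have [] := vP N.
  by rewrite hnB hN.
have xy : hn (x - y) ^+ 2 <= dd.
  have dd0 : 0 <= dd by apply: lb_le_inf => //; exists (hn (x - 0) ^+ 2).
  rewrite -[leRHS]sqr_sqrtr// lerXn2r ?nnegrE ?sqrtr_ge0 ?hn_ge0//.
  apply/ler_addgt0Pr => e e0.
  have e2 : 0 < e / 2 by rewrite divr_gt0.
  have [N1 hN1] := vy _ e2.
  pose N2 := Num.truncn ((e / 2) ^+ 2)^-1.
  pose N := maxn N1 N2.
  have h1 := hN1 N (leq_maxl _ _).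
  have h2 : hn (x - v N) <= Num.sqrt dd + e / 2.
    rewrite -(@ler_pXn2r _ 2)// ?nnegrE ?hn_ge0 ?addr_ge0 ?sqrtr_ge0 ?(ltW e2)//.
    have [_ /ltW vN] := vP N; apply: le_trans vN _.
    rewrite sqrrD sqr_sqrtr// -addrA lerD2l.
    rewrite (@le_trans _ _ ((e / 2) ^+ 2))//.
      rewrite invf_ple ?posrE// ?exprn_gt0//.
      by rewrite (le_trans (ltW (truncnS_gt _)))// ler_nat ltnS leq_maxr.
    by rewrite lerDr mulrn_wge0// mulr_ge0 ?sqrtr_ge0// ltW.
  rewrite (le_trans (hn_triangle _ (v N) _))// (le_trans (lerD h2 (ltW h1)))//.
  by rewrite -addrA -splitr.
(* First variation: minimality is tested at y + s c w with c = <x - y, w>. The choice of s makes s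
   |w|^2 at most 1, so the quadratic term cannot outweigh the linear one unless c = 0. *)
have orth w : V w -> ip (x - y) w = 0.
  move=> Vw; set z := x - y; set c := ip z w.
  pose s : R := (hn w ^+ 2 + 1)^-1.
  have w1 : 0 < hn w ^+ 2 + 1 by rewrite ltr_wpDl// sqr_ge0.
  have s0 : 0 < s by rewrite invr_gt0.
  have key : hn z ^+ 2 <= hn ((- s%:C%C * c) *: w + z) ^+ 2.
    apply: le_trans xy _; have := ddle ((s%:C%C * c) *: w + y) (VDZ _ Vw Vy).
    by rewrite mulNr scaleNr opprD addrCA /z.
  move: key; rewrite hn_sqrDZ ComplexField.Normc.normcM cmodN cmodR exprMn real_normK ?num_real//.
  rewrite (ipC z w) -/c mulNr mulNr -mulrA mulcJ ReN ReM/= mul0r subr0.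
  rewrite -subr_ge0 addrK; set D := cmod c ^+ 2; set W := hn w ^+ 2 => h.
  have sW : s * W <= 1.
    by rewrite /s mulrC ler_pdivrMr// mul1r lerDl.
  have D0 : 0 <= D by rewrite sqr_ge0.
  have : D <= 0.
    rewrite leNgt; apply/negP => D1.
    have h1 : s * D * (s * W) <= s * D by rewrite ler_piMr// mulr_ge0// ltW.
    have h2 : 0 < s * D by rewrite mulr_gt0.
    have h3 : s ^+ 2 * D * W = s * D * (s * W) by ring.
    by move: h; rewrite h3 mulr2n; lra.
  move=> D1; have /eqP : D = 0 by apply/eqP; rewrite eq_le D1 D0.
  by rewrite expf_eq0 /= => /eqP /cmod_eq0.
have z0 := Vorth _ orth.
(* x need not equal y, but it is at distance 0 from y, and V is closed. *)
by apply: Vcl => e e0; exists y => //; rewrite z0.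
Qed.

End orthogonal_density.

Lemma cmeasurable_comp (R : realType) (d d' : measure_display) (X : measurableType d)
    (Y : measurableType d') (p : X -> Y) (f : Y -> R[i]) :
  measurable_fun setT p -> cmeasurable f -> cmeasurable (f \o p).
Proof. by move=> mp [f1 f2]; split; [exact: (measurableT_comp f1 mp)|exact: (measurableT_comp f2 mp)]. Qed.

Lemma cauchy_schwarz_cintegral (R : realType) (d : measure_display)
    (X : measurableType d) (mu : {measure set X -> \bar R}) (f g : X -> R[i]) :
  L2 mu f -> L2 mu g ->
  ((cmod (cintegral mu (fun x => f x * g x)) ^+ 2)%:E <= nsq mu f * nsq mu g)%E.
Proof.
move=> lf lg.
have := cauchy_schwarz (MkL2T lf : L2S mu) (MkL2T (L2J lg) : L2S mu).
rewrite ip_L2 (@eq_cintegral _ _ _ mu _ (fun x => f x * g x)); last first.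
  by move=> x /=; rewrite conjcK.
have -> : nsq mu g = nsq mu (fun x => conjc (g x)).
  by apply: eq_integral => x _; rewrite cmod_conj.
move=> h; have hf := nsq_hn (MkL2T lf : L2S mu); have hg := nsq_hn (MkL2T (L2J lg) : L2S mu).
rewrite [X in nsq mu X]/= in hf; rewrite [X in nsq mu X]/= in hg; rewrite hf hg -EFinM lee_fin -exprMn.
by rewrite lerXn2r ?nnegrE ?cmod_ge0 ?mulr_ge0 ?hn_ge0.
Qed.

Section product_space.
Context (R : realType) (d1 d2 : measure_display).
Context (X1 : measurableType d1) (X2 : measurableType d2).
Variables (m1 : {sigma_finite_measure set X1 -> \bar R}).
Variables (m2 : {sigma_finite_measure set X2 -> \bar R}).
Implicit Types (F G : X1 * X2 -> R[i]).
Local Notation P := (m1 \x m2)%E.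

Lemma cmeasurable_slice1 F x2 : cmeasurable F -> cmeasurable (fun x1 => F (x1, x2)).
Proof. by move=> [f1 f2]; split; [exact: (measurable_fun_pair1 x2 f1)|exact: (measurable_fun_pair1 x2 f2)]. Qed.

Lemma nsq_prod1 F : cmeasurable F ->
  nsq P F = (\int[m1]_x1 nsq m2 (fun x2 => F (x1, x2)))%E.
Proof.
move=> mF; rewrite /nsq /P fubini_tonelli1//; first exact: measurable_ecmod2.
by move=> x; rewrite lee_fin sqr_ge0.
Qed.

Lemma nsq_prod2 F : cmeasurable F ->
  nsq P F = (\int[m2]_x2 nsq m1 (fun x1 => F (x1, x2)))%E.
Proof.
move=> mF; rewrite /nsq /P fubini_tonelli2//; first exact: measurable_ecmod2.
by move=> x; rewrite lee_fin sqr_ge0.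
Qed.

Lemma measurable_nsq_slice1 F : cmeasurable F ->
  measurable_fun setT (fun x2 => nsq m1 (fun x1 => F (x1, x2))).
Proof.
move=> mF; apply: (measurable_fun_fubini_tonelli_G (fun z => (cmod (F z) ^+ 2)%:E)).
  exact: measurable_ecmod2.
by move=> x; rewrite lee_fin sqr_ge0.
Qed.

Lemma L2_slice1 F : L2 P F -> \forall x2 \ae m2, L2 m1 (fun x1 => F (x1, x2)).
Proof.
move=> /L2P[mF lF]; rewrite nsq_prod2// in lF.
have := ge0_integral_lty_ae (measurable_nsq_slice1 mF) (fun=> nsq_ge0 _ _) lF.
apply: filterS => x2 h.
by apply/L2P; split=> //; exact: cmeasurable_slice1.
Qed.

Lemma ge0_integral_eq0_ae d (X : measurableType d) (m : {measure set X -> \bar R})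
    (f : X -> \bar R) : measurable_fun setT f -> (forall x, 0 <= f x)%E ->
  (\int[m]_x f x = 0)%E <-> (\forall x \ae m, f x = 0%E).
Proof.
move=> mf f0; have := ae_eq_integral_abs m measurableT mf.
under eq_integral do rewrite gee0_abs//.
by move=> ->; split; apply: filterS => x; [move=> /(_ I)|move=> -> _].
Qed.

Lemma prod_ae_eq0 F : cmeasurable F ->
  (\forall z \ae P, F z = 0) <->
  (\forall x2 \ae m2, \forall x1 \ae m1, F (x1, x2) = 0).
Proof.
move=> mF; rewrite -(nsq_eq0 P mF) nsq_prod2// ge0_integral_eq0_ae; last first.
- by move=> x; exact: nsq_ge0.
- exact: measurable_nsq_slice1.
by split; apply: filterS => x2 h; apply/(nsq_eq0 m1 (cmeasurable_slice1 x2 mF)).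
Qed.

Definition tensor (f : X1 -> R[i]) (g : X2 -> R[i]) : X1 * X2 -> R[i] :=
  fun z => f z.1 * g z.2.

Lemma cmeasurable_tensor f g : cmeasurable f -> cmeasurable g -> cmeasurable (tensor f g).
Proof.
move=> mf mg; apply: cmeasurableM.
  exact: (cmeasurable_comp measurable_fst mf).
exact: (cmeasurable_comp measurable_snd mg).
Qed.

Lemma nsq_tensor f g : cmeasurable f -> cmeasurable g ->
  nsq P (tensor f g) = (nsq m1 f * nsq m2 g)%E.
Proof.
move=> mf mg; rewrite nsq_prod2; last exact: cmeasurable_tensor.
under eq_integral => x2 _.
  rewrite (_ : (fun x1 => _) = fun x1 => g x2 * f x1); last first.
    by apply/funext => x1; rewrite /tensor mulrC.
  rewrite nsqZ// muleC; over.
rewrite -ge0_integralZl//.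
- exact: measurable_ecmod2.
- by move=> x _; rewrite lee_fin sqr_ge0.
- exact: nsq_ge0.
Qed.

Lemma L2_tensor f g : L2 m1 f -> L2 m2 g -> L2 P (tensor f g).
Proof.
move=> /L2P[mf lf] /L2P[mg lg]; apply/L2P; split; first exact: cmeasurable_tensor.
rewrite nsq_tensor//; apply: lte_mul_pinfty => //; first exact: nsq_ge0.
by rewrite ge0_fin_numE// nsq_ge0.
Qed.

Lemma cfubini1 F : cmeasurable F -> cintegrable P F ->
  cintegral P F = cintegral m2 (fun x2 => cintegral m1 (fun x1 => F (x1, x2))).
Proof.
move=> mF [F1 F2].
have H (f : X1 * X2 -> R) : P.-integrable setT (fun z => (f z)%:E) ->
    (\int[P]_z f z = \int[m2]_x2 \int[m1]_x1 f (x1, x2))%R.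
  move=> fi; rewrite {1}/Rintegral -integral21_prod_meas1//.
  have mf : measurable_fun setT (fun z => (f z)%:E) by case/integrableP: fi.
  have mG := measurable_fubini_G fi.
  rewrite /Rintegral; congr fine; apply: ae_eq_integral => //.
  - apply/measurable_EFinP; apply: (measurableT_comp _ mG); exact: fine_measurable.
  (* The inner Bochner-style integral is a [fine] value, which is meaningful where the slice is
     integrable; this is so for almost every x2. *)
  - have /(integrable21ltyP m1 m2 mf) := fi.
    have mGa : measurable_fun setT (fun x2 => \int[m1]_x1 `|(f (x1, x2))%:E|)%E.
      apply: (measurable_fun_fubini_tonelli_G (fun z => `|(f z)%:E|%E)) => //.
      exact: measurableT_comp.
    move=> h; have := ge0_integral_lty_ae mGa _ h.
    move=> /(_ (fun x2 => integral_ge0 _ (fun x _ => abse_ge0 _))).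
    apply: filterS => x2 {}h _ /=; rewrite /fubini_G fineK//.
    apply: integrable_fin_num => //; apply/integrableP; split=> //.
    exact: (measurable_fun_pair1 x2 mf).
by rewrite !cintegralE /= !H.
Qed.

(** Bilinear in F and b; the version [pintS] conjugates b and is a partial inner product. *)
Definition pint1 F (b : X1 -> R[i]) : X2 -> R[i] :=
  fun x2 => cintegral m1 (fun x1 => F (x1, x2) * b x1).

Lemma cmeasurable_cintegral1 F : cmeasurable F ->
  cmeasurable (fun x2 => cintegral m1 (fun x1 => F (x1, x2))).
Proof.
have H (f : X1 * X2 -> R) : measurable_fun setT f ->
    measurable_fun setT (fun x2 => \int[m1]_x1 f (x1, x2))%R.
  move=> mf; rewrite /Rintegral; apply: measurableT_comp; first exact: fine_measurable.
  under eq_fun do rewrite integralE.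
  have mfE : measurable_fun setT (EFin \o f) by exact/measurable_EFinP.
  apply: emeasurable_funB.
    rewrite (_ : (fun _ => _) = fubini_G m1 (EFin \o f)^\+%E); last first.
      by apply/funext => x2; apply: eq_integral => x1 _; rewrite !funeposE.
    exact: (measurable_fun_fubini_tonelli_G _ (measurable_funepos mfE)
      (fun=> funepos_ge0 _ _)).
  rewrite (_ : (fun _ => _) = fubini_G m1 (EFin \o f)^\-%E); last first.
    by apply/funext => x2; apply: eq_integral => x1 _; rewrite !funenegE.
  exact: (measurable_fun_fubini_tonelli_G _ (measurable_funeneg mfE)
    (fun=> funeneg_ge0 _ _)).
by move=> [F1 F2]; split; [exact: (H _ F1)|exact: (H _ F2)].
Qed.

Lemma cmeasurable_pint1 F b : cmeasurable F -> cmeasurable b -> cmeasurable (pint1 F b).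
Proof.
move=> mF mb; apply: (@cmeasurable_cintegral1 (fun z => F z * b z.1)).
by apply: cmeasurableM => //; exact: (cmeasurable_comp measurable_fst mb).
Qed.

(** The Cauchy-Schwarz inequality on almost every slice, integrated over the second coordinate. *)
Lemma nsq_pint1 F b : L2 P F -> L2 m1 b -> (nsq m2 (pint1 F b) <= nsq P F * nsq m1 b)%E.
Proof.
move=> lF lb; have /L2P[mF _] := lF; have /L2P[mb _] := lb.
rewrite nsq_prod2// muleC -ge0_integralZl ?nsq_ge0//; last 2 first.
- exact: measurable_nsq_slice1.
- by move=> x _; exact: nsq_ge0.
apply: ae_ge0_le_integral => //.
- by move=> x _; rewrite lee_fin sqr_ge0.
- by apply: measurable_ecmod2; exact: cmeasurable_pint1.
- by move=> x _; rewrite mule_ge0// nsq_ge0.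
- by apply: measurable_funeM; exact: measurable_nsq_slice1.
apply: filterS (L2_slice1 lF) => x2 h _; rewrite muleC.
exact: cauchy_schwarz_cintegral.
Qed.

Lemma L2_pint1 F b : L2 P F -> L2 m1 b -> L2 m2 (pint1 F b).
Proof.
move=> lF lb; apply/L2P; split.
  by apply: cmeasurable_pint1; [exact: L2_cmeasurable lF|exact: L2_cmeasurable lb].
rewrite (le_lt_trans (nsq_pint1 lF lb))//; move/L2P : lF => [_ lF]; move/L2P : lb => [_ lb].
apply: lte_mul_pinfty => //; first exact: nsq_ge0.
by rewrite ge0_fin_numE// nsq_ge0.
Qed.

Lemma pint1_tensor F b g : L2 P F -> L2 m1 b -> L2 m2 g ->
  cintegral m2 (fun x2 => pint1 F b x2 * g x2) =
  cintegral P (fun z => F z * tensor b g z).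
Proof.
move=> lF lb lg; have lt := L2_tensor lb lg.
have mF := L2_cmeasurable lF.
have mFt : cmeasurable (fun z => F z * tensor b g z).
  by apply: cmeasurableM => //; exact: L2_cmeasurable lt.
rewrite (cfubini1 mFt (L2_cintegrableM lF lt)).
apply: ae_eq_cintegral.
- apply: cmeasurableM; last exact: L2_cmeasurable lg.
  by apply: cmeasurable_pint1 => //; exact: L2_cmeasurable lb.
- exact: (cmeasurable_cintegral1 mFt).
apply: filterS (L2_slice1 lF) => x2 h.
rewrite /pint1 mulrC -cintegralZ; last exact: L2_cintegrableM.
by apply: eq_cintegral => x1; rewrite /tensor /= mulrC mulrA.
Qed.

End product_space.

Definition pswap (A B : Type) (z : A * B) : B * A := (z.2, z.1).

Section product_swap.
Context (R : realType) (d1 d2 : measure_display).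
Context (X1 : measurableType d1) (X2 : measurableType d2).
Variables (m1 : {sigma_finite_measure set X1 -> \bar R}).
Variables (m2 : {sigma_finite_measure set X2 -> \bar R}).

Lemma cmeasurable_swap (F : X1 * X2 -> R[i]) : cmeasurable F -> cmeasurable (F \o @pswap X2 X1).
Proof. by apply: cmeasurable_comp; exact: measurable_fun_pair. Qed.

Lemma nsq_swap (F : X1 * X2 -> R[i]) : cmeasurable F ->
  nsq (m2 \x m1)%E (F \o @pswap X2 X1) = nsq (m1 \x m2)%E F.
Proof. by move=> mF; rewrite nsq_prod2 ?nsq_prod1//; exact: cmeasurable_swap. Qed.

Lemma L2_swap (F : X1 * X2 -> R[i]) : L2 (m1 \x m2)%E F -> L2 (m2 \x m1)%E (F \o @pswap X2 X1).
Proof.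
by move=> /L2P[mF lF]; apply/L2P; split; [exact: cmeasurable_swap|rewrite nsq_swap].
Qed.

End product_swap.

Lemma sigma_finite_cover (d : measure_display) (X : measurableType d) (R : realType)
    (m : {sigma_finite_measure set X -> \bar R}) :
  exists S : nat -> set X, [/\ forall n, measurable (S n), forall n, (m (S n) < +oo)%E,
    nondecreasing_seq S & forall x, exists n, S n x].
Proof.
have /sigma_finiteP[F [FT Fnd mF]] := sigma_finiteT m.
exists F; split => // [n|n|x]; [by have [] := mF n|by have [] := mF n|].
by have : setT x by []; rewrite FT => -[n _ Fx]; exists n.
Qed.

Lemma L2_cindic (d : measure_display) (X : measurableType d) (R : realType)
    (m : {measure set X -> \bar R}) (A : set X) :
  measurable A -> (m A < +oo)%E -> L2 m (cindic R A).
Proof.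
move=> mA Aoo; apply/L2P; split; first exact: cmeasurable_indic.
rewrite /nsq; under eq_integral => x _.
  rewrite /cindic cmodR ger0_norm// indicE -natrX.
  have -> : ((x \in A) ^ 2 = (x \in A))%N by case: (x \in A).
  rewrite -indicE; over.
by rewrite integral_indic// setIT.
Qed.

Section tensor_density.
Context (R : realType) (d1 d2 : measure_display).
Context (X1 : measurableType d1) (X2 : measurableType d2).
Variables (m1 : {sigma_finite_measure set X1 -> \bar R}).
Variables (m2 : {sigma_finite_measure set X2 -> \bar R}).
Local Notation P := (m1 \x m2)%E.

(** Dynkin's theorem: the measurable sets E for which the integral over E and [S n] vanishes form a
    Dynkin class that contains the rectangles. Intersecting with [S n] is necessary as f is
    integrable only there. *)
Lemma rectangle_ae_eq0 (f : X1 * X2 -> R) (S1 : nat -> set X1) (S2 : nat -> set X2) :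
  measurable_fun setT f ->
  (forall n, measurable (S1 n)) -> (forall n, measurable (S2 n)) ->
  (forall z, exists n, (S1 n `*` S2 n) z) ->
  (forall n, P.-integrable (S1 n `*` S2 n) (EFin \o f)) ->
  (forall n A B, measurable A -> measurable B -> A `<=` S1 n -> B `<=` S2 n ->
    (\int[P]_(z in A `*` B) (f z)%:E = 0)%E) ->
  \forall z \ae P, f z = 0.
Proof.
move=> mf mS1 mS2 cov fi f0.
have mfE : measurable_fun setT (EFin \o f) by exact/measurable_EFinP.
pose S n := S1 n `*` S2 n.
have mS n : measurable (S n) by exact: measurableX.
have key n E : measurable E -> (\int[P]_(z in E `&` S n) (f z)%:E = 0)%E.
  move=> mE; pose Q E := (\int[P]_(z in E `&` S n) (f z)%:E = 0)%E.
  have fiS A : measurable A -> P.-integrable (A `&` S n) (EFin \o f).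
    move=> mA; apply: (integrableS (mS n)) => //; first exact: measurableI.
    exact: fi.
  apply: (@dynkin_induction _ _ [set C | exists2 A, measurable A &
      exists2 B, measurable B & A `*` B = C] Q) => //.
  - exact: measurable_prod_measurableType.
  - move=> _ _ [A mA [B mB <-]] [A' mA' [B' mB' <-]].
    exists (A `&` A'); first exact: measurableI.
    exists (B `&` B'); first exact: measurableI.
    by rewrite setXI.
  - by rewrite /Q setTI; apply: (f0 n).
  - move=> _ [A mA [B mB <-]]; rewrite /Q /S -setXI.
    by apply: (f0 n); (try exact: measurableI); exact: subIsetr.
  - move=> A mA; rewrite /Q => A0.
    have S0 : (\int[P]_(z in S n) (f z)%:E = 0)%E by apply: (f0 n).
    have e : S n = (A `&` S n) `|` (~` A `&` S n) by rewrite -setIUl setUv setTI.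
    have := @integral_setU _ _ _ P (A `&` S n) (~` A `&` S n) (EFin \o f).
    rewrite -e A0 add0e => h; rewrite -[RHS]S0 h//.
    + exact: measurableI.
    + by apply: measurableI => //; exact: measurableC.
    + exact: measurable_funTS.
    + by apply/disj_set2P; rewrite setIACA setICr set0I.
  - move=> F mF tF F0; rewrite /Q setI_bigcupl integral_bigcup.
    + by apply: eseries0 => i _ _; exact: F0.
    + exact: trivIset_setIr.
    + by move=> i; exact: measurableI.
    + rewrite -setI_bigcupl; apply: fiS; exact: bigcupT_measurable.
  - by rewrite -measurable_prod_measurableType.
have H n : \forall z \ae P, S n z -> f z = 0.
  have : ae_eq P (S n) (EFin \o f) (cst 0%E).
    apply: (integral_ae_eq (mS n) (fi n)) => // E ES mE.
    by rewrite -[E in LHS](setIidl ES) key// integral0.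
  by apply: filterS => z /= h /h [].
have := ae_foralln H; apply: filterS => z h.
by have [n Sz] := cov z; exact: h Sz.
Qed.

Lemma prod_orth_eq0 (y : X1 * X2 -> R[i]) : L2 P y ->
  (forall A B, measurable A -> measurable B -> (m1 A < +oo)%E -> (m2 B < +oo)%E ->
    cintegral P (fun z => y z * tensor (cindic R A) (cindic R B) z) = 0) ->
  \forall z \ae P, y z = 0.
Proof.
move=> ly y0; have [y1 y2] := L2_cmeasurable ly.
have [S1 [mS1 S1oo nS1 cS1]] := sigma_finite_cover m1.
have [S2 [mS2 S2oo nS2 cS2]] := sigma_finite_cover m2.
have cov z : exists n, (S1 n `*` S2 n) z.
  have [n h1] := cS1 z.1; have [k h2] := cS2 z.2; exists (maxn n k); split.
    by have /subsetPset := nS1 _ _ (leq_maxl n k); apply.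
  by have /subsetPset := nS2 _ _ (leq_maxr n k); apply.
have tE A B z : tensor (cindic R A) (cindic R B) z = ((\1_(A `*` B) z)%:C)%C.
  rewrite /tensor /cindic -rmorphM /= !indicE -natrM mulnb; congr (_%:R%:C)%C.
  by rewrite in_setX.
have Ai A B : measurable A -> measurable B -> (m1 A < +oo)%E -> (m2 B < +oo)%E ->
    cintegrable P (fun z => y z * tensor (cindic R A) (cindic R B) z).
  by move=> mA mB Aoo Boo; apply: L2_cintegrableM => //; apply: L2_tensor; exact: L2_cindic.
have pE (p : R[i] -> R) A B : (forall z r, p (z * (r%:C)%C) = p z * r) ->
    (fun z => (p (y z * tensor (cindic R A) (cindic R B) z))%:E) =
    ((EFin \o (p \o y)) \_ (A `*` B))%E.
  move=> pM; apply/funext => z; rewrite tE pM patchE indicE.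
  by case: ifPn; rewrite ?mulr1 ?mulr0.
(* To be used for the real and the imaginary part; both commute with multiplication by the
   indicators, which are real. *)
have main (p : R[i] -> R) : (forall z r, p (z * (r%:C)%C) = p z * r) ->
    measurable_fun setT (p \o y) ->
    (forall f, cintegrable P f -> P.-integrable setT (fun z => (p (f z))%:E)) ->
    (forall f, p (cintegral P f) = \int[P]_z p (f z))%R ->
    \forall z \ae P, p (y z) = 0.
  move=> pM mp pi pI; apply: (rectangle_ae_eq0 mp mS1 mS2 cov).
    move=> n; apply/integrable_mkcond; first exact: measurableX.
    by rewrite -pE//; apply: pi; exact: Ai.
  move=> n A B mA mB AS BS.
  have Aoo : (m1 A < +oo)%E by rewrite (le_lt_trans _ (S1oo n))// le_measure ?inE.
  have Boo : (m2 B < +oo)%E by rewrite (le_lt_trans _ (S2oo n))// le_measure ?inE.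
  have := pI (fun z => y z * tensor (cindic R A) (cindic R B) z).
  have p0 : p 0 = 0 by have := pM 0 0; rewrite mul0r mulr0.
  rewrite y0// p0 /Rintegral => /esym /eqP; rewrite fine_eq0.
    by rewrite pE// -integral_mkcond => /eqP.
  by apply: integrable_fin_num => //; apply: pi; exact: Ai.
have hRe : \forall z \ae P, Re (y z) = 0.
  apply: (main (@complex.Re R)) => //.
  - by move=> z r; rewrite ReM /= mulr0 subr0.
  - by move=> f [].
have hIm : \forall z \ae P, Im (y z) = 0.
  apply: (main (@complex.Im R)) => //.
  - by move=> z r; rewrite ImM /= mulr0 add0r.
  - by move=> f [].
by apply: filterS2 hRe hIm => z h1 h2; apply: complex_eq.
Qed.

Definition tensorS (f : L2S m1) (g : L2S m2) : L2S P :=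
  MkL2T (L2_tensor (L2funP f) (L2funP g)).

Lemma hn_tensorS f g : hn (tensorS f g) = hn f * hn g.
Proof.
apply/eqP; rewrite -(@eqrXn2 _ 2)// ?mulr_ge0 ?hn_ge0//; apply/eqP.
apply: EFin_inj; rewrite -nsq_hn /= nsq_tensor; try by apply: L2_cmeasurable; exact: L2funP.
by rewrite !nsq_hn -EFinM exprMn.
Qed.

Lemma tensor_dense (V : L2S P -> Prop) : V 0 ->
  (forall a x y, V x -> V y -> V (a *: x + y)) ->
  (forall x, (forall e : R, 0 < e -> exists2 y, V y & hn (x - y) < e) -> V x) ->
  (forall f g, V (tensorS f g)) -> forall F, V F.
Proof.
move=> V0 VDZ Vcl Vt; apply: orthogonal_dense => //; first exact: L2_complete.
move=> y yV; apply/hn_eq0; apply: prod_orth_eq0; first exact: L2funP.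
move=> A B mA mB Aoo Boo.
have := yV _ (Vt (MkL2T (L2_cindic mA Aoo) : L2S m1) (MkL2T (L2_cindic mB Boo) : L2S m2)).
rewrite ip_L2 => h; rewrite -[RHS]h; apply: eq_cintegral => z; congr (_ * _).
by apply: complex_eq; rewrite /=; ring.
Qed.

End tensor_density.

Lemma ae_conj (d : measure_display) (X : measurableType d) (R : realType)
    (m : {measure set X -> \bar R}) (P Q : X -> Prop) :
  (\forall x \ae m, P x) -> (\forall x \ae m, Q x) -> \forall x \ae m, P x /\ Q x.
Proof. by move=> h1 h2; apply: filterS2 h1 h2. Qed.

(** * Tensor products of operators *)

Section slices.
Context (R : realType) (d1 d2 : measure_display).
Context (X : measurableType d1) (Z : measurableType d2).
Variables (m : {sigma_finite_measure set X -> \bar R}).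
Variables (l : {sigma_finite_measure set Z -> \bar R}).
Local Notation P := (m \x l)%E.
Implicit Types (F G : L2S P).

Definition L2slice F z := L2 m (fun x => (F : L2T P) (x, z)).

(* The junk value 0 is only taken on a null set of [z]. *)
Definition sl F z : L2S m := if pselect (L2slice F z) is left h then MkL2T h else 0.

Lemma ae_L2slice F : \forall z \ae l, L2slice F z.
Proof. exact: (L2_slice1 (L2funP F)). Qed.

Lemma slE F z x : L2slice F z -> (sl F z : L2T m) x = (F : L2T P) (x, z).
Proof. by rewrite /sl; case: pselect. Qed.

Lemma slDZ (a : R[i]) F G z : L2slice F z -> L2slice G z ->
  sl (a *: F + G) z = a *: sl F z + sl G z.
Proof.
move=> hF hG; apply: L2T_eq => x; have hFG : L2slice (a *: F + G) z.
  exact: (L2D (L2Z a hF) hG).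
by rewrite slE//= !slE.
Qed.

Lemma sl0 z : sl 0 z = 0.
Proof. by apply: L2T_eq => x; rewrite slE//; exact: L2_0. Qed.

Lemma slB F G z : L2slice F z -> L2slice G z -> sl (F - G) z = sl F z - sl G z.
Proof. by move=> hF hG; rewrite addrC -scaleN1r slDZ// scaleN1r addrC. Qed.

Lemma sl_tensor (f : L2S m) (g : L2S l) z : sl (tensorS f g) z = (g : L2T l) z *: f.
Proof.
have h : L2slice (tensorS f g) z.
  have := L2Z ((g : L2T l) z) (L2funP f).
  by rewrite /L2slice /= /tensor /=; under eq_fun do rewrite mulrC.
by apply: L2T_eq => x; rewrite slE//= /tensor /= mulrC.
Qed.

Lemma hn_sl_sqr F z : L2slice F z ->
  (hn (sl F z) ^+ 2)%:E = nsq m (fun x => (F : L2T P) (x, z)).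
Proof.
by move=> hF; rewrite -nsq_hn; apply: eq_integral => x _; rewrite slE.
Qed.

Lemma hn_sqr_slices F : (hn F ^+ 2)%:E = (\int[l]_z nsq m (fun x => (F : L2T P) (x, z)))%E.
Proof. by rewrite -nsq_hn nsq_prod2//; apply: L2_cmeasurable; exact: L2funP. Qed.

Lemma measurable_nsq_sl F : measurable_fun setT (fun z => nsq m (fun x => (F : L2T P) (x, z))).
Proof. by apply: measurable_nsq_slice1; apply: L2_cmeasurable; exact: L2funP. Qed.

End slices.

Section slice_comparison.
Context (R : realType) (d1 d1' d2 : measure_display).
Context (X : measurableType d1) (Y : measurableType d1') (Z : measurableType d2).
Variables (m : {sigma_finite_measure set X -> \bar R}).
Variables (n : {sigma_finite_measure set Y -> \bar R}).
Variables (l : {sigma_finite_measure set Z -> \bar R}).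

Lemma hn_slices_le (F : L2S (m \x l)%E) (G : L2S (n \x l)%E) (c : R) : 0 <= c ->
  (\forall z \ae l, hn (sl G z) <= c * hn (sl F z)) -> hn G <= c * hn F.
Proof.
move=> c0 FG; rewrite -(@ler_pXn2r _ 2)// ?nnegrE ?mulr_ge0 ?hn_ge0//.
rewrite exprMn -lee_fin [X in (_ <= X)%E]EFinM !hn_sqr_slices -ge0_integralZl//; last 3 first.
- exact: measurable_nsq_sl.
- by move=> z _; exact: nsq_ge0.
- by rewrite lee_fin sqr_ge0.
apply: ae_ge0_le_integral => //.
- by move=> z _; exact: nsq_ge0.
- exact: measurable_nsq_sl.
- by move=> z _; rewrite mule_ge0 ?nsq_ge0// lee_fin sqr_ge0.
- by apply: measurable_funeM; exact: measurable_nsq_sl.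
apply: filterS3 FG (ae_L2slice F) (ae_L2slice G) => z FG hF hG _.
rewrite -!hn_sl_sqr// -EFinM lee_fin -exprMn.
by rewrite lerXn2r ?nnegrE ?mulr_ge0 ?hn_ge0.
Qed.

End slice_comparison.

(** Replaces the extraction of an almost everywhere convergent subsequence: [einfs _ 0] is the
    infimum over all k, and its integral lies below that of each [f k]. *)
Lemma ae_eq0_le (d : measure_display) (Z : measurableType d) (R : realType)
    (l : {measure set Z -> \bar R}) (f : nat -> Z -> \bar R) : (forall k, measurable_fun setT (f k)) ->
  (forall k z, 0 <= f k z)%E ->
  (forall e : R, 0 < e -> exists k, (\int[l]_z f k z <= e%:E)%E) ->
  \forall z \ae l, einfs (f^~ z) 0%N = 0%E.
Proof.
move=> mf f0 fe.
have e0 z : (0 <= einfs (f^~ z) 0%N)%E by apply: le_ereal_inf_tmp => _ [k _ <-].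
have me : measurable_fun setT (fun z => einfs (f^~ z) 0%N) by exact: measurable_fun_einfs.
apply/(ge0_integral_eq0_ae l me e0); apply/eqP; rewrite eq_le integral_ge0// andbT.
apply/lee_addgt0Pr => e /fe [k hk]; rewrite add0e; apply: le_trans hk.
apply: ge0_le_integral => // z _.
by apply: ereal_inf_lbound; exists k.
Qed.

Section amplification.
Context (R : realType) (d1 d1' d2 : measure_display).
Context (X : measurableType d1) (Y : measurableType d1') (Z : measurableType d2).
Variables (m : {sigma_finite_measure set X -> \bar R}).
Variables (n : {sigma_finite_measure set Y -> \bar R}).
Variables (l : {sigma_finite_measure set Z -> \bar R}).
Variables (A : L2S m -> L2S n) (M : R) (bA : blinear A M).
Implicit Types (F : L2S (m \x l)%E) (G : L2S (n \x l)%E).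

(* [G] represents the image of [F] under the ampliation of [A] by the identity. *)
Definition amp_rel F G := \forall z \ae l, hn (A (sl F z) - sl G z) = 0.

Lemma amp_relDZ (a : R[i]) F F' G G' : amp_rel F G -> amp_rel F' G' ->
  amp_rel (a *: F + F') (a *: G + G').
Proof.
move=> FG FG'; have FGs := ae_conj FG FG'.
have Fs := ae_conj (ae_L2slice F) (ae_L2slice F').
have Gs := ae_conj (ae_L2slice G) (ae_L2slice G').
move: FGs Fs Gs; apply: filterS3 => z [h h'] [hF hF'] [hG hG'].
rewrite !slDZ//; apply/eqP; rewrite eq_le hn_ge0 andbT.
rewrite (le_trans (hn_triangle _ (a *: A (sl F z) + A (sl F' z)) _))//.
rewrite (blinear_comb bA) add0r opprD addrACA -scalerBr (le_trans (hnD _ _))//.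
by rewrite hnZ h h' mulr0 addr0.
Qed.

Lemma amp_rel0 : amp_rel 0 0.
Proof.
by apply: aeW => z; rewrite !sl0 subr0; apply: (blinear_null bA); exact: hn0.
Qed.

Lemma amp_relB F F' G G' : amp_rel F G -> amp_rel F' G' -> amp_rel (F - F') (G - G').
Proof.
move=> h h'; have := amp_relDZ (-1) h' h.
by rewrite !scaleN1r [- F' + _]addrC [- G' + _]addrC.
Qed.

Lemma amp_rel_le F G : amp_rel F G -> hn G <= M * hn F.
Proof.
have [_ M0 _] := bA; move=> FG; apply: hn_slices_le => //.
apply: filterS FG => z h.
by rewrite -(hn_null_eq h) (blinear_le bA).
Qed.

Lemma amp_rel_unique F G G' : amp_rel F G -> amp_rel F G' -> hn (G - G') = 0.
Proof.
move=> h h'; have := amp_rel_le (amp_relB h h'); rewrite subrr hn0 mulr0 => e.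
by apply/eqP; rewrite eq_le e hn_ge0.
Qed.

Lemma amp_rel_tensor f g : amp_rel (tensorS f g) (tensorS (A f) g).
Proof. by apply: aeW => z; rewrite !sl_tensor (blinearZ bA). Qed.

(** The images of the slices under A do not by themselves form a jointly measurable function.
    Therefore G is given explicitly for tensors and carried to limits by the bound [amp_rel_le]. *)
Lemma amp_rel_exists F : exists G, amp_rel F G.
Proof.
have [_ M0 _] := bA.
move: F; apply: tensor_dense.
- by exists 0; exact: amp_rel0.
- by move=> a F F' [G hG] [G' hG']; exists (a *: G + G'); exact: amp_relDZ.
- move=> F Fapp.
  have /choice[FG FGP] : forall k : nat, exists FG : L2S (m \x l)%E * L2S (n \x l)%E,
      amp_rel FG.1 FG.2 /\ hn (F - FG.1) < k.+1%:R^-1.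
    move=> k; have k0 : 0 < k.+1%:R^-1 :> R by rewrite invr_gt0.
    by have [F' [G h] FF'] := Fapp _ k0; exists (F', G).
  have Fcv : hcv (fun k => (FG k).1) F.
    move=> e e0; exists (Num.truncn e^-1) => k Nk; rewrite hnB.
    have [_ /lt_le_trans] := FGP k; apply.
    by rewrite invf_ple ?posrE// (le_trans (ltW (truncnS_gt _)))// ler_nat.
  have Gle i j : hn ((FG i).2 - (FG j).2) <= M * hn ((FG i).1 - (FG j).1).
    by apply: amp_rel_le; apply: amp_relB; [have [] := FGP i|have [] := FGP j].
  have [G Gcv] : exists G, hcv (fun k => (FG k).2) G.
    apply: L2_complete => e e0; have M1 : 0 < M + 1 by rewrite ltr_wpDl.
    have [N hN] := hcv_cauchy Fcv (divr_gt0 e0 M1); exists N => i j /hN h /h.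
    rewrite ltr_pdivlMr// => {}h; rewrite (le_lt_trans (Gle i j))// (le_lt_trans _ h)//.
    by rewrite mulrC ler_wpM2l ?hn_ge0// lerDl.
  exists G.
  pose N F z := nsq m (fun x => (F : L2T (m \x l)%E) (x, z)).
  pose N' G z := nsq n (fun x => (G : L2T (n \x l)%E) (x, z)).
  (* From (p + q)^2 <= 2 p^2 + 2 q^2: for every k, [D k z] dominates the squared norm of
     [A (sl F z) - sl G z]. Its infimum over k vanishes for almost every z. *)
  pose D k z := ((2 * M ^+ 2)%:E * N (F - (FG k).1)%R z + 2%:E * N' ((FG k).2 - G)%R z)%E.
  have c0 : 0 <= 2 * M ^+ 2 by rewrite mulr_ge0// sqr_ge0.
  have D0 k z : (0 <= D k z)%E.
    by rewrite adde_ge0// mule_ge0// ?nsq_ge0// lee_fin.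
  have mD k : measurable_fun setT (D k).
    by apply: emeasurable_funD; apply: measurable_funeM; exact: measurable_nsq_sl.
  have : \forall z \ae l, einfs (D^~ z) 0%N = 0%E.
    apply: ae_eq0_le => // e e0.
    have iD k : (\int[l]_z D k z = (2 * M ^+ 2 * hn (F - (FG k).1) ^+ 2 +
        2 * hn ((FG k).2 - G) ^+ 2)%:E)%E.
      rewrite ge0_integralD//.
      - rewrite !ge0_integralZl_EFin//; try exact: measurable_nsq_sl;
          try by move=> z _; exact: nsq_ge0.
        by rewrite -!hn_sqr_slices -!EFinM.
      - by move=> z _; rewrite mule_ge0// ?nsq_ge0// lee_fin.
      - by apply: measurable_funeM; exact: measurable_nsq_sl.
      - by move=> z _; rewrite mule_ge0// ?nsq_ge0// lee_fin.
      - by apply: measurable_funeM; exact: measurable_nsq_sl.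
    (* If both squared distances are at most e / c, the integral of [D k] is at most e. The cap by 1
       in [e'] gives t^2 <= t for the distances t. *)
    pose c := 2 * M ^+ 2 + 2; have cp : 0 < c by rewrite ltr_wpDl.
    pose e' := Num.min 1 (e / c); have e'0 : 0 < e' by rewrite lt_min ltr01 divr_gt0.
    have [N1 hN1] := Fcv _ e'0; have [N2 hN2] := Gcv _ e'0.
    exists (maxn N1 N2); rewrite iD lee_fin.
    have := hN1 _ (leq_maxl N1 N2); rewrite hnB; have := hN2 _ (leq_maxr N1 N2).
    set a := hn _; set b := hn (F - _) => ha hb.
    have sq (t : R) : 0 <= t -> t < e' -> t ^+ 2 <= e / c.
      move=> t0 te; have t1 : t <= 1 by rewrite ltW// (lt_le_trans te)// ge_min lexx.
      have t2 : t <= e / c by rewrite ltW// (lt_le_trans te)// ge_min lexx orbT.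
      by rewrite expr2 (le_trans _ t2)// ler_piMl.
    have a2 := sq _ (hn_ge0 _) ha; have b2 := sq _ (hn_ge0 _) hb.
    have -> : e = 2 * M ^+ 2 * (e / c) + 2 * (e / c).
      by rewrite -mulrDl -/c mulrC divfK// gt_eqF.
    by rewrite lerD// ler_wpM2l.
  have hFs := ae_foralln (fun k => ae_conj
    (ae_L2slice (FG k).1) (ae_L2slice (FG k).2)).
  have hFG := ae_foralln (fun k => (FGP k).1).
  have hs := ae_conj (ae_L2slice F) (ae_L2slice G).
  have hh := ae_conj hFs hFG.
  apply: filterS3 hs hh => z [hF hG] [hk hkr] Dz.
  apply/eqP; rewrite eq_le hn_ge0 andbT leNgt; apply/negP => pos.
  have : ((hn (A (sl F z) - sl G z) ^+ 2)%:E <= einfs (D^~ z) 0%N)%E.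
    apply: le_ereal_inf_tmp => _ [k _ <-]; rewrite /D /N /N'.
    have [h1 h2] := hk k.
    rewrite -!hn_sl_sqr; [|exact: L2B|exact: L2B].
    rewrite -!EFinM -EFinD lee_fin !slB//.
    have t1 : hn (A (sl F z) - sl G z) <=
        M * hn (sl F z - sl (FG k).1 z) + hn (sl (FG k).2 z - sl G z).
      rewrite (le_trans (hn_triangle _ (sl (FG k).2 z) _))// lerD2r.
      rewrite (le_trans (hn_triangle _ (A (sl (FG k).1 z)) _))//.
      by rewrite hkr addr0 (blinear_sub_le bA).
    apply: (@le_trans _ _ ((M * hn (sl F z - sl (FG k).1 z) +
        hn (sl (FG k).2 z - sl G z)) ^+ 2)).
      by rewrite lerXn2r ?nnegrE ?addr_ge0 ?mulr_ge0 ?hn_ge0.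
    set p := hn _; set q := hn _.
    have := sqr_ge0 (M * p - q); nra.
  rewrite Dz lee_fin leNgt => /negP; apply.
  by rewrite exprn_gt0.
- by move=> f g; exists (tensorS (A f) g); exact: amp_rel_tensor.
Qed.

(** An arbitrary choice, unique up to a vector of norm 0 by [amp_rel_unique]. *)
Definition amp F : L2S (n \x l)%E := projT1 (cid (amp_rel_exists F)).

Lemma ampP F : amp_rel F (amp F).
Proof. exact: projT2 (cid (amp_rel_exists F)). Qed.

Lemma amp_blinear : blinear amp M.
Proof.
have [_ M0 _] := bA; split=> // [a F F'|F]; last exact: amp_rel_le (ampP F).
by apply: amp_rel_unique (ampP _) _; apply: amp_relDZ; exact: ampP.
Qed.

Lemma amp_tensor f g : hn (amp (tensorS f g) - tensorS (A f) g) = 0.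
Proof. by apply: amp_rel_unique (ampP _) _; exact: amp_rel_tensor. Qed.

End amplification.

Lemma hcompact_bounded (R : realType) (H W : semiHilbert R) (A : H -> W) (M C : R)
    (u : nat -> H) : blinear A M -> hcompact A -> 0 < C -> (forall n, hn (u n) <= C) ->
  exists s v, increasing_nat s /\ hcv (A \o u \o s) v.
Proof.
move=> bA cA C0 uC; pose c : R[i] := (C^-1%:C)%C.
have cC : cmod c = C^-1 by rewrite cmodR ger0_norm// invr_ge0 ltW.
have [|t [v [ti tv]]] := cA (fun n => c *: u n).
  by move=> n; rewrite hnZ cC mulrC ler_pdivrMr// mul1r.
exists t, ((C%:C)%C *: v); split=> // d d0.
have [N hN] := tv _ (divr_gt0 d0 C0); exists N => n /hN.
rewrite ltr_pdivlMr// mulrC => h; apply: le_lt_trans h => /=.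
have cM1 : cmod (C%:C)%C = C :> R by rewrite cmodR ger0_norm// ltW.
rewrite -[X in X * _]cM1 -hnZ scalerBr.
have e1 : (C%:C)%C *: (c *: u (t n)) = u (t n).
  by rewrite scalerA /c -rmorphM /= mulfV ?scale1r// gt_eqF.
rewrite -{1}e1 le_eqVlt; apply/orP; left; apply/eqP; apply: hn_null_eq.
by rewrite opprB subrKA (blinearZ bA).
Qed.


Lemma hn_le0 (R : realType) (H : semiHilbert R) (x : H) : hn x <= 0 -> hn x = 0.
Proof. by move=> h; apply/eqP; rewrite eq_le h hn_ge0. Qed.

Lemma hn_sub_proj_null (R : realType) (H : semiHilbert R) (e : nat -> H) K (x y : H) :
  orthosys e -> hn (x - y) = 0 -> hn (x - proj e K x) = hn (y - proj e K y).
Proof.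
move=> oe xy; apply: hn_null_eq; apply: hn_le0; rewrite -xy.
apply: le_trans (hn_sub_proj_le oe K (x - y)); rewrite projB.
have -> // : x - proj e K x - (y - proj e K y) = x - y - (proj e K x - proj e K y).
by rewrite !opprB addrACA [RHS]addrACA; congr (_ + _); rewrite addrC.
Qed.

Lemma blinear_sum_null (R : realType) (H W : semiHilbert R) (A : H -> W) (M : R)
    I (r : seq I) (F : I -> H) (G : I -> W) : blinear A M ->
  (forall i, hn (A (F i) - G i) = 0) ->
  hn (A (\sum_(i <- r) F i) - \sum_(i <- r) G i) = 0.
Proof.
move=> bA FG; apply: hn_le0; rewrite (le_trans (hn_triangle _ (\sum_(i <- r) A (F i)) _))//.
rewrite (blinear_sum bA) add0r -sumrB (le_trans (hn_sum _ _ _))//.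
by rewrite big1.
Qed.

Lemma hn_lt_third (R : realType) (H : semiHilbert R) (x y x' y' : H) (d : R) :
  hn (x - x') < d / 3 -> hn (y - y') < d / 3 -> hn (x' - y') < d / 3 -> hn (x - y) < d.
Proof.
move=> h1 h2 h3; have t1 := hn_triangle x x' y; have t2 := hn_triangle x' y' y.
by move: h1 h2 h3 t1 t2; rewrite (hnB y y'); lra.
Qed.

Section swap_space.
Context (R : realType) (d1 d2 : measure_display).
Context (X1 : measurableType d1) (X2 : measurableType d2).
Variables (m1 : {sigma_finite_measure set X1 -> \bar R}).
Variables (m2 : {sigma_finite_measure set X2 -> \bar R}).

Definition swapS (F : L2S (m1 \x m2)%E) : L2S (m2 \x m1)%E := MkL2T (L2_swap (L2funP F)).

Lemma hn_swapS F : hn (swapS F) = hn F.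
Proof.
apply/eqP; rewrite -(@eqrXn2 _ 2)// ?hn_ge0//; apply/eqP; apply: EFin_inj.
by rewrite -!nsq_hn /= nsq_swap//; apply: L2_cmeasurable; exact: L2funP.
Qed.

Lemma swapSDZ (a : R[i]) F G : swapS (a *: F + G) = a *: swapS F + swapS G.
Proof. exact: L2T_eq. Qed.

Lemma swapSB F G : swapS (F - G) = swapS F - swapS G.
Proof. exact: L2T_eq. Qed.

Definition pintS (G : L2S (m1 \x m2)%E) (b : L2S m1) : L2S m2 :=
  MkL2T (L2_pint1 (L2funP G) (L2J (L2funP b))).

Lemma pintSE G b z : L2slice G z -> (pintS G b : L2T m2) z = ip (sl G z) b.
Proof.
by move=> hG; rewrite ip_L2; apply: eq_cintegral => x; rewrite slE.
Qed.

Lemma hn_pintS G b : hn (pintS G b) <= hn G * hn b.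
Proof.
rewrite -(@ler_pXn2r _ 2)// ?nnegrE ?mulr_ge0 ?hn_ge0// exprMn -lee_fin.
rewrite [X in (_ <= X)%E]EFinM -!nsq_hn.
have -> : nsq m1 (b : L2T m1) = nsq m1 (fun x => conjc ((b : L2T m1) x)).
  by apply: eq_integral => x _; rewrite cmod_conj.
exact: nsq_pint1 (L2funP G) (L2J (L2funP b)).
Qed.

Lemma sl_sum I (r : seq I) (F : I -> L2S (m1 \x m2)%E) z : (forall i, L2slice (F i) z) ->
  L2slice (\sum_(i <- r) F i) z /\ sl (\sum_(i <- r) F i) z = \sum_(i <- r) sl (F i) z.
Proof.
move=> hF; elim: r => [|i r [IH1 IH2]].
  by rewrite !big_nil sl0; split=> //; exact: L2_0.
rewrite !big_cons -IH2; split; first exact: (L2D (hF i) IH1).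
by rewrite -[F i]scale1r slDZ// !scale1r.
Qed.

Lemma L2slice_tensor (f : L2S m1) (g : L2S m2) z : L2slice (tensorS f g) z.
Proof.
have := L2Z ((g : L2T m2) z) (L2funP f).
by rewrite /L2slice /= /tensor /=; under eq_fun do rewrite mulrC.
Qed.

(** Expanding G along e in the first coordinate amounts to projecting every slice; this reduces
    estimates on the product to estimates on the factor. *)
Lemma sl_expansion (e : nat -> L2S m1) K G z : L2slice G z ->
  sl (G - \sum_(k < K) tensorS (e k) (pintS G (e k))) z = sl G z - proj e K (sl G z).
Proof.
move=> hG; have [h1 h2] := @sl_sum _ (index_enum 'I_K)
  (fun k : 'I_K => tensorS (e k) (pintS G (e k))) z (fun k => L2slice_tensor _ _ z).
rewrite slB// h2; congr (_ - _); apply: eq_bigr => k _.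
by rewrite sl_tensor pintSE.
Qed.

End swap_space.

Lemma swapS_tensor (R : realType) (d1 d2 : measure_display)
  (X1 : measurableType d1) (X2 : measurableType d2)
  (m1 : {sigma_finite_measure set X1 -> \bar R})
  (m2 : {sigma_finite_measure set X2 -> \bar R}) (f : L2S m1) (g : L2S m2) :
  swapS (tensorS f g) = tensorS g f.
Proof. by apply: L2T_eq => z; rewrite /= /tensor /= mulrC. Qed.

Section tensor_operator.
Context (R : realType) (d1 d2 d1' d2' : measure_display).
Context (X1 : measurableType d1) (X2 : measurableType d2).
Context (Y1 : measurableType d1') (Y2 : measurableType d2').
Variables (m1 : {sigma_finite_measure set X1 -> \bar R}).
Variables (m2 : {sigma_finite_measure set X2 -> \bar R}).
Variables (n1 : {sigma_finite_measure set Y1 -> \bar R}).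
Variables (n2 : {sigma_finite_measure set Y2 -> \bar R}).
Variables (T1 : L2S m1 -> L2S n1) (M1 : R) (bT1 : blinear T1 M1).
Variables (T2 : L2S m2 -> L2S n2) (M2 : R) (bT2 : blinear T2 M2).

(** The operator 1 (x) T2: [amp] acts on the first coordinate, so the coordinates are exchanged
    before and after. *)
Definition amp2 (F : L2S (n1 \x m2)%E) : L2S (n1 \x n2)%E :=
  swapS (amp (l := n1) bT2 (swapS F)).

Lemma amp2_blinear : blinear amp2 M2.
Proof.
have [h1 h2 h3] := amp_blinear n1 bT2; split=> // [a F G|F].
  by rewrite /amp2 -swapSDZ -swapSB hn_swapS swapSDZ h1.
by rewrite /amp2 hn_swapS -(hn_swapS F) h3.
Qed.

Lemma amp2_tensor f g : hn (amp2 (tensorS f g) - tensorS f (T2 g)) = 0.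
Proof.
by rewrite /amp2 swapS_tensor -(swapS_tensor (T2 g) f) -swapSB hn_swapS amp_tensor.
Qed.

Definition amp1 (F : L2S (m1 \x m2)%E) : L2S (n1 \x m2)%E := amp (l := m2) bT1 F.

Definition tens_op (F : L2S (m1 \x m2)%E) : L2S (n1 \x n2)%E := amp2 (amp1 F).

Lemma amp1_blinear : blinear amp1 M1.
Proof. exact: (amp_blinear m2 bT1). Qed.

Lemma amp1_tensor f g : hn (amp1 (tensorS f g) - tensorS (T1 f) g) = 0.
Proof. exact: (amp_tensor bT1). Qed.

Lemma blinear_comp_null (V W U : semiHilbert R) (A : V -> W) (B : W -> U) MB x y :
  blinear B MB -> hn (A x - y) = 0 -> hn (B (A x) - B y) = 0.
Proof.
by move=> bB h; apply: hn_le0; rewrite (le_trans (blinear_sub_le bB _ _))// h mulr0.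
Qed.

Lemma tens_op_blinear : blinear tens_op (M2 * M1).
Proof.
have [_ p2 p3] := amp1_blinear; have [_ q2 q3] := amp2_blinear; split; last 2 first.
- by rewrite mulr_ge0.
- by move=> F; rewrite (le_trans (q3 _))// -mulrA ler_wpM2l// p3.
move=> a F G; apply: hn_le0.
rewrite (le_trans (hn_triangle _ (amp2 (a *: amp1 F + amp1 G)) _))//.
rewrite (blinear_comb amp2_blinear a (amp1 F) (amp1 G)) addr0.
by rewrite (blinear_comp_null amp2_blinear (blinear_comb amp1_blinear a F G)).
Qed.

Lemma tens_op_tensor f g : hn (tens_op (tensorS f g) - tensorS (T1 f) (T2 g)) = 0.
Proof.
apply: hn_le0; rewrite (le_trans (hn_triangle _ (amp2 (tensorS (T1 f) g)) _))//.
rewrite (amp2_tensor (T1 f) g) addr0.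
by rewrite (blinear_comp_null amp2_blinear (amp1_tensor f g)).
Qed.

Variable e : nat -> L2S n1.
Hypothesis oe : orthosys e.

(** The slice at z of [amp1 F] minus its expansion is the residual of [T1 (sl F z)], hence at most d
    times the norm of the slice of F. Then 1 (x) T2 is applied, term by term on the expansion. *)
Lemma tens_op_expansion K (d : R) (F : L2S (m1 \x m2)%E) : 0 <= d ->
  (forall u, hn (T1 u - proj e K (T1 u)) <= d * hn u) ->
  hn (tens_op F - \sum_(k < K) tensorS (e k) (T2 (pintS (amp1 F) (e k)))) <= M2 * (d * hn F).
Proof.
move=> d0 eK; have [_ M20 _] := bT2.
pose S := \sum_(k < K) tensorS (e k) (pintS (amp1 F) (e k)).
rewrite (le_trans (hn_triangle _ (amp2 S) _))//.
have -> : hn (amp2 S - \sum_(k < K) tensorS (e k) (T2 (pintS (amp1 F) (e k)))) = 0.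
  apply: (blinear_sum_null _ amp2_blinear) => k.
  exact: (amp2_tensor (e k) (pintS (amp1 F) (e k))).
rewrite addr0 (le_trans (blinear_sub_le amp2_blinear (amp1 F) S))// ler_wpM2l//.
apply: hn_slices_le => //.
have := ae_conj (ampP (l := m2) bT1 F) (ae_L2slice (amp1 F)).
apply: filterS => z [h1 h2]; rewrite sl_expansion//.
by rewrite -(hn_sub_proj_null _ oe h1).
Qed.

(** Up to a small error, uniformly on the unit ball, only finitely many coefficients [T2 (p k n)]
    matter. Compactness of T2 makes each of them converge along a subsequence, and the diagonal
    sequence serves all k at once. *)
Lemma tens_op_compact : hcompact T2 ->
  (forall d : R, 0 < d -> exists K, forall u, hn (T1 u - proj e K (T1 u)) <= d * hn u) ->
  hcompact tens_op.
Proof.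
move=> cT2 eK u u1; have [_ M10 _] := bT1; have [_ M20 _] := bT2.
pose p k n := pintS (amp1 (u n)) (e k).
have pM k n : hn (p k n) <= M1.
  rewrite (le_trans (hn_pintS _ _))//.
  have [_ _ h] := amp1_blinear.
  have a1 : hn (amp1 (u n)) <= M1 by rewrite (le_trans (h _))// ler_piMr.
  have [_ /(_ k) [->|->]] := oe; first by rewrite mulr0.
  by rewrite mulr1.
have M11 : 0 < M1 + 1 by rewrite ltr_wpDl.
have [s si sP] : exists2 s, increasing_nat s &
    forall k, exists v, hcv (fun n => T2 (p k (s n))) v.
  apply: (diagonal_extraction (P := fun k s => exists v, hcv (fun n => T2 (p k (s n))) v)).
  - move=> k s si; have [n|t [v [ti tv]]] := hcompact_bounded (u := p k \o s) bT2 cT2 M11.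
      by rewrite (le_trans (pM _ _))// lerDl.
    by exists t => //; exists v.
  - by move=> k s t ti [v sv]; exists v; exact: hcv_sub ti sv.
  - by move=> k j s [v sv]; exists v; exact: (hcv_shift (m := j)) sv.
suff cau : hcauchy (tens_op \o u \o s).
  by have [v hv] := L2_complete cau; exists s, v.
move=> d d0.
have M21 : 0 < M2 + 1 by rewrite ltr_wpDl.
(* The expansion error is M2 times this number, thus below d / 3 even if M2 = 0. *)
have dpos : 0 < d / (3 * (M2 + 1)) by rewrite divr_gt0// mulr_gt0.
have [K hK] := eK _ dpos.
have ex n : hn (tens_op (u n) - \sum_(k < K) tensorS (e k) (T2 (p k n))) < d / 3.
  have := tens_op_expansion (u n) (ltW dpos) hK => /le_lt_trans; apply.
  apply: (@le_lt_trans _ _ (M2 * (d / (3 * (M2 + 1))))).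
    by rewrite ler_wpM2l// ler_piMr// ltW.
  have -> : d / (3 * (M2 + 1)) = (d / 3) / (M2 + 1) by rewrite invfM mulrA.
  rewrite mulrA ltr_pdivrMr// mulrC ltr_pM2l ?divr_gt0//.
  by rewrite ltrDl.
have [N hN] : exists N, forall i j, (N <= i)%N -> (N <= j)%N ->
    hn (\sum_(k < K) tensorS (e k) (T2 (p k (s i))) -
        \sum_(k < K) tensorS (e k) (T2 (p k (s j)))) < d / 3.
  (* Dividing by K.+1 keeps the sum of K errors strictly below d / 3 and covers the case K = 0. *)
  have K1 : 0 < (K.+1)%:R :> R by rewrite ltr0n.
  have d3 : 0 < d / 3 / (K.+1)%:R by rewrite !divr_gt0.
  have /choice[N hN] : forall k, exists N, forall i j, (N <= i)%N -> (N <= j)%N ->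
      hn (T2 (p k (s i)) - T2 (p k (s j))) < d / 3 / (K.+1)%:R.
    by move=> k; have [v hv] := sP k; exact: (hcv_cauchy hv).
  exists (\max_(k < K) N k) => i j Ni Nj.
  rewrite -sumrB (le_lt_trans (hn_sum _ _ _))//.
  apply: (@le_lt_trans _ _ (\sum_(k < K) (d / 3 / (K.+1)%:R))).
    apply: ler_sum => k _.
    have -> : tensorS (e k) (T2 (p k (s i))) - tensorS (e k) (T2 (p k (s j))) =
        tensorS (e k) (T2 (p k (s i)) - T2 (p k (s j))).
      by apply: L2T_eq => z; rewrite /= /tensor -mulrBr.
    rewrite hn_tensorS (@le_trans _ _ (hn (T2 (p k (s i)) - T2 (p k (s j)))))//.
      by have [_ /(_ k) [->|->]] := oe; rewrite ?mul0r ?mul1r ?hn_ge0.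
    by rewrite ltW// hN ?(leq_trans _ Ni) ?(leq_trans _ Nj)// (leq_bigmax k).
  rewrite sumr_const card_ord -[X in X < _]mulr_natr -mulrA gtr_pMr ?divr_gt0//.
  by rewrite mulrC ltr_pdivrMr// mul1r ltr_nat.
exists N => i j Ni Nj.
exact: (hn_lt_third (ex (s i)) (ex (s j)) (hN i j Ni Nj)).
Qed.

End tensor_operator.

(** * Series *)

Section real_series.
Variable R : realType.
Implicit Types (a b : nat -> R).

(** Meant for nonnegative terms, where bounded partial sums are the same as summability. *)
Definition bsum b := exists B : R, forall n, series b n <= B.

Definition rsum b : R := limn (series b).

Lemma bsum_is_cvg b : (forall i, 0 <= b i) -> bsum b -> cvgn (series b).
Proof.
move=> b0 [B hB]; apply: nondecreasing_is_cvgn; first exact: nondecreasing_series.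
by exists B => _ [n _ <-].
Qed.

Lemma series_le_rsum b n : (forall i, 0 <= b i) -> bsum b -> series b n <= rsum b.
Proof.
move=> b0 sb; apply: nondecreasing_cvgn_le; last exact: bsum_is_cvg.
exact: nondecreasing_series.
Qed.

Lemma bsum_le a b : (forall i, a i <= b i) -> bsum b -> bsum a.
Proof. by move=> ab [B hB]; exists B => n; rewrite (le_trans _ (hB n))// ler_sum. Qed.

Lemma bsumD a b : bsum a -> bsum b -> bsum (fun i => a i + b i).
Proof.
move=> [A hA] [B hB]; exists (A + B) => n.
by rewrite /series /= big_split; exact: (lerD (hA n) (hB n)).
Qed.

Lemma bsumZ (c : R) b : 0 <= c -> bsum b -> bsum (fun i => c * b i).
Proof.
by move=> c0 [B hB]; exists (c * B) => n; rewrite /series /= -mulr_sumr; exact: (ler_wpM2l c0 (hB n)).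
Qed.

Lemma bsum_mul a b : bsum (fun i => a i ^+ 2) -> bsum (fun i => b i ^+ 2) ->
  bsum (fun i => a i * b i).
Proof.
move=> ha hb; apply: bsum_le (bsumD ha hb) => i.
have := sqr_ge0 (a i - b i); have := sqr_ge0 (a i + b i); nra.
Qed.

Lemma bsum_ereal b : (forall i, 0 <= b i) ->
  bsum b <-> (\sum_(0 <= i <oo) (b i)%:E < +oo)%E.
Proof.
move=> b0; split=> [[B hB]|h].
  rewrite (@le_lt_trans _ _ B%:E) ?ltry//.
  apply: lime_le; first by apply: is_cvg_nneseries => i _ _; rewrite lee_fin.
  by apply: nearW => n; rewrite sumEFin lee_fin; exact: hB.
exists (fine (\sum_(0 <= i <oo) (b i)%:E)%E) => n.
rewrite /series /= -lee_fin fineK; last first.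
  by rewrite ge0_fin_numE// nneseries_ge0// => i _ _; rewrite lee_fin.
by rewrite -sumEFin; apply: nneseries_lim_ge => i _ _; rewrite lee_fin.
Qed.

Lemma rsum_ereal b : (forall i, 0 <= b i) -> bsum b ->
  (rsum b)%:E = (\sum_(0 <= i <oo) (b i)%:E)%E.
Proof.
move=> b0 sb; apply/esym/cvg_lim => //.
have -> : (fun n => \sum_(0 <= i < n) (b i)%:E)%E = EFin \o series b.
  by apply/funext => n; rewrite /= sumEFin.
by apply: cvg_EFin; [exact: nearW|exact: bsum_is_cvg].
Qed.

Lemma rsum_tail b (e : R) : (forall i, 0 <= b i) -> bsum b -> 0 < e ->
  exists N, forall n, (N <= n)%N -> rsum b - series b n < e.
Proof.
move=> b0 sb e0; have /cvgrPdist_lt /(_ e e0)[N _ hN] := bsum_is_cvg b0 sb.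
exists N => n /hN; rewrite ger0_norm// subr_ge0.
exact: series_le_rsum.
Qed.

Lemma rsum_le_tail a b K : (forall i, `|a i| <= b i) -> bsum b ->
  cvgn (series a) /\ `|rsum a - series a K| <= rsum b - series b K.
Proof.
move=> ab sb; have b0 i : 0 <= b i by rewrite (le_trans _ (ab i)).
have ca : cvgn (series a).
  by apply: normed_cvg; apply: bsum_is_cvg => [i|]; [exact: normr_ge0|exact: bsum_le sb].
split=> //.
have cn : (fun n => `|series a n - series a K|) @ \oo --> `|rsum a - series a K|.
  by apply: cvg_norm; apply: cvgB; [exact: ca|exact: cvg_cst].
rewrite -(cvg_lim _ cn)//; apply: limr_le; first by apply/cvg_ex; eexists; exact: cn.
exists K => // n /= Kn; rewrite /series /= (big_cat_nat (n := K))//= addrAC subrr add0r.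
rewrite (le_trans (ler_norm_sum _ _ _))//.
apply: (@le_trans _ _ (series b n - series b K)); last by rewrite lerD2r series_le_rsum.
by rewrite /series /= [X in _ <= X - _](big_cat_nat (n := K))//= addrAC subrr add0r ler_sum.
Qed.

End real_series.

Section complex_series.
Variable R : realType.
Implicit Types (u v : nat -> R[i]) (b : nat -> R).

Definition asum u := bsum (fun i => cmod (u i)).

Lemma cseriesE u : cseries u = Complex (rsum (fun i => Re (u i))) (rsum (fun i => Im (u i))).
Proof. by []. Qed.

Lemma eq_cseries u v : (forall i, u i = v i) -> cseries u = cseries v.
Proof. by move=> uv; congr cseries; exact/funext. Qed.

Lemma asum_le u b : (forall i, cmod (u i) <= b i) -> bsum b -> asum u.
Proof. exact: bsum_le. Qed.

Lemma asum_cvg u : asum u ->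
  cvgn (series (fun i => Re (u i))) /\ cvgn (series (fun i => Im (u i))).
Proof.
move=> su; split.
  by have [] := @rsum_le_tail _ (fun i => Re (u i)) _ 0 (fun i => normr_Re _) su.
by have [] := @rsum_le_tail _ (fun i => Im (u i)) _ 0 (fun i => normr_Im _) su.
Qed.

(** The factor 2 arises because real and imaginary parts are summed and estimated separately. *)
Lemma cseries_tail u b K : (forall i, cmod (u i) <= b i) -> bsum b ->
  cmod (cseries u - \sum_(i < K) u i) <= 2 * (rsum b - series b K).
Proof.
move=> ub sb; rewrite -(big_mkord xpredT u).
have hRe := (@rsum_le_tail _ (fun i => Re (u i)) b K
  (fun i => le_trans (normr_Re _) (ub i)) sb).2.
have hIm := (@rsum_le_tail _ (fun i => Im (u i)) b K
  (fun i => le_trans (normr_Im _) (ub i)) sb).2.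
rewrite (le_trans (cmod_le _))// ReD ImD ReN ImN Re_sum Im_sum.
by rewrite mulr_natl mulr2n lerD.
Qed.

Lemma cseries_le u b : (forall i, cmod (u i) <= b i) -> bsum b ->
  cmod (cseries u) <= 2 * rsum b.
Proof.
by move=> ub sb; have := cseries_tail 0 ub sb; rewrite big_ord0 /series /= big_geq// !subr0.
Qed.

(** [cseries] is built from two values of [limn]; the dominating series guarantees that both limits
    exist, so that convergence of the partial sums identifies them. *)
Lemma cseries_eqP u b z : (forall i, cmod (u i) <= b i) -> bsum b ->
  (forall e : R, 0 < e -> exists N, forall K, (N <= K)%N -> cmod (\sum_(i < K) u i - z) < e) ->
  cseries u = z.
Proof.
move=> ub sb uz; apply/eqP; rewrite -subr_eq0; apply/eqP; apply: cmod_eq0.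
have b0 i : 0 <= b i by rewrite (le_trans _ (ub i))// cmod_ge0.
apply/eqP; rewrite eq_le cmod_ge0 andbT; apply/ler_addgt0Pr => e e0; rewrite add0r.
have e2 : 0 < e / 2 by rewrite divr_gt0.
have e4 : 0 < e / 4 by rewrite divr_gt0.
have [N1 h1] := uz _ e2; have [N2 h2] := rsum_tail b0 sb e4.
have h3 := cseries_tail (maxn N1 N2) ub sb.
have := h1 _ (leq_maxl N1 N2); have := h2 _ (leq_maxr N1 N2).
set s := \sum_(i < _) _ in h3 *; move=> h4 h5.
have -> : cseries u - z = (cseries u - s) + (s - z) by rewrite subrKA.
by rewrite (le_trans (cmodD _ _))//; lra.
Qed.

Lemma cseriesDZ (c : R[i]) u v : asum u -> asum v ->
  cseries (fun i => c * u i + v i) = c * cseries u + cseries v.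
Proof.
move=> su sv; have [u1 u2] := asum_cvg su; have [v1 v2] := asum_cvg sv.
have sZ (r : R) (w : nat -> R) : series (fun i => r * w i) = (fun n => r * series w n).
  by apply/funext => n; rewrite /series /= mulr_sumr.
have sD (w w' : nat -> R) : series (fun i => w i + w' i) = (fun n => series w n + series w' n).
  by apply/funext => n; rewrite /series /= big_split.
apply: complex_eq; rewrite ?ReD ?ImD ?ReM ?ImM /=.
- apply: cvg_lim => //; under eq_fun do rewrite ReD ReM -mulNr.
  rewrite !sD !sZ -mulNr; apply: cvgD => //; apply: cvgD; apply: cvgMr => //.
- apply: cvg_lim => //; under eq_fun do rewrite ImD ImM.
  rewrite !sD !sZ; apply: cvgD => //; apply: cvgD; apply: cvgMr => //.
Qed.

Lemma cseries0 : cseries (fun=> 0 : R[i]) = 0.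
Proof.
by apply: complex_eq => /=; apply: cvg_lim => //; rewrite /series /=;
  under eq_fun do rewrite big1//; exact: cvg_cst.
Qed.

Lemma asum0 : asum (fun=> 0).
Proof.
rewrite /asum (_ : (fun=> _) = fun=> 0); first by exists 0 => n; rewrite /series /= big1.
by apply/funext => i; exact: ComplexField.Normc.normc0.
Qed.

Lemma cseriesZ (c : R[i]) u : asum u -> cseries (fun i => c * u i) = c * cseries u.
Proof.
move=> su; rewrite -[RHS]addr0 -cseries0 -(cseriesDZ c su asum0).
by apply: eq_cseries => i; rewrite addr0.
Qed.

Lemma cseriesD u v : asum u -> asum v ->
  cseries (fun i => u i + v i) = cseries u + cseries v.
Proof.
move=> su sv; rewrite -[X in X + _]mul1r -(cseriesDZ 1 su sv).
by apply: eq_cseries => i; rewrite mul1r.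
Qed.

Lemma asumD u v : asum u -> asum v -> asum (fun i => u i + v i).
Proof. by move=> su sv; apply: asum_le (bsumD su sv) => i; exact: cmodD. Qed.

Lemma cseries_sum I (r : seq I) (u : I -> nat -> R[i]) : (forall j, asum (u j)) ->
  asum (fun i => \sum_(j <- r) u j i) /\
  cseries (fun i => \sum_(j <- r) u j i) = \sum_(j <- r) cseries (u j).
Proof.
move=> su; elim: r => [|j r [IH1 IH2]].
  rewrite big_nil; under eq_fun do rewrite big_nil.
  by split; [exact: asum0|rewrite cseries0].
under eq_fun do rewrite big_cons; rewrite big_cons -IH2; split; first exact: asumD.
exact: cseriesD.
Qed.

Lemma tannery (a : nat -> nat -> R[i]) u b : (forall n i, cmod (a n i) <= b i) -> bsum b ->
  (forall i (e : R), 0 < e -> exists N, forall n, (N <= n)%N -> cmod (a n i - u i) < e) ->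
  forall e : R, 0 < e -> exists N, forall n, (N <= n)%N -> cmod (cseries (a n) - cseries u) < e.
Proof.
move=> ab sb au e e0.
have b0 i : 0 <= b i by rewrite (le_trans _ (ab 0%N i))// cmod_ge0.
have ub i : cmod (u i) <= b i.
  apply/ler_addgt0Pr => d d0; have [N /(_ N (leqnn _)) hN] := au i d d0.
  have -> : u i = a N i - (a N i - u i) by rewrite opprB addrC subrK.
  by rewrite (le_trans (cmodD _ _))// cmodN lerD// ltW.
(* Each of the two tails costs less than 2 e / 5 because of the factor in [cseries_tail], and the
   finite sums differ by at most e / 5. *)
have e5 : 0 < e / 5 by rewrite divr_gt0.
have [K hK] := rsum_tail b0 sb e5.
have eK : 0 < e / 5 / K.+1%:R by rewrite divr_gt0.
have [N hN] := choice (fun i => au i _ eK); exists (\max_(i < K) N i) => n Nn.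
have := cseries_tail K (ab n) sb; have := cseries_tail K ub sb; have := hK K (leqnn _).
have : cmod (\sum_(i < K) a n i - \sum_(i < K) u i) <= e / 5.
  rewrite -sumrB (le_trans (cmod_sum _ _ _))//.
  apply: (@le_trans _ _ (\sum_(i < K) e / 5 / K.+1%:R)).
    apply: ler_sum => i _; apply: ltW; apply: hN.
    by rewrite (leq_trans _ Nn)// (leq_bigmax i).
  rewrite sumr_const card_ord -[_ *+ _]mulr_natr mulrAC ler_pdivrMr//.
  by rewrite ler_wpM2l ?(ltW e5)// ler_nat.
set s := \sum_(i < K) _; set t := \sum_(i < K) _ => h0 h1 h2 h3.
have -> : cseries (a n) - cseries u = (cseries (a n) - s) + ((s - t) + (t - cseries u)).
  by rewrite addrA subrKA addrA subrK.
rewrite (le_lt_trans (cmodD _ _))//.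
have := cmodD (s - t) (t - cseries u); rewrite -[t - _]opprB cmodN; lra.
Qed.

End complex_series.

(** * Rearrangement of double series *)

Section double_series.
Variable R : realType.

Lemma nat2_enum : exists p : nat -> nat * nat, bijective p.
Proof.
have /ppcard_eqP[f] := card_nat2.
by have [g fg gf] : bijective f := bijTT; exists g; exists f.
Qed.

Variable p : nat -> nat * nat.
Hypothesis bp : bijective p.

Lemma nneseries_double (b : nat * nat -> \bar R) : (forall z, 0 <= b z)%E ->
  (\sum_(0 <= n <oo) b (p n) = \sum_(0 <= i <oo) \sum_(0 <= k <oo) b (i, k))%E.
Proof.
move=> b0; rewrite nneseries_esumT//.
rewrite -(@reindex_esum _ _ _ setT setT p b); last first.
  by have [q pq qp] := bp; split => // [n m _ _|z _]; [exact: (can_inj pq)|exists (q z)].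
rewrite [RHS]nneseries_esumT; last by move=> i; apply: nneseries_ge0 => k _ _; exact: b0.
under [RHS]eq_esum => i _ do rewrite nneseries_esumT//.
rewrite (@esum_esum _ _ _ setT (fun=> setT) (fun i k => b (i, k)))//.
rewrite (_ : [set: nat] `*`` (fun=> [set: nat]) = [set: nat * nat]); last first.
  by apply/seteqP; split.
by apply: eq_esum => -[i k] _.
Qed.

Section double_real.
Variable b : nat * nat -> R.
Hypothesis b0 : forall z, 0 <= b z.
Hypothesis sb : bsum (b \o p).

Lemma double_bsum_inner i : bsum (fun k => b (i, k)).
Proof.
apply/bsum_ereal => //; move/bsum_ereal : sb => /(_ (fun=> b0 _)).
rewrite (nneseries_double (b := EFin \o b)) => [h|z]; last by rewrite lee_fin.
have n0 j : (0 <= \sum_(0 <= k <oo) (EFin \o b) (j, k))%E.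
  by apply: nneseries_ge0 => k _ _; rewrite lee_fin.
apply: le_lt_trans h.
rewrite (nneseriesD1 (n := i) (P := xpredT) (f := fun j => \sum_(0 <= k <oo) (EFin \o b) (j, k))%E)//.
rewrite -[leLHS]adde0; apply: leeD; first by [].
by apply: nneseries_ge0 => j _ _.
Qed.

Lemma double_rsum : bsum (fun i => rsum (fun k => b (i, k))) /\
  rsum (b \o p) = rsum (fun i => rsum (fun k => b (i, k))).
Proof.
have r0 i : 0 <= rsum (fun k => b (i, k)).
  have := series_le_rsum 0 (fun k => b0 (i, k)) (double_bsum_inner i).
  by rewrite /series /= big_geq.
have E : (\sum_(0 <= n <oo) (b (p n))%:E =
    \sum_(0 <= i <oo) (rsum (fun k => b (i, k)))%:E)%E.
  rewrite (nneseries_double (b := EFin \o b)) => [|z]; last by rewrite lee_fin.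
  by apply: eq_eseriesr => i _; rewrite rsum_ereal//; exact: double_bsum_inner.
have s2 : bsum (fun i => rsum (fun k => b (i, k))).
  by apply/bsum_ereal => //; rewrite -E; apply/(bsum_ereal (fun=> b0 _)).
split=> //; apply: EFin_inj.
by rewrite (rsum_ereal (fun n => b0 (p n)) sb) (rsum_ereal r0 s2) -E.
Qed.

End double_real.

Lemma rsumB (a b : nat -> R) : cvgn (series a) -> cvgn (series b) ->
  rsum (fun i => a i - b i) = rsum a - rsum b.
Proof.
move=> ca cb; apply: cvg_lim => //.
have -> : series (fun i => a i - b i) = (fun n => series a n - series b n).
  by apply/funext => n; rewrite /series /= sumrB.
exact: cvgB.
Qed.

Lemma double_rsum_abs (a : nat * nat -> R) (b : nat * nat -> R) :
  (forall z, `|a z| <= b z) -> bsum (b \o p) ->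
  rsum (a \o p) = rsum (fun i => rsum (fun k => a (i, k))).
Proof.
move=> ab sb.
(* Positive and negative parts reduce the claim to nonnegative terms. *)
pose a1 z := Num.max (a z) 0; pose a2 z := Num.max (- a z) 0.
have aE z : a z = a1 z - a2 z.
  rewrite /a1 /a2; have /orP[h|h] := le_total 0 (a z).
    by rewrite max_l// max_r ?subr0// oppr_le0.
  by rewrite (max_r h) max_l ?oppr_ge0// sub0r opprK.
have a1b z : a1 z <= b z.
  by rewrite /a1 ge_max (le_trans (ler_norm _) (ab z)) (le_trans _ (ab z)).
have a2b z : a2 z <= b z.
  by rewrite /a2 ge_max (le_trans _ (ab z)) ?(le_trans _ (ab z))// -normrN ler_norm.
have a10 z : 0 <= a1 z by rewrite /a1 le_max lexx orbT.
have a20 z : 0 <= a2 z by rewrite /a2 le_max lexx orbT.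
have s1 : bsum (a1 \o p) by apply: bsum_le sb => i; exact: a1b.
have s2 : bsum (a2 \o p) by apply: bsum_le sb => i; exact: a2b.
have [t1 e1] := double_rsum a10 s1; have [t2 e2] := double_rsum a20 s2.
have r0 (c : nat * nat -> R) : (forall z, 0 <= c z) -> bsum (c \o p) ->
    forall i, 0 <= rsum (fun k => c (i, k)).
  move=> c0 sc i; have := series_le_rsum 0 (fun k => c0 (i, k)) (double_bsum_inner c0 sc i).
  by rewrite /series /= big_geq.
have -> : a \o p = (fun n => (a1 \o p) n - (a2 \o p) n).
  by apply/funext => n; exact: aE.
have p1 : cvgn (series (a1 \o p)) by apply: bsum_is_cvg s1 => i; exact: a10.
have p2 : cvgn (series (a2 \o p)) by apply: bsum_is_cvg s2 => i; exact: a20.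
have c1 := bsum_is_cvg (r0 _ a10 s1) t1; have c2 := bsum_is_cvg (r0 _ a20 s2) t2.
rewrite (rsumB p1 p2) e1 e2 -(rsumB c1 c2).
congr rsum; apply/funext => i.
have d1 := bsum_is_cvg (fun k => a10 (i, k)) (double_bsum_inner a10 s1 i).
have d2 := bsum_is_cvg (fun k => a20 (i, k)) (double_bsum_inner a20 s2 i).
by rewrite -(rsumB d1 d2); congr rsum; apply/funext => k; rewrite -aE.
Qed.

Lemma double_cseries (u : nat * nat -> R[i]) (b : nat * nat -> R) :
  (forall z, cmod (u z) <= b z) -> bsum (b \o p) ->
  cseries (u \o p) = cseries (fun i => cseries (fun k => u (i, k))).
Proof.
move=> ub sb; rewrite !cseriesE; congr Complex.
- exact: (@double_rsum_abs (fun z => Re (u z)) b (fun z => le_trans (normr_Re _) (ub z)) sb).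
- exact: (@double_rsum_abs (fun z => Im (u z)) b (fun z => le_trans (normr_Im _) (ub z)) sb).
Qed.

End double_series.

Lemma cmod_lt_third (R : realType) (p0 p1 p2 t1 t2 : R[i]) (d : R) :
  cmod (t1 + t2 - p0) < d / 3 -> cmod (t1 - p1) < d / 3 -> cmod (t2 - p2) < d / 3 ->
  cmod (p0 - (p1 + p2)) <= d.
Proof.
move=> h0 h1 h2.
have -> : p0 - (p1 + p2) = - (t1 + t2 - p0) + ((t1 - p1) + (t2 - p2)) by ring.
have c1 := cmodD (- (t1 + t2 - p0)) ((t1 - p1) + (t2 - p2)); have c2 := cmodD (t1 - p1) (t2 - p2).
by rewrite cmodN in c1; lra.
Qed.

Lemma ip_eq_null (R : realType) (H : semiHilbert R) (x y z : H) :
  hn (x - y) = 0 -> ip x z = ip y z.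
Proof.
move=> xy; apply/eqP; rewrite -subr_eq0 -ipBl; apply/eqP; exact: ip_nulll.
Qed.

(** Absolute convergence in norm; continuity of the inner product then allows summation term by
    term. *)
Lemma hilbert_series (R : realType) (H : semiHilbert R) (u : nat -> H) :
  (forall v : nat -> H, hcauchy v -> exists w, hcv v w) -> bsum (fun i => hn (u i)) ->
  exists2 v, hcv (fun n => \sum_(i < n) u i) v &
    forall c, ip v c = cseries (fun i => ip (u i) c).
Proof.
move=> Hc su; have u0 i : 0 <= hn (u i) by exact: hn_ge0.
have tail N n : (N <= n)%N ->
    hn (\sum_(i < n) u i - \sum_(i < N) u i) <= rsum (fun i => hn (u i)) - series (fun i => hn (u i)) N.
  move=> Nn; rewrite -!(big_mkord xpredT u) (big_cat_nat (n := N))//= addrAC subrr add0r.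
  rewrite (le_trans (hn_sum _ _ _))//.
  apply: (@le_trans _ _ (series (fun i => hn (u i)) n - series (fun i => hn (u i)) N)).
    by rewrite /series /= [X in _ <= X - _](big_cat_nat (n := N))//= addrAC subrr add0r.
  by rewrite lerD2r series_le_rsum.
have [v hv] : exists v, hcv (fun n => \sum_(i < n) u i) v.
  apply: Hc => e e0; have e2 : 0 < e / 2 by rewrite divr_gt0.
  have [N hN] := rsum_tail u0 su e2; exists N => m n Nm Nn.
  have h1 := tail _ _ Nm; have h2 := tail _ _ Nn; have h3 := hN _ (leqnn N).
  rewrite (le_lt_trans (hn_triangle _ (\sum_(i < N) u i) _))//.
  by rewrite [hn (\sum_(i < N) u i - _)]hnB; lra.
exists v => // c; apply/esym; have c1 : 0 < hn c + 1 by rewrite ltr_wpDl// hn_ge0.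
apply: (@cseries_eqP _ _ (fun i => hn c * hn (u i))).
- by move=> i; rewrite (le_trans (cauchy_schwarz _ _))// mulrC.
- by apply: bsumZ => //; exact: hn_ge0.
- move=> e e0; have [N hN] := hv _ (divr_gt0 e0 c1); exists N => K /hN.
  rewrite ltr_pdivlMr// -ip_suml -ipBl => h.
  rewrite (le_lt_trans (cauchy_schwarz _ _))// (le_lt_trans _ h)//.
  by rewrite ler_wpM2l ?hn_ge0// lerDl.
Qed.

(** * The pairing *)

Section ae_series.
Context (R : realType) (d : measure_display) (X : measurableType d).
Variable mu : {measure set X -> \bar R}.

Lemma ae_bsum_sqr (f : nat -> L2S mu) : bsum (fun i => hn (f i) ^+ 2) ->
  \forall x \ae mu, bsum (fun i => cmod ((f i : L2T mu) x) ^+ 2).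
Proof.
move=> sf; have mf i : measurable_fun setT (fun x => (cmod ((f i : L2T mu) x) ^+ 2)%:E).
  by apply: measurable_ecmod2; apply: L2_cmeasurable; exact: L2funP.
have f0 i x : (0 <= (cmod ((f i : L2T mu) x) ^+ 2)%:E)%E by rewrite lee_fin sqr_ge0.
have : \forall x \ae mu, (\sum_(0 <= i <oo) (cmod ((f i : L2T mu) x) ^+ 2)%:E < +oo)%E.
  apply: ge0_integral_lty_ae.
  - by apply: ge0_emeasurable_sum => // i x _ _; exact: f0.
  - by move=> x; apply: nneseries_ge0 => i _ _; exact: f0.
  rewrite integral_nneseries//.
  move/(bsum_ereal (fun i => sqr_ge0 (hn (f i)))) : sf; congr (_ < _)%E.
  by apply: eq_eseriesr => i _; rewrite -nsq_hn.
by apply: filterS => x h; apply/bsum_ereal => // i; exact: sqr_ge0.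
Qed.

(** For every N, the infimum over n >= N of |s n - v|^2 vanishes almost everywhere. So at almost
    every point v is approached by values [s n x] with arbitrarily large n, which forces it to be
    the pointwise limit. *)
Lemma hcv_ae_limit (s : nat -> L2S mu) (v : L2S mu) (S : X -> R[i]) : hcv s v ->
  (\forall x \ae mu, forall e : R, 0 < e ->
    exists N, forall n, (N <= n)%N -> cmod ((s n : L2T mu) x - S x) < e) ->
  \forall x \ae mu, (v : L2T mu) x = S x.
Proof.
move=> sv hS.
pose f N k x := (cmod ((s (k + N)%N : L2T mu) x - (v : L2T mu) x) ^+ 2)%:E.
have H N : \forall x \ae mu, einfs ((f N)^~ x) 0%N = 0%E.
  apply: ae_eq0_le.
  - move=> k; apply: measurable_ecmod2.
    by apply: cmeasurableB; apply: L2_cmeasurable; exact: L2funP.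
  - by move=> k x; rewrite lee_fin sqr_ge0.
  - move=> e e0; pose e' := Num.min 1 e; have e'0 : 0 < e' by rewrite lt_min ltr01.
    have [K hK] := sv _ e'0; exists K.
    have -> : (\int[mu]_x f N K x)%E = nsq mu ((s (K + N)%N - v : L2S mu) : L2T mu) by [].
    rewrite nsq_hn lee_fin; have := hK (K + N)%N (leq_addr _ _).
    rewrite lt_min => /andP[h1 h2]; rewrite expr2 (le_trans _ (ltW h2))//.
    by rewrite ler_piMl ?hn_ge0// ltW.
have := ae_conj hS (ae_foralln H); apply: filterS => x [hx Hx].
apply/eqP; rewrite -subr_eq0; apply/eqP; apply: cmod_eq0.
apply/eqP; rewrite eq_le cmod_ge0 andbT; apply/ler_addgt0Pr => e e0; rewrite add0r.
have e2 : 0 < e / 2 by rewrite divr_gt0.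
have [N hN] := hx _ e2.
have [_ [k _ <-] hk] : exists2 y, [set f N k x | k in [set k | (0 <= k)%N]] y &
    (y < ((e / 2) ^+ 2)%:E)%E.
  by apply: ereal_inf_lt; rewrite [ereal_inf _](Hx N) lte_fin exprn_gt0.
have {hN} := hN (k + N)%N (leq_addl _ _).
move: hk; rewrite lte_fin ltr_pXn2r ?nnegrE ?cmod_ge0 ?(ltW e2)//.
set p := (s _ : L2T mu) x; set q := (v : L2T mu) x => h1 h2.
have -> : q - S x = - (p - q) + (p - S x) by rewrite opprB subrKA.
by rewrite (le_trans (cmodD _ _))// cmodN; lra.
Qed.

Lemma L2_series (u : nat -> L2S mu) : bsum (fun i => hn (u i)) ->
  (\forall x \ae mu, asum (fun i => (u i : L2T mu) x)) ->
  exists2 v : L2S mu, forall c, ip v c = cseries (fun i => ip (u i) c) &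
    \forall x \ae mu, (v : L2T mu) x = cseries (fun i => (u i : L2T mu) x).
Proof.
move=> su ux; have [v hv iv] := hilbert_series (@L2_complete _ _ _ mu) su.
exists v => //; apply: hcv_ae_limit hv _; apply: filterS ux => x sx e e0.
have sumE n : ((\sum_(i < n) u i : L2S mu) : L2T mu) x = \sum_(i < n) (u i : L2T mu) x.
  by elim: n => [|n IH]; rewrite ?big_ord0// !big_ord_recr /= -IH.
have e3 : 0 < e / 3 by rewrite divr_gt0.
have [N hN] := rsum_tail (fun i => cmod_ge0 _) sx e3; exists N => n /hN h.
rewrite sumE -cmodN opprB.
by have := cseries_tail n (fun i => lexx _) sx; lra.
Qed.

Definition conjS (f : L2S mu) : L2S mu := MkL2T (L2J (L2funP f)).

Lemma hn_conjS f : hn (conjS f) = hn f.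
Proof.
apply/eqP; rewrite -(@eqrXn2 _ 2)// ?hn_ge0//; apply/eqP; apply: EFin_inj.
by rewrite -!nsq_hn; apply: eq_integral => x _; rewrite cmod_conj.
Qed.

Lemma ip_conjS_sym (f g : L2S mu) : ip f (conjS g) = ip g (conjS f).
Proof.
by rewrite !ip_L2; apply: eq_cintegral => x /=; rewrite !conjcK mulrC.
Qed.

End ae_series.

Section pairing.
Context (R : realType) (d d' : measure_display).
Context (X : measurableType d) (Y : measurableType d').
Variables (mu : {measure set X -> \bar R}) (nu : {measure set Y -> \bar R}).

Definition l2seq (d0 : measure_display) (Z : measurableType d0)
  (m : {measure set Z -> \bar R}) (f : nat -> L2S m) := bsum (fun i => hn (f i) ^+ 2).

Definition hpair (A : L2S mu -> L2S nu) (f : nat -> L2S mu) (g : nat -> L2S nu) :=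
  cseries (fun i => ip (A (f i)) (conjS (g i))).

Definition kernel_sum (f : nat -> L2S mu) (g : nat -> L2S nu) (z : X * Y) :=
  cseries (fun i => (f i : L2T mu) z.1 * (g i : L2T nu) z.2).

(** V is the function y |-> <h(., y), a> for the kernel h of f and g; integrating out x shows that
    pairing with a rank one operator depends on h alone. *)
Lemma rank_one_series (f : nat -> L2S mu) (g : nat -> L2S nu) (a : L2S mu) :
  l2seq f -> l2seq g ->
  exists2 V : L2S nu, forall c, ip V c = cseries (fun i => ip (f i) a * ip (g i) c) &
    \forall y \ae nu, (V : L2T nu) y = cseries (fun i => ip (f i) a * (g i : L2T nu) y).
Proof.
move=> sf sg.
have sa : bsum (fun i => cmod (ip (f i) a) ^+ 2).
  apply: bsum_le (bsumZ (sqr_ge0 (hn a)) sf) => i.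
  by rewrite -exprMn lerXn2r ?nnegrE ?mulr_ge0 ?cmod_ge0 ?hn_ge0// mulrC cauchy_schwarz.
have [] := @L2_series _ _ _ nu (fun i => ip (f i) a *: g i).
- apply: bsum_le (bsum_mul sa sg) => i; by rewrite hnZ.
- apply: filterS (ae_bsum_sqr sg) => y sy.
  by apply: asum_le (bsum_mul sa sy) => i; rewrite ComplexField.Normc.normcM.
move=> V V1 V2; exists V => // c; rewrite V1; apply: eq_cseries => i.
by rewrite ipZl.
Qed.

(** v is the slice h(., y) of the kernel, as a vector of L^2; the second hypothesis holds for almost
    every y by [ae_bsum_sqr]. *)
Lemma slice_series (f : nat -> L2S mu) (g : nat -> L2S nu) (y : Y) : l2seq f ->
  bsum (fun i => cmod ((g i : L2T nu) y) ^+ 2) ->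
  exists2 v : L2S mu, forall a, ip v a = cseries (fun i => ip (f i) a * (g i : L2T nu) y) &
    \forall x \ae mu, (v : L2T mu) x = kernel_sum f g (x, y).
Proof.
move=> sf sy.
have [] := @L2_series _ _ _ mu (fun i => (g i : L2T nu) y *: f i).
- apply: bsum_le (bsum_mul sy sf) => i; by rewrite hnZ.
- apply: filterS (ae_bsum_sqr sf) => x sx.
  by apply: asum_le (bsum_mul sy sx) => i; rewrite ComplexField.Normc.normcM.
move=> v v1 v2; exists v.
  by move=> a; rewrite v1; apply: eq_cseries => i; rewrite ipZl mulrC.
apply: filterS v2 => x ->; apply: eq_cseries => i /=; by rewrite mulrC.
Qed.

Variables (A : L2S mu -> L2S nu) (M : R).
Hypothesis bA : blinear A M.

Lemma hpair_bound (f : nat -> L2S mu) (g : nat -> L2S nu) i :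
  cmod (ip (A (f i)) (conjS (g i))) <= M * (hn (f i) * hn (g i)).
Proof.
rewrite (le_trans (cauchy_schwarz _ _))// hn_conjS mulrA ler_wpM2r ?hn_ge0//.
exact: (blinear_le bA).
Qed.

Lemma l2seq_bsum (f : nat -> L2S mu) (g : nat -> L2S nu) : l2seq f -> l2seq g ->
  bsum (fun i => M * (hn (f i) * hn (g i))).
Proof. by have [_ M0 _] := bA; move=> sf sg; apply: bsumZ => //; exact: bsum_mul. Qed.

(* Rank one operators are handled by integration, and [A] is approximated by its compositions
   with the projections on the span of finitely many of the functions [F j i]. *)
Lemma hpair_additive (F : nat -> nat -> L2S mu) (G : nat -> nat -> L2S nu) :
  (forall j, l2seq (F j)) -> (forall j, l2seq (G j)) ->
  marginally_null mu nu [set z | kernel_sum (F 0%N) (G 0%N) z <>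
    kernel_sum (F 1%N) (G 1%N) z + kernel_sum (F 2%N) (G 2%N) z] ->
  hpair A (F 0%N) (G 0%N) = hpair A (F 1%N) (G 1%N) + hpair A (F 2%N) (G 2%N).
Proof.
move=> sF sG [X0 [Y0 [mX0 X00 mY0 Y00 N]]]; have [_ M0 _] := bA.
have aeX : \forall x \ae mu, ~ X0 x by exists X0; split => // x /= /contrapT.
have aeY : \forall y \ae nu, ~ Y0 y by exists Y0; split => // y /= /contrapT.
(* The pairing of the j-th kernel with the rank one operator u |-> <u, a> conj(c). *)
pose r j a c := cseries (fun i => ip (F j i) a * ip (G j i) c).
have r_add a c : r 0%N a c = r 1%N a c + r 2%N a c.
  have [V0 V01 V02] := rank_one_series a (sF 0%N) (sG 0%N).
  have [V1 V11 V12] := rank_one_series a (sF 1%N) (sG 1%N).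
  have [V2 V21 V22] := rank_one_series a (sF 2%N) (sG 2%N).
  rewrite /r -V01 -V11 -V21 -ipDl; apply: ip_eq_null; apply/hn_sub_eq0.
  have h := ae_conj V02 (ae_conj V12 V22).
  have b := ae_conj (ae_bsum_sqr (sG 0%N)) (ae_conj (ae_bsum_sqr (sG 1%N)) (ae_bsum_sqr (sG 2%N))).
  have := ae_conj aeY (ae_conj h b); apply: filterS => y [yY0 [[h0 [h1 h2]] [b0 [b1 b2]]]].
  have [v0 v01 v02] := slice_series (sF 0%N) b0.
  have [v1 v11 v12] := slice_series (sF 1%N) b1.
  have [v2 v21 v22] := slice_series (sF 2%N) b2.
  rewrite h0 /= h1 h2 -v01 -v11 -v21 -ipDl; apply: ip_eq_null; apply/hn_sub_eq0.
  have := ae_conj aeX (ae_conj v02 (ae_conj v12 v22)).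
  apply: filterS => x [xX0 [e0 [e1 e2]]] /=; rewrite e0 e1 e2.
  by apply: contrapT => ne; have [[]|[]] := N (x, y) ne.
(* The three sequences are interleaved into one, [F j i] receiving the index 3 i + j, so that a
   single orthonormal system serves all of them. *)
pose v n := F (n %% 3)%N (n %/ 3)%N.
have [e oe ev] := gram_schmidt_seq v.
(* The i-th term of the pairing with A composed with the projection onto the first K vectors,
   written as a sum of rank one pairings. *)
pose t j K := fun i => \sum_(k < K) ip (F j i) (e k) * ip (G j i) (conjS (A (e k))).
have tE j K i : t j K i = ip (A (proj e K (F j i))) (conjS (G j i)).
  have -> : ip (A (proj e K (F j i))) (conjS (G j i)) =
      ip (\sum_(k < K) ip (F j i) (e k) *: A (e k)) (conjS (G j i)).
    apply: ip_eq_null; apply: (blinear_sum_null _ bA) => k.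
    exact: (blinearZ bA).
  rewrite ip_suml; apply: eq_bigr => k _.
  by rewrite ipZl [in RHS]ip_conjS_sym.
have tM j K i : cmod (t j K i) <= M * (hn (F j i) * hn (G j i)).
  rewrite tE (le_trans (cauchy_schwarz _ _))// hn_conjS mulrA ler_wpM2r ?hn_ge0//.
  rewrite (le_trans (blinear_le bA _))// ler_wpM2l//.
  rewrite -(@ler_pXn2r _ 2)// ?nnegrE ?hn_ge0// hn_proj_sqr//; exact: bessel.
(* For K > 3 i + j the projection fixes [F j i] up to norm 0, so each term is eventually constant in
   K, and Tannery's theorem applies. *)
have tcv j : (j < 3)%N -> forall d0 : R, 0 < d0 -> exists N, forall K, (N <= K)%N ->
    cmod (cseries (t j K) - hpair A (F j) (G j)) < d0.
  move=> j3; apply: (tannery (tM j) (l2seq_bsum (sF j) (sG j))) => i d1 d1p.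
  exists (i * 3 + j).+1 => K hK.
  rewrite tE -ipBl ip_nulll ?ComplexField.Normc.normc0//.
  apply: hn_le0; rewrite (le_trans (blinear_sub_le bA _ _))// hnB.
  have := ev (i * 3 + j)%N K hK; rewrite /v modnMDl modn_small// divnMDl// divn_small// addn0.
  by move=> ->; rewrite mulr0.
have t_add K : cseries (t 0%N K) = cseries (t 1%N K) + cseries (t 2%N K).
  have tS j : cseries (t j K) = \sum_(k < K) r j (e k) (conjS (A (e k))).
    rewrite /t; have [] // := @cseries_sum _ _ (index_enum 'I_K)
      (fun (k : 'I_K) i => ip (F j i) (e k) * ip (G j i) (conjS (A (e k)))).
    move=> k; apply: asum_le (bsumZ (mulr_ge0 (hn_ge0 (e k)) (hn_ge0 (conjS (A (e k)))))
      (bsum_mul (sF j) (sG j))) => i.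
    rewrite ComplexField.Normc.normcM [X in _ <= X](_ : _ = (hn (F j i) * hn (e k)) * (hn (G j i) * hn (conjS (A (e k))))).
      by apply: ler_pM; rewrite ?cmod_ge0 ?cauchy_schwarz.
    by ring.
  by rewrite !tS -big_split; apply: eq_bigr => k _; exact: r_add.
apply/eqP; rewrite -subr_eq0; apply/eqP; apply: cmod_eq0.
apply/eqP; rewrite eq_le cmod_ge0 andbT; apply/ler_addgt0Pr => d0 d00; rewrite add0r.
have d3 : 0 < d0 / 3 by rewrite divr_gt0.
have [N0 h0] := tcv 0%N isT _ d3; have [N1 h1] := tcv 1%N isT _ d3; have [N2 h2] := tcv 2%N isT _ d3.
pose K := maxn N0 (maxn N1 N2).
have {}h0 := h0 K (leq_maxl _ _).
have {}h1 := h1 K (leq_trans (leq_maxl N1 N2) (leq_maxr _ _)).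
have {}h2 := h2 K (leq_trans (leq_maxr N1 N2) (leq_maxr _ _)).
rewrite t_add in h0; exact: (cmod_lt_third h0 h1 h2).
Qed.

(** A kernel that vanishes satisfies k = k + k, hence its pairing p satisfies p = p + p. *)
Lemma hpair_null (f : nat -> L2S mu) (g : nat -> L2S nu) : l2seq f -> l2seq g ->
  marginally_null mu nu [set z | kernel_sum f g z <> 0] -> hpair A f g = 0.
Proof.
move=> sf sg N; have := @hpair_additive (fun=> f) (fun=> g) (fun=> sf) (fun=> sg).
have N' : marginally_null mu nu [set z | kernel_sum f g z <> kernel_sum f g z + kernel_sum f g z].
  have [X0 [Y0 [h1 h2 h3 h4 h5]]] := N; exists X0, Y0; split => // z zz; apply: h5.
  by apply: contra_not zz => /= ->; rewrite addr0.
by move=> /(_ N') /eqP; rewrite -subr_eq0 opprD addrA subrr add0r oppr_eq0 => /eqP.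
Qed.

End pairing.

(** * Passage between operators on functions and operators on [L2S] *)

Section operator_bridge.
Context (R : realType) (d d' : measure_display).
Context (X : measurableType d) (Y : measurableType d').
Variables (mu : {measure set X -> \bar R}) (nu : {measure set Y -> \bar R}).

Section lift.
Variables (T : (X -> R[i]) -> Y -> R[i]) (bT : bounded_operator mu nu T).

Lemma oplift_L2 f : L2 mu f -> L2 nu (T f).
Proof. by have [h _ _] := bT; exact: h. Qed.

Definition oplift (f : L2S mu) : L2S nu := MkL2T (oplift_L2 (L2funP f)).

Lemma oplift_blinear : exists M, blinear oplift M.
Proof.
have [_ TDZ [M TM]] := bT; exists `|M|; split=> // [a f g|f].
  apply/hn_sub_eq0; have := TDZ a _ _ (L2funP f) (L2funP g).
  by apply: filterS => y /(_ I).
have := TM _ (L2funP f); rewrite L2norm_hn (L2norm_hn (oplift f)) -EFinM lee_fin => h.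
by rewrite (le_trans h)// ler_wpM2r ?hn_ge0// ler_norm.
Qed.

Lemma oplift_compact : compact_operator mu nu T -> hcompact oplift.
Proof.
move=> [_ cT] u u1; have [|s [v [si lv sv]]] := cT (fun n => u n : L2T mu).
  by move=> n; split; [exact: L2funP|rewrite L2norm_hn lee_fin].
exists s, (MkL2T lv); split=> // e e0.
have E n : L2norm nu (fun y => T (u (s n) : L2T mu) y - v y) =
    (hn ((oplift \o u \o s) n - MkL2T lv : L2S nu))%:E by rewrite -L2norm_hn.
move: sv; under eq_fun do rewrite E.
move=> /fine_cvgP[_ /cvgrPdist_lt /(_ e e0)[N _ hN]]; exists N => n /hN /=.
by rewrite sub0r normrN ger0_norm// hn_ge0.
Qed.

Lemma oplift_nonzero : nonzero_operator mu nu T -> exists f, hn (oplift f) <> 0.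
Proof.
move=> [f lf Tf0]; exists (MkL2T lf) => /hn_eq0 h; apply: Tf0.
by apply: filterS h => y.
Qed.

End lift.

Section unlift.
Variables (A : L2S mu -> L2S nu) (M : R) (bA : blinear A M).

(* Zero outside of L^2, where the values of an operator are irrelevant. *)
Definition unlift (f : X -> R[i]) : Y -> R[i] :=
  if pselect (L2 mu f) is left h then (A (MkL2T h) : L2T nu) else fun=> 0.

Lemma unliftE f (lf : L2 mu f) : unlift f = (A (MkL2T lf) : L2T nu).
Proof.
rewrite /unlift; case: pselect => // h; congr (L2fun (A (MkL2T _))).
exact: Prop_irrelevance.
Qed.

Lemma unlift_bounded : bounded_operator mu nu unlift.
Proof.
split.
- by move=> f lf; rewrite (unliftE lf); exact: L2funP.
- move=> a f g lf lg; rewrite (unliftE lf) (unliftE lg) (unliftE (L2D (L2Z a lf) lg)).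
  have := blinear_comb bA a (MkL2T lf) (MkL2T lg); move/hn_sub_eq0.
  by apply: filterS => y h _; exact: h.
- exists M => f lf; rewrite (unliftE lf).
  rewrite (L2norm_hn (A (MkL2T lf))) (L2norm_hn (MkL2T lf : L2S mu)) -EFinM lee_fin.
  exact: (blinear_le bA).
Qed.

Lemma oplift_unlift (f : L2S mu) : oplift unlift_bounded f = A f.
Proof.
apply: L2T_eq => y; rewrite /= (unliftE (L2funP f)).
by case: f => f lf.
Qed.

Lemma unlift_compact : hcompact A -> compact_operator mu nu unlift.
Proof.
move=> cA; split; first exact: unlift_bounded.
move=> u hu; pose u' n : L2S mu := MkL2T (hu n).1.
have [|s [v [si sv]]] := cA u'.
  by move=> n; rewrite -lee_fin -L2norm_hn; exact: (hu n).2.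
exists s, (v : L2T nu); split=> //; first exact: L2funP.
have E n : L2norm nu (fun y => unlift (u (s n)) y - (v : L2T nu) y) =
    (hn ((A \o u' \o s) n - v))%:E by rewrite -L2norm_hn (unliftE (hu (s n)).1).
under eq_fun do rewrite E.
by apply: cvg_EFin; [exact: nearW|exact/hcvP].
Qed.

Lemma unlift_nonzero f : hn (A f) <> 0 -> nonzero_operator mu nu unlift.
Proof.
move=> Af; exists (f : L2T mu); first exact: L2funP.
have e : MkL2T (L2funP f) = f by apply: L2T_eq.
rewrite (unliftE (L2funP f)) e => h; apply: Af; apply/hn_eq0.
by apply: filterS h => y /(_ I).
Qed.

End unlift.

Definition rep (f : nat -> L2S mu) (g : nat -> L2S nu) (h : X * Y -> R[i]) :=
  [/\ l2seq f, l2seq g & marginally_null mu nu [set z | h z <> kernel_sum f g z]].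

Lemma l2seqE (d0 : measure_display) (Z : measurableType d0)
    (m : {measure set Z -> \bar R}) (f : nat -> L2S m) :
  l2seq f <-> (\sum_(0 <= i <oo) L2norm m (f i : L2T m) ^+ 2 < +oo)%E.
Proof.
rewrite /l2seq bsum_ereal; last by move=> i; exact: sqr_ge0.
rewrite (_ : (\sum_(0 <= i <oo) _)%E =
  (\sum_(0 <= i <oo) L2norm m (f i : L2T m) ^+ 2)%E)//.
by apply: eq_eseriesr => i _; rewrite L2norm_hn EFin_expe.
Qed.

Lemma rep_represents f g h : rep f g h ->
  represents mu nu (fun i => f i : L2T mu) (fun i => g i : L2T nu) h.
Proof.
move=> [sf sg N]; split=> //; try (by move=> i; exact: L2funP); exact/l2seqE.
Qed.

Lemma represents_rep f g h : represents mu nu f g h ->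
  exists f' g', [/\ forall i, (f' i : L2T mu) = f i :> (X -> R[i]),
    forall i, (g' i : L2T nu) = g i :> (Y -> R[i]) & rep f' g' h].
Proof.
move=> [lf lg sf sg N].
exists (fun i => MkL2T (lf i) : L2S mu), (fun i => MkL2T (lg i) : L2S nu).
by split=> //; split=> //; exact/l2seqE.
Qed.

Lemma pairing_oplift T (bT : bounded_operator mu nu T) (f : nat -> L2S mu) (g : nat -> L2S nu) :
  pairing nu T (fun i => f i : L2T mu) (fun i => g i : L2T nu) = hpair (oplift bT) f g.
Proof. by []. Qed.

Lemma annihilator_hpair S T (bT : bounded_operator mu nu T) :
  annihilator mu nu S T -> forall h f g, S h -> rep f g h -> hpair (oplift bT) f g = 0.
Proof.
by move=> [_ ST] h f g Sh /rep_represents r; rewrite -pairing_oplift; exact: ST Sh r.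
Qed.

Lemma annihilator_unlift S A M (bA : blinear A M) :
  (forall h f g, S h -> rep f g h -> hpair A f g = 0) -> annihilator mu nu S (unlift A).
Proof.
move=> SA; split; first exact: (unlift_bounded bA).
move=> h f g Sh /represents_rep[f' [g' [ff' gg' r]]].
have -> : f = (fun i => f' i : L2T mu) by apply/funext => i; rewrite ff'.
have -> : g = (fun i => g' i : L2T nu) by apply/funext => i; rewrite gg'.
rewrite (pairing_oplift (unlift_bounded bA)) -[RHS](SA _ _ _ Sh r).
by apply: eq_cseries => i; rewrite oplift_unlift.
Qed.

Lemma bsum_hn_mul (f : nat -> L2S mu) (g : nat -> L2S nu) :
  l2seq f -> l2seq g -> bsum (fun i => hn (f i) * hn (g i)).
Proof. exact: bsum_mul. Qed.

Lemma Gamma_normE (f : nat -> L2S mu) (g : nat -> L2S nu) : l2seq f -> l2seq g ->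
  (\sum_(0 <= i <oo) L2norm mu (f i : L2T mu) * L2norm nu (g i : L2T nu) =
   (rsum (fun i => hn (f i) * hn (g i)))%:E)%E.
Proof.
move=> sf sg; rewrite rsum_ereal; last 2 first.
- by move=> i; rewrite mulr_ge0 ?hn_ge0.
- exact: bsum_hn_mul.
by apply: eq_eseriesr => i _; rewrite !L2norm_hn.
Qed.

Lemma Gamma_norm_lt h (e : R) : (Gamma_norm mu nu h < e%:E)%E ->
  exists f g, rep f g h /\ rsum (fun i => hn (f i) * hn (g i)) < e.
Proof.
move=> /ereal_inf_lt[_ [[f g] /= /represents_rep[f' [g' [ff' gg' r]]] <-]].
exists f', g'; split=> //; have [sf sg _] := r.
rewrite -lte_fin -Gamma_normE//.
by under eq_eseriesr do rewrite ff' gg'.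
Qed.

Lemma lt_Gamma_norm h f g (e : R) : rep f g h ->
  rsum (fun i => hn (f i) * hn (g i)) < e -> (Gamma_norm mu nu h < e%:E)%E.
Proof.
move=> r he; have [sf sg _] := r; apply: (@le_lt_trans _ _ (rsum (fun i => hn (f i) * hn (g i)))%:E).
  rewrite -Gamma_normE//; apply: ereal_inf_lbound.
  exists ((fun i => (f i : L2T mu) : X -> R[i]), (fun i => (g i : L2T nu) : Y -> R[i])) => //.
  exact: (rep_represents r).
by rewrite lte_fin.
Qed.

Lemma GammaP h : Gamma mu nu h <-> exists f g, rep f g h.
Proof.
split=> [[f [g /represents_rep[f' [g' [_ _ r]]]]]|[f [g /rep_represents r]]].
  by exists f', g'.
by eexists; eexists; exact: r.
Qed.

End operator_bridge.

(** Polarisation: the norm of a x + y determines Re (a <x, y>), and a = 1 and a = i give both parts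
    of the inner product. *)
Lemma ip_isometry (R : realType) (H W : semiHilbert R) (U : H -> W) :
  (forall a x y, U (a *: x + y) = a *: U x + U y) -> (forall x, hn (U x) = hn x) ->
  forall x y, ip (U x) (U y) = ip x y.
Proof.
move=> UDZ Uhn x y.
have key a : Re (a * ip (U x) (U y)) = Re (a * ip x y).
  have := Uhn (a *: x + y) => /(congr1 (fun t => t ^+ 2)).
  rewrite UDZ !hn_sqrDZ !Uhn => /addIr/addrI/eqP.
  by rewrite eqrMn2r => /eqP.
apply: complex_eq; first by have := key 1; rewrite !mul1r.
have := key (Complex 0 1); rewrite !ReM /= !mul0r !sub0r !mul1r.
by move/oppr_inj.
Qed.

Lemma rsum_le_bound (R : realType) (b : nat -> R) (c : R) : (forall i, 0 <= b i) ->
  (forall n, series b n <= c) -> rsum b <= c.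
Proof.
move=> b0 bc; apply: limr_le; first by apply: bsum_is_cvg => //; exists c.
exact: nearW.
Qed.

(** * From the product to a factor *)

Section marginally_null_theory.
Context (R : realType) (d d' : measure_display).
Context (X : measurableType d) (Y : measurableType d').
Variables (mu : {measure set X -> \bar R}) (nu : {measure set Y -> \bar R}).
Implicit Types E F : set (X * Y).

Lemma marginally_null_sub E F : E `<=` F -> marginally_null mu nu F -> marginally_null mu nu E.
Proof. by move=> EF [A [B [mA A0 mB B0 FS]]]; exists A, B; split=> // z /EF/FS. Qed.

Lemma marginally_nullU E F : marginally_null mu nu E -> marginally_null mu nu F ->
  marginally_null mu nu (E `|` F).
Proof.
move=> [A [B [mA A0 mB B0 ES]]] [C [D [mC C0 mD D0 FS]]].
exists (A `|` C), (B `|` D); split.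
- exact: measurableU.
- by apply/eqP; rewrite measureU0//; exact/eqP.
- exact: measurableU.
- by apply/eqP; rewrite measureU0//; exact/eqP.
- by move=> z [/ES[[h _]|[_ h]]|/FS[[h _]|[_ h]]]; [left|right|left|right]; split=> //=;
    [left|left|right|right].
Qed.

Lemma marginally_null_ae (P : X -> Prop) (Q : Y -> Prop) E :
  (\forall x \ae mu, P x) -> (\forall y \ae nu, Q y) ->
  (forall x y, P x -> Q y -> ~ E (x, y)) -> marginally_null mu nu E.
Proof.
move=> [A [mA A0 PA]] [B [mB B0 QB]] hE; exists A, B; split=> // -[x y] Exy.
have [Ax|Ax] := pselect (A x); first by left.
have [By|By] := pselect (B y); first by right.
exfalso; apply: (hE x y) => //.
- by apply: contrapT => nP; apply: Ax; exact: PA.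
- by apply: contrapT => nQ; apply: By; exact: QB.
Qed.

Lemma marginally_null_ae2 E : marginally_null mu nu E ->
  exists (P : X -> Prop) (Q : Y -> Prop), [/\ \forall x \ae mu, P x, \forall y \ae nu, Q y &
    forall x y, P x -> Q y -> ~ E (x, y)].
Proof.
move=> [A [B [mA A0 mB B0 EAB]]]; exists (~` A), (~` B); split.
- by exists A; split=> // x /=; exact: contrapT.
- by exists B; split=> // x /=; exact: contrapT.
- by move=> x y nA nB /EAB[[]|[]].
Qed.

Lemma omega_openU E F : omega_open mu nu E -> omega_open mu nu F -> omega_open mu nu (E `|` F).
Proof.
move=> [A [B [mA mB nE]]] [C [D [mC mD nF]]].
exists (fun n => if odd n then A n./2 else C n./2), (fun n => if odd n then B n./2 else D n./2).
split; [by move=> n; case: ifP|by move=> n; case: ifP|].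
apply: marginally_null_sub (marginally_nullU nE nF).
have eq1 n : odd (n.*2.+1) = true by rewrite /= odd_double.
have eq2 n : (n.*2.+1)./2 = n by rewrite /= uphalf_double.
have U z : (\bigcup_n ((if odd n then A n./2 else C n./2) `*`
      (if odd n then B n./2 else D n./2))) z <->
    (\bigcup_n (A n `*` B n)) z \/ (\bigcup_n (C n `*` D n)) z.
  split=> [[n _]|[[n _ h]|[n _ h]]].
  - by case: ifP => _ h; [left|right]; exists n./2.
  - by exists n.*2.+1 => //; rewrite eq1 eq2.
  - by exists n.*2 => //; rewrite odd_double doubleK.
move=> z [[EF /U h]|[/U h EF]].
- case: EF => [Ez|Fz]; [left; left|right; left]; split=> // hz; apply: h; [by left|by right].
- case: h => hz; [left; right|right; right]; split=> // h'; apply: EF; [by left|by right].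
Qed.

End marginally_null_theory.

Section transfer.
Context (R : realType) (d d' c c' : measure_display).
Context (X1 : measurableType d) (Y1 : measurableType d').
Context (X : measurableType c) (Y : measurableType c').
Variables (mu : {measure set X1 -> \bar R}) (nu : {measure set Y1 -> \bar R}).
Variables (zx : {measure set X -> \bar R}) (zy : {measure set Y -> \bar R}).
Variables (p : X -> X1) (q : Y -> Y1).
Hypotheses (mp : measurable_fun setT p) (mq : measurable_fun setT q).
Hypothesis p0 : forall N, measurable N -> mu N = 0%E -> zx (p @^-1` N) = 0%E.
Hypothesis q0 : forall N, measurable N -> nu N = 0%E -> zy (q @^-1` N) = 0%E.

Definition pull (T : Type) (h : X1 * Y1 -> T) (z : X * Y) : T := h (p z.1, q z.2).

Lemma marginally_null_pull E : marginally_null mu nu E -> marginally_null zx zy (pull E).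
Proof.
move=> [A [B [mA A0 mB B0 EAB]]]; exists (p @^-1` A), (q @^-1` B); split.
- by rewrite -[X in measurable X]setTI; exact: mp.
- exact: p0.
- by rewrite -[X in measurable X]setTI; exact: mq.
- exact: q0.
- by move=> z /EAB[[]|[]]; [left|right].
Qed.

Lemma omega_open_pull E : omega_open mu nu E -> omega_open zx zy (pull E).
Proof.
move=> [A [B [mA mB N]]]; exists (fun n => p @^-1` A n), (fun n => q @^-1` B n); split.
- by move=> n; rewrite -[X in measurable X]setTI; exact: mp.
- by move=> n; rewrite -[X in measurable X]setTI; exact: mq.
- apply: marginally_null_sub (marginally_null_pull N) => z [[h1 h2]|[[n _ h1] h2]].
    by left; split=> // -[n _ h]; apply: h2; exists n.
  by right; split=> //; exists n.
Qed.

Lemma ae_pull_p (P : X1 -> Prop) : (\forall x \ae mu, P x) -> \forall x \ae zx, P (p x).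
Proof.
move=> [A [mA A0 PA]]; exists (p @^-1` A); split.
- by rewrite -[X in measurable X]setTI; exact: mp.
- exact: p0.
- by move=> x /PA.
Qed.

Lemma ae_pull_q (P : Y1 -> Prop) : (\forall x \ae nu, P x) -> \forall x \ae zy, P (q x).
Proof.
move=> [A [mA A0 PA]]; exists (q @^-1` A); split.
- by rewrite -[X in measurable X]setTI; exact: mq.
- exact: q0.
- by move=> x /PA.
Qed.

Variables (al : X -> R[i]) (be : Y -> R[i]) (ca cb : R).
Variables (V : L2S mu -> L2S zx) (V' : L2S nu -> L2S zy).
Hypothesis VE : forall f x, (V f : L2T zx) x = (f : L2T mu) (p x) * al x.
Hypothesis V'E : forall g y, (V' g : L2T zy) y = (g : L2T nu) (q y) * be y.
Hypotheses (ca0 : 0 <= ca) (cb0 : 0 <= cb).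
Hypothesis hnV : forall f, hn (V f) = ca * hn f.
Hypothesis hnV' : forall g, hn (V' g) = cb * hn g.

(** With coordinate projections for p and q, and weights in the other coordinate, this is h (x) (al
    (x) be). *)
Definition wpull (h : X1 * Y1 -> R[i]) (z : X * Y) := pull h z * (al z.1 * be z.2).

Lemma rep_pull f g h : rep f g h -> rep (V \o f) (V' \o g) (wpull h).
Proof.
move=> [sf sg N].
have bs (d0 d1 : measure_display) (Z : measurableType d0) (Z1 : measurableType d1)
    (m : {measure set Z -> \bar R}) (m1 : {measure set Z1 -> \bar R})
    (U : L2S m -> L2S m1) (k : R) (w : nat -> L2S m) :
    (forall i, hn (U i) = k * hn i) -> l2seq w -> l2seq (U \o w).
  move=> Uk /(bsumZ (sqr_ge0 k)); apply: bsum_le => i.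
  by rewrite /= Uk exprMn.
split; [exact: bs sf|exact: bs sg|].
(* Besides the pulled back exceptional set, the points at which the series may fail to converge
   absolutely are discarded; elsewhere the weight can be moved into the sum. *)
apply: marginally_null_sub (marginally_nullU (marginally_null_pull N)
  (marginally_null_ae (E := [set z | ~ (bsum (fun i => cmod ((f i : L2T mu) (p z.1)) ^+ 2) /\
    bsum (fun i => cmod ((g i : L2T nu) (q z.2)) ^+ 2))])
    (ae_pull_p (ae_bsum_sqr sf)) (ae_pull_q (ae_bsum_sqr sg)) _)); last first.
  by move=> x y h1 h2 /=; apply; split.
move=> z hz; have [[b1 b2]|nb] := pselect (bsum (fun i => cmod ((f i : L2T mu) (p z.1)) ^+ 2) /\
    bsum (fun i => cmod ((g i : L2T nu) (q z.2)) ^+ 2)); last by right.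
left => /= e; apply: hz; rewrite /wpull {1}/pull e /kernel_sum mulrC -cseriesZ; last first.
  apply: asum_le (bsum_mul b1 b2) => i; by rewrite Normc.normcM.
by apply: eq_cseries => i /=; rewrite VE V'E mulrC mulrACA.
Qed.

Lemma Gamma_pull h : Gamma mu nu h -> Gamma zx zy (wpull h).
Proof. by move=> /GammaP[f [g r]]; apply/GammaP; exists (V \o f), (V' \o g); exact: rep_pull. Qed.

Lemma vanishes_pull (k k1 : set _) h : k `<=` pull k1 -> vanishes_on mu nu k1 h ->
  vanishes_on zx zy k (wpull h).
Proof.
move=> kk /marginally_null_pull; apply: marginally_null_sub => z [/kk kz /= h0]; split=> //= e.
by apply: h0; rewrite /wpull /pull e mul0r.
Qed.

Lemma Phi_pull (k k1 : set _) h : k `<=` pull k1 -> Phi mu nu k1 h -> Phi zx zy k (wpull h).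
Proof. by move=> kk [gh vh]; split; [exact: Gamma_pull|exact: vanishes_pull vh]. Qed.

Lemma Psi_pull (k k1 : set _) h : k `<=` pull k1 -> Psi mu nu k1 h -> Psi zx zy k (wpull h).
Proof.
move=> kk [gh hh]; split=> [|e e0]; first exact: Gamma_pull.
(* [wpull] scales the representing sums by ca * cb, which may be 0; adding 1 keeps the divisor
   positive. *)
have C0 : 0 < ca * cb + 1 by rewrite ltr_wpDl ?mulr_ge0.
have [h0 [gh0 [E [oE kE vE]] dh]] := hh _ (divr_gt0 e0 C0).
exists (wpull h0); split; first exact: Gamma_pull.
  exists (pull E); split; [exact: omega_open_pull|by move=> z /kk/kE|].
  exact: vanishes_pull vE.
have [f [g [r fg]]] := Gamma_norm_lt dh.
have -> : (fun z => wpull h z - wpull h0 z) = wpull (fun z => h z - h0 z).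
  by apply/funext => z; rewrite /wpull -mulrBl.
have [sf sg _] := r; have bfg := bsum_hn_mul sf sg.
apply: (lt_Gamma_norm (rep_pull r)).
apply: (@le_lt_trans _ _ ((ca * cb) * rsum (fun i => hn (f i) * hn (g i)))).
  apply: rsum_le_bound => [i|n]; first by rewrite mulr_ge0 ?hn_ge0.
  apply: (@le_trans _ _ ((ca * cb) * series (fun i => hn (f i) * hn (g i)) n)).
    by rewrite /series /= mulr_sumr; apply: ler_sum => i _; rewrite hnV hnV' mulrACA.
  rewrite ler_wpM2l ?mulr_ge0//; apply: series_le_rsum => // i.
  by rewrite mulr_ge0 ?hn_ge0.
have r0 : 0 <= rsum (fun i => hn (f i) * hn (g i)).
  apply: le_trans (series_le_rsum 0 _ bfg) => [|i]; last by rewrite mulr_ge0 ?hn_ge0.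
  by rewrite /series /= big_geq.
move: fg; rewrite ltr_pdivlMr// mulrDr mulr1 mulrC; apply: le_lt_trans.
by rewrite lerDl.
Qed.

Variables (W : L2S zy -> L2S nu) (MW : R).
Hypothesis bW : blinear W MW.
Hypothesis ipW : forall G g, ip (W G) (conjS g) = ip G (conjS (V' g)).

(** The partial matrix coefficient is W T V. As W is the transpose of V' for the bilinear pairing,
    pairing W T V with (f, g) is pairing T with (V f, V' g), which represents [wpull h]. *)
Lemma transfer_operator T (bT : bounded_operator zx zy T)
    (S : set (X * Y -> R[i])) (S1 : set (X1 * Y1 -> R[i])) :
  (forall h, S1 h -> S (wpull h)) -> annihilator zx zy S T -> compact_operator zx zy T ->
  (exists f g, ip (oplift bT (V f)) (conjS (V' g)) <> 0) ->
  exists T1, [/\ annihilator mu nu S1 T1, compact_operator mu nu T1 & nonzero_operator mu nu T1].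
Proof.
move=> SS aT cT [f [g fg]]; have [M bA] := oplift_blinear bT; set A := oplift bT in bA fg *.
have cA : hcompact A by exact: oplift_compact.
have [_ M0 _] := bA; have [_ MW0 _] := bW.
have VDZ a u v : V (a *: u + v) = a *: V u + V v.
  by apply: L2T_eq => x; rewrite !VE /= !VE mulrDl mulrA.
pose B u := W (A (V u)).
have bB : blinear B (MW * (M * ca)).
  split.
  - move=> a u v; rewrite /B VDZ; apply: hn_le0.
    rewrite (le_trans (hn_triangle _ (W (a *: A (V u) + A (V v))) _))//.
    rewrite (blinear_comb bW a (A (V u)) (A (V v))) addr0.
    rewrite (le_trans (blinear_sub_le bW _ _))//.
    by rewrite (blinear_comb bA a (V u) (V v)) mulr0.
  - by rewrite !mulr_ge0.
  - move=> u; rewrite (le_trans (blinear_le bW _))// -!mulrA ler_wpM2l//.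
    by rewrite (le_trans (blinear_le bA _))// hnV.
have cB : hcompact B.
  move=> u u1; have C0 : 0 < ca + 1 by rewrite ltr_wpDl.
  have [|s [v [si sv]]] := hcompact_bounded (u := V \o u) bA cA C0.
    move=> n; rewrite /= hnV (@le_trans _ _ (ca * 1)) ?ler_wpM2l// mulr1 lerDl//.
  by exists s, (W v); split=> //; exact: (blinear_hcv bW sv).
exists (unlift B); split.
- apply: (annihilator_unlift bB) => h u v Sh r.
  rewrite -[RHS](annihilator_hpair bT aT (SS _ Sh) (rep_pull r)).
  by apply: eq_cseries => i; rewrite /B ipW.
- exact: unlift_compact bB cB.
- apply: (@unlift_nonzero _ _ _ _ _ _ _ B f) => Bf; apply: fg.
  by rewrite -ipW; exact: ip_nulll.
Qed.

End transfer.

Section coordinates.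
Context (R : realType) (d1 d2 : measure_display).
Context (X1 : measurableType d1) (X2 : measurableType d2).
Variables (m1 : {sigma_finite_measure set X1 -> \bar R}).
Variables (m2 : {sigma_finite_measure set X2 -> \bar R}).

Lemma ip_swapS (F G : L2S (m1 \x m2)%E) : ip (swapS F) (swapS G) = ip F G.
Proof. by apply: ip_isometry; [exact: swapSDZ|exact: hn_swapS]. Qed.

Lemma ip_pintS (G : L2S (m1 \x m2)%E) b g :
  ip (pintS G (conjS b)) (conjS g) = ip G (conjS (tensorS b g)).
Proof.
rewrite !ip_L2 /=.
under eq_cintegral do rewrite conjcK; under [RHS]eq_cintegral do rewrite conjcK.
rewrite -(pint1_tensor (L2funP G) (L2funP b) (L2funP g)).
suff E x : pint1 m1 (G : L2T (m1 \x m2)%E) (fun y => conjc (conjc ((b : L2T m1) y))) x =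
    pint1 m1 (G : L2T (m1 \x m2)%E) (b : L2T m1) x.
  by apply: eq_cintegral => x; rewrite -E.
by rewrite /pint1; apply: eq_cintegral => y; rewrite conjcK.
Qed.

Lemma pintS_blinear b : blinear (fun G : L2S (m1 \x m2)%E => pintS G b) (hn b).
Proof.
split=> [a F G||F]; last by rewrite mulrC hn_pintS.
- apply/hn_eq0; apply: filterS (ae_conj (ae_L2slice F) (ae_L2slice G)) => z [hF hG].
  have hFG : L2slice (a *: F + G) z by exact: (L2D (L2Z a hF) hG).
  transitivity ((pintS (a *: F + G) b : L2T m2) z -
    (a * (pintS F b : L2T m2) z + (pintS G b : L2T m2) z)); first by [].
  by rewrite !pintSE// slDZ// ipDZl subrr.
- exact: hn_ge0.
Qed.

Lemma null_fst N : measurable N -> m1 N = 0%E -> (m1 \x m2)%E (fst @^-1` N) = 0%E.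
Proof.
move=> mN N0; rewrite (_ : fst @^-1` N = N `*` [set: X2]).
  by transitivity (m1 N * m2 setT)%E; [exact: product_measure1E|rewrite N0 mul0e].
by apply/seteqP; split=> z //= -[].
Qed.

Lemma null_snd N : measurable N -> m2 N = 0%E -> (m1 \x m2)%E (snd @^-1` N) = 0%E.
Proof.
move=> mN N0; rewrite (_ : snd @^-1` N = [set: X1] `*` N).
  by transitivity (m1 setT * m2 N)%E; [exact: product_measure1E|rewrite N0 mule0].
by apply/seteqP; split=> z //= -[].
Qed.

End coordinates.

Section products.
Context (R : realType) (d1 d2 e1 e2 : measure_display).
Context (X1 : measurableType d1) (X2 : measurableType d2).
Context (Y1 : measurableType e1) (Y2 : measurableType e2).
Variables (m1 : {sigma_finite_measure set X1 -> \bar R}).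
Variables (m2 : {sigma_finite_measure set X2 -> \bar R}).
Variables (n1 : {sigma_finite_measure set Y1 -> \bar R}).
Variables (n2 : {sigma_finite_measure set Y2 -> \bar R}).
Variables (k1 : set (X1 * Y1)) (k2 : set (X2 * Y2)).
Local Notation mu := (m1 \x m2)%E.
Local Notation nu := (n1 \x n2)%E.
Let kappa := (@rho X1 X2 Y1 Y2) @` (k1 `*` k2).

Lemma rho_image z : kappa z <-> k1 (z.1.1, z.2.1) /\ k2 (z.1.2, z.2.2).
Proof.
split=> [[[[x1 y1] [x2 y2]] [/= h1 h2] <-]//|[h1 h2]].
by exists ((z.1.1, z.2.1), (z.1.2, z.2.2)) => //; case: z {h1 h2} => -[? ?] [? ?].
Qed.

Lemma omega_closed_rho : omega_closed m1 n1 k1 -> omega_closed m2 n2 k2 ->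
  omega_closed mu nu kappa.
Proof.
move=> c1 c2; rewrite /omega_closed.
have -> : ~` kappa = pull fst fst (~` k1) `|` pull snd snd (~` k2).
  apply/seteqP; split=> z.
    move=> nz; have [h1|h1] := pselect (k1 (z.1.1, z.2.1)); last by left.
    by right=> h2; apply: nz; apply/rho_image.
  by move=> [h|h] /rho_image[h1 h2]; exact: h.
apply: omega_openU.
- apply: omega_open_pull c1; [exact: measurable_fst|exact: measurable_fst|exact: null_fst|exact: null_fst].
- apply: omega_open_pull c2; [exact: measurable_snd|exact: measurable_snd|exact: null_snd|exact: null_snd].
Qed.

(** Density of tensors is used twice: if all these coefficients vanish, each [A (tensorS f a)] is
    orthogonal to every vector, in particular to itself; so A vanishes on tensors and then
    everywhere. *)
Lemma tensor_witness (A : L2S mu -> L2S nu) (M : R) F : blinear A M -> hn (A F) <> 0 ->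
  exists f a g b, ip (A (tensorS f a)) (conjS (tensorS g b)) <> 0.
Proof.
move=> bA AF; apply: contrapT => h.
have {}h f a g b : ip (A (tensorS f a)) (conjS (tensorS g b)) = 0.
  by apply: contrapT => h'; apply: h; exists f, a, g, b.
have M0 : 0 <= M by case: bA.
have A0 f a : hn (A (tensorS f a)) = 0.
  have : ip (A (tensorS f a)) (A (tensorS f a)) = 0.
    move: {-1}(A (tensorS f a)); apply: tensor_dense => [|c x y x0 y0|x hx|g b].
    - by apply: ip_nullr; exact: hn0.
    - by rewrite ipDr ipZr x0 y0 mulr0 addr0.
    - apply: cmod_eq0; apply/eqP; rewrite eq_le cmod_ge0 andbT; apply/ler_addgt0Pr => e e0.
      have D0 : 0 < hn (A (tensorS f a)) + 1 by rewrite ltr_wpDl ?hn_ge0.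
      have [y y0 xy] := hx _ (divr_gt0 e0 D0).
      have -> : ip (A (tensorS f a)) x = ip (A (tensorS f a)) (x - y).
        by rewrite ipBr y0 subr0.
      rewrite add0r (le_trans (cauchy_schwarz _ _))//.
      rewrite (@le_trans _ _ ((hn (A (tensorS f a)) + 1) * hn (x - y)))//.
        by rewrite ler_wpM2r ?hn_ge0// lerDl.
      by rewrite mulrC -ler_pdivlMr// ltW.
    - rewrite -[RHS](h f a (conjS g) (conjS b)); congr (ip _ _); apply: L2T_eq => z.
      by rewrite /= /tensor /= rmorphM /= !conjcK.
  rewrite ipxx => /(congr1 (@complex.Re R)) /= /eqP.
  by rewrite expf_eq0 /= => /eqP.
apply: AF; move: F; apply: tensor_dense => // [|c x y x0 y0|x hx].
- by apply: (blinear_null bA); exact: hn0.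
- apply: hn_le0; have := hn_triangle (A (c *: x + y)) (c *: A x + A y) 0.
  rewrite !subr0 (blinear_comb bA) add0r => /le_trans; apply.
  by rewrite (le_trans (hnD _ _))// hnZ x0 y0 mulr0 addr0.
- apply: hn_le0; apply/ler_addgt0Pr => e e0.
  have D0 : 0 < M + 1 by rewrite ltr_wpDl.
  have [y y0 xy] := hx _ (divr_gt0 e0 D0).
  have := hn_triangle (A x) (A y) 0; rewrite !subr0 y0 addr0 add0r => /le_trans; apply.
  rewrite (le_trans (blinear_sub_le bA _ _))//.
  rewrite (@le_trans _ _ ((M + 1) * hn (x - y)))//.
    by rewrite ler_wpM2r ?hn_ge0// lerDl.
  by rewrite mulrC -ler_pdivlMr// ltW.
Qed.

Lemma factor_operators T (S : set ((X1 * X2) * (Y1 * Y2) -> R[i]))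
    (S1 : set (X1 * Y1 -> R[i])) (S2 : set (X2 * Y2 -> R[i])) :
  (forall (a : L2S m2) (b : L2S n2) h, S1 h -> S (wpull fst fst
    (fun z => (a : L2T m2) z.2) (fun z => (b : L2T n2) z.2) h)) ->
  (forall (a : L2S m1) (b : L2S n1) h, S2 h -> S (wpull snd snd
    (fun z => (a : L2T m1) z.1) (fun z => (b : L2T n1) z.1) h)) ->
  annihilator mu nu S T -> compact_operator mu nu T -> nonzero_operator mu nu T ->
  (exists T1, [/\ annihilator m1 n1 S1 T1, compact_operator m1 n1 T1 & nonzero_operator m1 n1 T1]) /\
  (exists T2, [/\ annihilator m2 n2 S2 T2, compact_operator m2 n2 T2 & nonzero_operator m2 n2 T2]).
Proof.
move=> S1S S2S aT cT [F lF TF0]; have [bT _] := cT; have [M bA] := oplift_blinear bT.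
have [F' AF] := oplift_nonzero bT (ex_intro2 _ _ F lF TF0).
have [f [a [g [b w]]]] := tensor_witness bA AF.
split.
(* [pintS] integrates out the first coordinate, so the second one has to be brought to the front by
   [swapS]. *)
- apply: (@transfer_operator _ _ _ _ _ _ _ _ _ m1 n1 mu nu fst fst _ _ _ _
    (fun z => (a : L2T m2) z.2) (fun z => (b : L2T n2) z.2) (hn a) (hn b)
    (fun f => tensorS f a) (fun g => tensorS g b) _ _ _ _ _
    (fun G => pintS (swapS G) (conjS b)) _ _ _ T bT S S1) => //.
  + exact: null_fst.
  + exact: null_fst.
  + exact: hn_ge0.
  + by move=> f'; rewrite hn_tensorS mulrC.
  + by move=> f'; rewrite hn_tensorS mulrC.
  + have [h1 h2 h3] := pintS_blinear n1 (conjS b).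
    split; [|exact: h2|by move=> G; rewrite -(hn_swapS G) h3].
    by move=> c G H; rewrite swapSDZ h1.
  + move=> G g'; rewrite ip_pintS -[RHS]ip_swapS; congr (ip _ _).
    by apply: L2T_eq => z; rewrite /= /tensor /= mulrC.
  + by move=> h; exact: S1S.
  + by exists f, g.
- apply: (@transfer_operator _ _ _ _ _ _ _ _ _ m2 n2 mu nu snd snd _ _ _ _
    (fun z => (f : L2T m1) z.1) (fun z => (g : L2T n1) z.1) (hn f) (hn g)
    (fun a => tensorS f a) (fun b => tensorS g b) _ _ _ _ _
    (fun G => pintS G (conjS g)) _ _ _ T bT S S2) => //.
  + exact: null_snd.
  + exact: null_snd.
  + by move=> f' z; rewrite /= /tensor mulrC.
  + by move=> f' z; rewrite /= /tensor mulrC.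
  + exact: hn_ge0.
  + by move=> f'; rewrite hn_tensorS.
  + by move=> f'; rewrite hn_tensorS.
  + exact: pintS_blinear.
  + by move=> G g'; rewrite ip_pintS.
  + by move=> h; exact: S2S.
  + by exists a, b.
Qed.

Lemma factor_M_max T : M_max mu nu kappa T -> compact_operator mu nu T ->
    nonzero_operator mu nu T ->
  (exists T1, [/\ M_max m1 n1 k1 T1, compact_operator m1 n1 T1 & nonzero_operator m1 n1 T1]) /\
  (exists T2, [/\ M_max m2 n2 k2 T2, compact_operator m2 n2 T2 & nonzero_operator m2 n2 T2]).
Proof.
apply: factor_operators => a b h.
- apply: (Psi_pull measurable_fst measurable_fst (@null_fst _ _ _ _ _ m1 m2)
    (@null_fst _ _ _ _ _ n1 n2) (V := fun f => tensorS f a) (V' := fun g => tensorS g b)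
    (ca := hn a) (cb := hn b)) => //; rewrite ?hn_ge0//.
  + by move=> f; rewrite hn_tensorS mulrC.
  + by move=> f; rewrite hn_tensorS mulrC.
  + by move=> z /rho_image[].
- apply: (Psi_pull measurable_snd measurable_snd (@null_snd _ _ _ _ _ m1 m2)
    (@null_snd _ _ _ _ _ n1 n2) (V := fun f => tensorS a f) (V' := fun g => tensorS b g)
    (ca := hn a) (cb := hn b)) => //; rewrite ?hn_ge0//.
  + by move=> f z; rewrite /= /tensor mulrC.
  + by move=> f z; rewrite /= /tensor mulrC.
  + by move=> f; rewrite hn_tensorS.
  + by move=> f; rewrite hn_tensorS.
  + by move=> z /rho_image[].
Qed.

Lemma factor_M_min T : M_min mu nu kappa T -> compact_operator mu nu T ->
    nonzero_operator mu nu T ->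
  (exists T1, [/\ M_min m1 n1 k1 T1, compact_operator m1 n1 T1 & nonzero_operator m1 n1 T1]) /\
  (exists T2, [/\ M_min m2 n2 k2 T2, compact_operator m2 n2 T2 & nonzero_operator m2 n2 T2]).
Proof.
apply: factor_operators => a b h.
- apply: (Phi_pull measurable_fst measurable_fst (@null_fst _ _ _ _ _ m1 m2)
    (@null_fst _ _ _ _ _ n1 n2) (V := fun f => tensorS f a) (V' := fun g => tensorS g b)
    (ca := hn a) (cb := hn b)) => //; rewrite ?hn_ge0//.
  + by move=> f; rewrite hn_tensorS mulrC.
  + by move=> f; rewrite hn_tensorS mulrC.
  + by move=> z /rho_image[].
- apply: (Phi_pull measurable_snd measurable_snd (@null_snd _ _ _ _ _ m1 m2)
    (@null_snd _ _ _ _ _ n1 n2) (V := fun f => tensorS a f) (V' := fun g => tensorS b g)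
    (ca := hn a) (cb := hn b)) => //; rewrite ?hn_ge0//.
  + by move=> f z; rewrite /= /tensor mulrC.
  + by move=> f z; rewrite /= /tensor mulrC.
  + by move=> f; rewrite hn_tensorS.
  + by move=> f; rewrite hn_tensorS.
  + by move=> z /rho_image[].
Qed.

End products.

Lemma bsum_double (R : realType) (p : nat -> nat * nat) (b : nat * nat -> R) (c : nat -> R) :
  bijective p -> (forall z, 0 <= b z) -> (forall i K, \sum_(k < K) b (i, nat_of_ord k) <= c i) ->
  bsum c -> bsum (b \o p).
Proof.
move=> bp b0 bc sc; have c0 i : 0 <= c i by have := bc i 0%N; rewrite big_ord0.
apply/bsum_ereal => [i|]; first exact: b0.
rewrite (nneseries_double bp (b := EFin \o b)); last by move=> z; rewrite lee_fin.
move/(bsum_ereal c0) : sc; apply: le_lt_trans.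
apply: lee_nneseries => [i _ _|i _]; first by apply: nneseries_ge0 => k _ _; rewrite lee_fin.
apply: lime_le; first by apply: is_cvg_nneseries => k _ _; rewrite lee_fin.
by apply: nearW => n; rewrite /= big_mkord sumEFin lee_fin.
Qed.

(** The system need not span the whole space: it is enough that w lies in its closed span, while v
    is arbitrary. *)
Lemma cseries_parseval (R : realType) (H : semiHilbert R) (e : nat -> H) (w v : H) :
  orthosys e -> (forall d : R, 0 < d -> exists K, hn (w - proj e K w) <= d) ->
  cseries (fun k => ip w (e k) * ip (e k) v) = ip w v.
Proof.
move=> oe ew; have b1 : bsum (fun k => cmod (ip w (e k)) ^+ 2).
  by exists (hn w ^+ 2) => n; rewrite /series /= big_mkord; exact: bessel.
have b2 : bsum (fun k => cmod (ip (e k) v) ^+ 2).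
  exists (hn v ^+ 2) => n; rewrite /series /= big_mkord.
  by apply: le_trans (bessel oe n v); apply: ler_sum => k _; rewrite [ip v _]ipC cmod_conj.
apply: cseries_eqP (bsum_mul b1 b2) _ => [k|d d0]; first by rewrite Normc.normcM.
have D0 : 0 < hn v + 1 by rewrite ltr_wpDl ?hn_ge0.
have [N hN] := ew _ (divr_gt0 d0 (mulr_gt0 (@ltr0n R 2) D0)).
exists N => K NK.
have -> : \sum_(k < K) ip w (e k) * ip (e k) v = ip (proj e K w) v.
  by rewrite /proj ip_suml; apply: eq_bigr => k _; rewrite ipZl.
rewrite -ipBl (le_lt_trans (cauchy_schwarz _ _))// -hnN opprB.
apply: (@le_lt_trans _ _ (d / (2 * (hn v + 1)) * (hn v + 1))).
  apply: ler_pM; rewrite ?hn_ge0//; last by rewrite lerDl.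
  exact: le_trans (hn_sub_proj_mono oe _ NK) hN.
by rewrite invfM mulrA mulfVK ?gt_eqF// ltr_pdivrMr// ltr_pMr// ltr1n.
Qed.

(** * Tensor products annihilating Phi *)

Section slices_of_sequences.
Context (R : realType) (d1 d2 : measure_display).
Context (X1 : measurableType d1) (X2 : measurableType d2).
Variables (m1 : {sigma_finite_measure set X1 -> \bar R}).
Variables (m2 : {sigma_finite_measure set X2 -> \bar R}).

(** Q itself need not be measurable; [prod_ae_eq0] is applied to the indicator of a measurable null
    set outside of which Q holds. *)
Lemma ae_slice (Q : X1 * X2 -> Prop) : (\forall z \ae (m1 \x m2)%E, Q z) ->
  \forall x2 \ae m2, \forall x1 \ae m1, Q (x1, x2).
Proof.
move=> [N [mN N0 QN]].
have mF : cmeasurable (cindic R N) by exact: cmeasurable_indic.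
have /(prod_ae_eq0 m1 m2 mF) : \forall z \ae (m1 \x m2)%E, cindic R N z = 0.
  exists N; split=> // z /=; apply: contra_notP => nz.
  by rewrite /cindic indicE memNset.
apply: filterS => x2; apply: filterS => x1 h; apply: contrapT => /QN Nz.
move: h; rewrite /cindic indicE mem_set// => /(congr1 (@complex.Re R)) /= /eqP.
by rewrite oner_eq0.
Qed.

(** Bessel's inequality on almost every slice, integrated over the second coordinate. *)
Lemma bessel_pintS (e : nat -> L2S m1) (F : L2S (m1 \x m2)%E) K : orthosys e ->
  \sum_(k < K) hn (pintS F (e k)) ^+ 2 <= hn F ^+ 2.
Proof.
move=> oe; rewrite -lee_fin -sumEFin hn_sqr_slices.
under eq_bigr do rewrite -nsq_hn /nsq.
have mp k : measurable_fun setT (fun y => (cmod ((pintS F (e k) : L2T m2) y) ^+ 2)%:E).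
  by apply: measurable_ecmod2; apply: L2_cmeasurable; exact: L2funP.
rewrite -ge0_integral_sum//; last by move=> k y _; rewrite lee_fin sqr_ge0.
apply: ae_ge0_le_integral => //.
- by move=> y _; apply: sume_ge0 => k _; rewrite lee_fin sqr_ge0.
- exact: emeasurable_sum.
- by move=> y _; exact: nsq_ge0.
- exact: measurable_nsq_sl.
apply: filterS (ae_L2slice F) => y hF _.
rewrite -hn_sl_sqr// sumEFin lee_fin; under eq_bigr do rewrite pintSE//.
exact: bessel.
Qed.

(** By Tonelli, the sum of the squared slice norms has a finite integral, hence is finite almost
    everywhere. *)
Lemma ae_l2seq_slices (F : nat -> L2S (m1 \x m2)%E) : l2seq F ->
  \forall z \ae m2, (forall i, L2slice (F i) z) /\ l2seq (fun i => sl (F i) z).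
Proof.
move=> sF; apply: ae_conj; first by apply: ae_foralln => i; exact: ae_L2slice.
have hs : \forall z \ae m2, forall i, L2slice (F i) z.
  by apply: ae_foralln => i; exact: ae_L2slice.
have : \forall z \ae m2,
    (\sum_(0 <= i <oo) nsq m1 (fun x => (F i : L2T (m1 \x m2)%E) (x, z)) < +oo)%E.
  apply: ge0_integral_lty_ae.
  - apply: ge0_emeasurable_sum => [i z _ _|i _]; first exact: nsq_ge0.
    exact: measurable_nsq_sl.
  - by move=> z; apply: nneseries_ge0 => i _ _; exact: nsq_ge0.
  rewrite integral_nneseries//; last 2 first.
  - by move=> i; exact: measurable_nsq_sl.
  - by move=> i z _; exact: nsq_ge0.
  move/(bsum_ereal (fun i => sqr_ge0 (hn (F i)))) : sF; congr (_ < _)%E.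
  by apply: eq_eseriesr => i _; rewrite hn_sqr_slices.
apply: filterS2 hs => z hs h; apply/bsum_ereal => [i|]; first exact: sqr_ge0.
by move: h; congr (_ < _)%E; apply: eq_eseriesr => i _; rewrite hn_sl_sqr.
Qed.

Lemma orthosys_conjS (e : nat -> L2S m1) : orthosys e -> orthosys (fun k => conjS (e k)).
Proof.
have cK f : conjS (conjS f) = f by apply: L2T_eq => x; rewrite /= conjcK.
move=> [e1 e2]; split=> [i j ij|i]; last by rewrite hn_conjS.
by rewrite ip_conjS_sym cK e1// => /esym.
Qed.

End slices_of_sequences.

Section minimal_annihilator.
Context (R : realType) (d1 d2 e1 e2 : measure_display).
Context (X1 : measurableType d1) (X2 : measurableType d2).
Context (Y1 : measurableType e1) (Y2 : measurableType e2).
Variables (m1 : {sigma_finite_measure set X1 -> \bar R}).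
Variables (m2 : {sigma_finite_measure set X2 -> \bar R}).
Variables (n1 : {sigma_finite_measure set Y1 -> \bar R}).
Variables (n2 : {sigma_finite_measure set Y2 -> \bar R}).
Variables (T1 : L2S m1 -> L2S n1) (M1 : R) (bT1 : blinear T1 M1).
Variables (T2 : L2S m2 -> L2S n2) (M2 : R) (bT2 : blinear T2 M2).
Variable e : nat -> L2S n1.
Hypothesis oe : orthosys e.
Hypothesis eK : forall d : R, 0 < d ->
  exists K, forall u, hn (T1 u - proj e K (T1 u)) <= d * hn u.
Variables (f : nat -> L2S (m1 \x m2)%E) (g : nat -> L2S (n1 \x n2)%E).
Hypotheses (sf : l2seq f) (sg : l2seq g).
Variable p : nat -> nat * nat.
Hypothesis bp : bijective p.

(** F i is (T1 (x) 1) f_i. For z = (i, k), P z and Q z are the coefficients of F i and g_i along e_k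
    and conj(e_k) in the first coordinate; enumerated by p, they represent the kernel R. *)
Let F i := amp1 (m2 := m2) bT1 (f i).
Let P z : L2S m2 := pintS (F z.1) (e z.2).
Let Q z : L2S n2 := pintS (g z.1) (conjS (e z.2)).

Lemma slices_approx (u : L2S m1) (d : R) : 0 < d -> exists K, hn (T1 u - proj e K (T1 u)) <= d.
Proof.
move=> d0; have D0 : 0 < hn u + 1 by rewrite ltr_wpDl ?hn_ge0.
have [K hK] := eK (divr_gt0 d0 D0); exists K; rewrite (le_trans (hK u))//.
by rewrite mulrAC ler_pdivrMr// ler_wpM2l ?(ltW d0)// lerDl.
Qed.

Lemma l2seq_amp1 : l2seq F.
Proof.
have [_ M10 h] := amp1_blinear m2 bT1.
have := bsumZ (sqr_ge0 M1) sf; apply: bsum_le => i.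
by rewrite -exprMn lerXn2r ?nnegrE ?mulr_ge0 ?hn_ge0//; exact: h.
Qed.

Lemma l2seq_P : l2seq (P \o p).
Proof.
apply: (bsum_double (b := fun z => hn (P z) ^+ 2) bp _ _ l2seq_amp1) => [z|i K].
  exact: sqr_ge0.
exact: (bessel_pintS (F i) K oe).
Qed.

Lemma l2seq_Q : l2seq (Q \o p).
Proof.
apply: (bsum_double (b := fun z => hn (Q z) ^+ 2) bp _ _ sg) => [z|i K].
  exact: sqr_ge0.
exact: (bessel_pintS (g i) K (orthosys_conjS oe)).
Qed.

Lemma ip_tensor_conjS (G : L2S (n1 \x n2)%E) k c :
  ip (tensorS (e k) c) (conjS G) = ip c (conjS (pintS G (conjS (e k)))).
Proof. by rewrite ip_conjS_sym -ip_pintS ip_conjS_sym. Qed.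

(** For fixed i, the sum over k is the pairing of the expansion of (T1 (x) T2) f_i with g_i.
    Domination by the flattened series permits summing first over k and then over i. *)
Lemma hpair_tens_op : hpair (tens_op bT1 bT2) f g = hpair T2 (P \o p) (Q \o p).
Proof.
have M20 : 0 <= M2 by case: bT2.
pose u z := ip (T2 (P z)) (conjS (Q z)).
pose b z := M2 * (hn (P z) * hn (Q z)).
have ub z : cmod (u z) <= b z.
  rewrite (le_trans (cauchy_schwarz _ _))// hn_conjS /b mulrA ler_wpM2r ?hn_ge0//.
  exact: (blinear_le bT2).
have sb : bsum (b \o p) by exact: (l2seq_bsum bT2 l2seq_P l2seq_Q).
have b0 z : 0 <= b z by rewrite !mulr_ge0 ?hn_ge0.
transitivity (cseries (u \o p)); last by [].
rewrite (double_cseries bp ub sb); apply: eq_cseries => i; apply/esym.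
apply: (cseries_eqP (fun k => ub (i, k)) (double_bsum_inner bp b0 sb i)) => d d0.
have C0 : 0 < M2 * hn (f i) * hn (g i) + 1 by rewrite ltr_wpDl ?mulr_ge0 ?hn_ge0.
have D0 : 0 < d / (M2 * hn (f i) * hn (g i) + 1) by rewrite divr_gt0.
have [N hN] := eK D0; exists N => K NK.
have hK v : hn (T1 v - proj e K (T1 v)) <= d / (M2 * hn (f i) * hn (g i) + 1) * hn v.
  exact: le_trans (hn_sub_proj_mono oe _ NK) (hN v).
have -> : \sum_(k < K) u (i, nat_of_ord k) =
    ip (\sum_(k < K) tensorS (e k) (T2 (pintS (amp1 bT1 (f i)) (e k)))) (conjS (g i)).
  by rewrite ip_suml; apply: eq_bigr => k _; rewrite ip_tensor_conjS.
rewrite -ipBl (le_lt_trans (cauchy_schwarz _ _))// hn_conjS -[X in X * _]hnN opprB.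
apply: le_lt_trans (ler_wpM2r (hn_ge0 _) (tens_op_expansion bT1 bT2 oe (f i) (ltW D0) hK)) _.
have key (x y : R) : 0 < M2 * x * y + 1 -> M2 * (d / (M2 * x * y + 1) * x) * y < d.
  move=> c0; rewrite (_ : M2 * _ * y = (d * (M2 * x * y)) / (M2 * x * y + 1)); last by ring.
  by rewrite ltr_pdivrMr// ltr_pM2l// ltrDl.
exact: key C0.
Qed.

(** Identifies the flattened kernel with R(x, y), the pairing of T1 with the slices: the sum over k
    is Parseval's identity for T1 applied to the slice of f_i at x. U and W are the good points at
    which all slices are square summable. *)
Lemma kernel_sum_slices : exists (U : X2 -> Prop) (W : Y2 -> Prop),
  [/\ \forall x \ae m2, U x, \forall y \ae n2, W y &
  forall x y, U x -> W y -> kernel_sum (P \o p) (Q \o p) (x, y) =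
    hpair T1 (fun i => sl (f i) x) (fun i => sl (g i) y)].
Proof.
exists (fun x => ((forall i, L2slice (f i) x) /\ l2seq (fun i => sl (f i) x)) /\
   ((forall i, L2slice (F i) x) /\ l2seq (fun i => sl (F i) x)) /\
   forall i, hn (T1 (sl (f i) x) - sl (F i) x) = 0).
exists (fun y => (forall i, L2slice (g i) y) /\ l2seq (fun i => sl (g i) y)); split.
- apply: ae_conj (ae_conj _ _); [exact: ae_l2seq_slices|exact: ae_l2seq_slices l2seq_amp1|].
  by apply: ae_foralln => i; exact: (ampP (l := m2) bT1 (f i)).
- exact: ae_l2seq_slices.
move=> x y [[h1 h2] [[h3 h4] h5]] [h6 h7].
pose u z := ip (sl (F z.1) x) (e z.2) * ip (sl (g z.1) y) (conjS (e z.2)).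
pose b1 z := cmod (ip (sl (F z.1) x) (e z.2)).
pose b2 z := cmod (ip (sl (g z.1) y) (conjS (e z.2))).
have sb1 : bsum (fun n => (b1 \o p) n ^+ 2).
  apply: (bsum_double (b := fun z => b1 z ^+ 2) bp _ _ h4) => [z|i K]; first exact: sqr_ge0.
  exact: (bessel oe K (sl (F i) x)).
have sb2 : bsum (fun n => (b2 \o p) n ^+ 2).
  apply: (bsum_double (b := fun z => b2 z ^+ 2) bp _ _ h7) => [z|i K]; first exact: sqr_ge0.
  exact: (bessel (orthosys_conjS oe) K (sl (g i) y)).
transitivity (cseries (u \o p)).
  apply: eq_cseries => n.
  transitivity ((P (p n) : L2T m2) x * (Q (p n) : L2T n2) y); first by [].
  by rewrite (pintSE _ (h3 _)) (pintSE _ (h6 _)).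
rewrite (double_cseries bp (b := fun z => b1 z * b2 z)); last 2 first.
- by move=> z; rewrite Normc.normcM.
- exact: (bsum_mul sb1 sb2).
apply: eq_cseries => i.
rewrite -(cseries_parseval (conjS (sl (g i) y)) oe (@slices_approx (sl (f i) x))).
apply: eq_cseries => k; rewrite (ip_conjS_sym (e k)).
transitivity (ip (sl (F i) x) (e k) * ip (sl (g i) y) (conjS (e k))); first by [].
congr (_ * _).
by apply/esym; exact: ip_eq_null (h5 i).
Qed.

Variables (k1 : set (X1 * Y1)) (k2 : set (X2 * Y2)) (k : set ((X1 * X2) * (Y1 * Y2))).
Hypothesis k12 : forall x1 y1 x2 y2, k1 (x1, y1) -> k2 (x2, y2) -> k ((x1, x2), (y1, y2)).
Hypothesis T1k1 : forall h u v, Phi m1 n1 k1 h -> rep u v h -> hpair T1 u v = 0.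
Hypothesis T2k2 : forall h u v, Phi m2 n2 k2 h -> rep u v h -> hpair T2 u v = 0.

(** For good (x, y) in k2 the slice h((., x), (., y)) vanishes on k1, so R(x, y) = 0 by the
    hypothesis on T1. Thus R belongs to Phi(k2), and T2 annihilates it. *)
Lemma tens_op_Phi h : Phi (m1 \x m2)%E (n1 \x n2)%E k h -> rep f g h ->
  hpair (tens_op bT1 bT2) f g = 0.
Proof.
move=> [_ vh] [_ _ Nh]; rewrite hpair_tens_op.
have rPQ : rep (P \o p) (Q \o p) (kernel_sum (P \o p) (Q \o p)).
  split; [exact: l2seq_P|exact: l2seq_Q|exists set0, set0].
  by split=> //; rewrite ?measure0// => z /= /(_ erefl).
apply: T2k2 (rPQ); split; first by apply/GammaP; exists (P \o p), (Q \o p).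
have [U [W [aU aW UW]]] := kernel_sum_slices.
have [a [b [aa ab ab0]]] := marginally_null_ae2 (marginally_nullU vh Nh).
(* h vanishes and is represented off a marginally null set of the product. Its two sides have null
   slices for almost every x and almost every y, so the slice of h is again controlled off a
   marginally null set. *)
have a' := ae_conj (ae_conj aU (ae_l2seq_slices sf)) (ae_slice aa).
have b' := ae_conj (ae_conj aW (ae_l2seq_slices sg)) (ae_slice ab).
apply: (marginally_null_ae a' b') => x y [[Ux [fx1 fx2]] ax] [[Wy [gy1 gy2]] by_] [k2xy /= n0].
apply: n0; rewrite UW//.
have hE x1 y1 : a (x1, x) -> b (y1, y) -> h ((x1, x), (y1, y)) =
    kernel_sum (fun i => sl (f i) x) (fun i => sl (g i) y) (x1, y1).
  move=> ha hb; have /contrapT -> : ~ h ((x1, x), (y1, y)) <> kernel_sum f g ((x1, x), (y1, y)).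
    by move=> hn; apply: (ab0 _ _ ha hb); right.
  by apply: eq_cseries => i /=; rewrite !slE.
have r : rep (fun i => sl (f i) x) (fun i => sl (g i) y) (fun z => h ((z.1, x), (z.2, y))).
  by split=> //; apply: (marginally_null_ae ax by_) => x1 y1 ha hb /=; apply; exact: hE.
apply: T1k1 (r); split; first by apply/GammaP; eexists; eexists; exact: r.
apply: (marginally_null_ae ax by_) => x1 y1 ha hb [k1xy /= hn].
by apply: (ab0 _ _ ha hb); left; split=> //; exact: k12.
Qed.

End minimal_annihilator.

(** * Operators vanishing on rectangles *)

Section restriction.
Context (R : realType) (d : measure_display) (X : measurableType d).
Variable mu : {measure set X -> \bar R}.

Lemma cindicM A B (x : X) : cindic R A x * cindic R B x = cindic R (A `&` B) x.
Proof. by rewrite /cindic indicI -rmorphM. Qed.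

Lemma cmod_cindic A (x : X) : cmod (cindic R A x) = \1_A x.
Proof. by rewrite /cindic cmodR ger0_norm. Qed.

Lemma L2_restr A f : measurable A -> L2 mu f -> L2 mu (fun x => cindic R A x * f x).
Proof.
move=> mA lf; apply: (@L2_le _ _ _ _ _ f) => [|//|x].
  by apply: cmeasurableM; [exact: cmeasurable_indic|exact: L2_cmeasurable lf].
by rewrite ComplexField.Normc.normcM cmod_cindic ler_piMl ?cmod_ge0// indicE; case: (_ \in _).
Qed.

Definition restrS A (mA : measurable A) (f : L2S mu) : L2S mu := MkL2T (L2_restr mA (L2funP f)).

Lemma restrSE A (mA : measurable A) f x :
  (restrS mA f : L2T mu) x = cindic R A x * (f : L2T mu) x.
Proof. by []. Qed.

Lemma hn_restrS A (mA : measurable A) f : hn (restrS mA f) <= hn f.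
Proof.
rewrite -(@ler_pXn2r _ 2)// ?nnegrE ?hn_ge0// -lee_fin -!nsq_hn; apply: nsq_le.
- by apply: L2_cmeasurable; exact: L2funP.
- by apply: L2_cmeasurable; exact: L2funP.
- move=> x; rewrite restrSE ComplexField.Normc.normcM cmod_cindic.
  by rewrite ler_piMl ?cmod_ge0// indicE; case: (_ \in _).
Qed.

Lemma restrSDZ A (mA : measurable A) a f g :
  restrS mA (a *: f + g) = a *: restrS mA f + restrS mA g.
Proof. by apply: L2T_eq => x; rewrite /= mulrDr !mulrA [a * _]mulrC. Qed.

Lemma restrS_blinear A (mA : measurable A) : blinear (restrS mA) 1.
Proof.
split=> // [a f g|f]; first by rewrite restrSDZ subrr hn0.
by rewrite mul1r hn_restrS.
Qed.

Lemma ip_restrS A (mA : measurable A) f g :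
  ip (restrS mA f) (conjS g) = ip f (conjS (restrS mA g)).
Proof.
rewrite !ip_L2; apply: eq_cintegral => x /=; rewrite !conjcK.
by rewrite mulrA [cindic _ _ _ * _]mulrC.
Qed.

Lemma l2seq_restr A (mA : measurable A) (f : nat -> L2S mu) : l2seq f -> l2seq (restrS mA \o f).
Proof.
by apply: bsum_le => i; rewrite lerXn2r ?nnegrE ?hn_ge0//; exact: hn_restrS.
Qed.

Lemma restrS_split A B (mA : measurable A) (mAB : measurable (A `&` B))
    (mAD : measurable (A `\` B)) f : restrS mA f = restrS mAB f + restrS mAD f.
Proof.
apply: L2T_eq => x; transitivity (cindic R (A `&` B) x * (f : L2T mu) x +
  cindic R (A `\` B) x * (f : L2T mu) x); last by [].
rewrite restrSE -mulrDl /cindic -rmorphD /=; congr ((_%:C)%C * _); rewrite !indicE.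
rewrite in_setI in_setD.
by case: (x \in A); case: (x \in B); rewrite /= ?addr0 ?add0r.
Qed.

Lemma hcv_restr (K : nat -> set X) (mK : forall n, measurable (K n)) (f : L2S mu) :
  (forall n, K n `<=` K n.+1) -> (\forall x \ae mu, exists n, K n x) ->
  hcv (fun n => restrS (mK n) f) f.
Proof.
move=> Kinc cov.
have mF n : measurable_fun setT
    (fun x => (cmod (restrS (mK n) f x - (f : L2T mu) x) ^+ 2)%:E).
  by apply: measurable_ecmod2; apply: cmeasurableB; apply: L2_cmeasurable; exact: L2funP.
have le n x : cmod (restrS (mK n) f x - (f : L2T mu) x) ^+ 2 <= cmod ((f : L2T mu) x) ^+ 2.
  rewrite restrSE /cindic indicE; case: (_ \in _); rewrite ?mul1r ?subrr ?mul0r ?sub0r ?cmodN//.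
  by rewrite ComplexField.Normc.normc0 expr0n sqr_ge0.
have Kmono m n : (m <= n)%N -> K m `<=` K n.
  elim: n => [|n IH]; first by rewrite leqn0 => /eqP->.
  by rewrite leq_eqVlt => /predU1P[->//|/IH h x /h/Kinc].
have cv x : (exists n, K n x) ->
    (cmod (restrS (mK n) f x - (f : L2T mu) x) ^+ 2)%:E @[n --> \oo] --> 0%E.
  move=> [N KN]; apply: cvg_near_cst; exists N => // n /= Nn.
  rewrite /cindic indicE mem_set; last exact: Kmono KN.
  by rewrite mul1r subrr ComplexField.Normc.normc0 expr0n.
have ig : mu.-integrable setT (fun x => (cmod ((f : L2T mu) x) ^+ 2)%:E).
  have /L2P[mf lf] := L2funP f; apply/integrableP; split; first exact: measurable_ecmod2.
  by under eq_integral do rewrite gee0_abs ?lee_fin ?sqr_ge0//.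
have [] := @dominated_convergence _ X R mu setT measurableT
  (fun n x => (cmod (restrS (mK n) f x - (f : L2T mu) x) ^+ 2)%:E) (cst 0%E)
  (fun x => (cmod ((f : L2T mu) x) ^+ 2)%:E) mF (measurable_cst _) _ ig.
- by apply: filterS cov => x hx _; exact: cv.
- by apply: aeW => x n _; rewrite gee0_abs ?lee_fin ?sqr_ge0.
move=> _ _; rewrite integral0.
have E n : (\int[mu]_x (cmod (restrS (mK n) f x - (f : L2T mu) x) ^+ 2)%:E =
    (hn (restrS (mK n) f - f) ^+ 2)%:E)%E by rewrite -nsq_hn.
under eq_fun do rewrite E.
move=> /fine_cvgP[_ /cvgrPdist_lt h] e e0.
have [N _ hN] := h _ (exprn_gt0 2 e0); exists N => n /hN /=.
by rewrite sub0r normrN ger0_norm ?sqr_ge0// ltr_pXn2r ?nnegrE ?hn_ge0 ?(ltW e0).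
Qed.

End restriction.

Lemma ip_tensorS (R : realType) (d1 d2 : measure_display)
    (X1 : measurableType d1) (X2 : measurableType d2)
    (m1 : {sigma_finite_measure set X1 -> \bar R}) (m2 : {sigma_finite_measure set X2 -> \bar R})
    (f a : L2S m1) (g b : L2S m2) :
  ip (tensorS f g) (tensorS a b) = ip f a * ip g b.
Proof.
have cK (d : measure_display) (X : measurableType d) (m : {measure set X -> \bar R})
    (u : L2S m) : conjS (conjS u) = u by apply: L2T_eq => x; rewrite /= conjcK.
have -> : tensorS a b = conjS (tensorS (conjS a) (conjS b)).
  by apply: L2T_eq => z; rewrite /= /tensor /= rmorphM /= !conjcK.
rewrite -ip_pintS !cK mulrC.
have -> : pintS (tensorS f g) a = ip f a *: g.
  apply: L2T_eq => z; rewrite (pintSE _ (L2slice_tensor _ _ _)) sl_tensor ipZl.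
  by rewrite mulrC.
by rewrite ipZl mulrC.
Qed.

Section killing.
Context (R : realType) (d1 d2 e1 e2 : measure_display).
Context (X1 : measurableType d1) (X2 : measurableType d2).
Context (Y1 : measurableType e1) (Y2 : measurableType e2).
Variables (m1 : {sigma_finite_measure set X1 -> \bar R}).
Variables (m2 : {sigma_finite_measure set X2 -> \bar R}).
Variables (n1 : {sigma_finite_measure set Y1 -> \bar R}).
Variables (n2 : {sigma_finite_measure set Y2 -> \bar R}).

Section coordinates_of_tensor_operator.
Variables (T1 : L2S m1 -> L2S n1) (M1 : R) (bT1 : blinear T1 M1).
Variables (T2 : L2S m2 -> L2S n2) (M2 : R) (bT2 : blinear T2 M2).
Let A := tens_op bT1 bT2.

(** The compression of A by the two restrictions is again bounded and linear, so by [tensor_witness]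
    it vanishes once its coefficients on elementary tensors do. *)
Lemma restr_tens_op_eq0 (S : set (X1 * X2)) (S' : set (Y1 * Y2)) (mS : measurable S)
    (mS' : measurable S') :
  (forall f a g b, ip (A (restrS mS (tensorS f a))) (conjS (restrS mS' (tensorS g b))) = 0) ->
  forall F G, ip (A (restrS mS F)) (conjS (restrS mS' G)) = 0.
Proof.
move=> h F G; rewrite -ip_restrS; apply: ip_nulll.
have bA := tens_op_blinear bT1 bT2.
pose B H := restrS mS' (A (restrS mS H)).
have bB : blinear B (M2 * M1).
  have M0 : 0 <= M2 * M1 by case: bA.
  split=> // [a H H'|H].
    apply: hn_le0; rewrite /B restrSDZ.
    rewrite (le_trans (hn_triangle _ (restrS mS' (a *: A (restrS mS H) + A (restrS mS H'))) _))//.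
    rewrite (blinear_comb (restrS_blinear _ mS') a) addr0.
    rewrite (le_trans (blinear_sub_le (restrS_blinear _ mS') _ _))//.
    by rewrite (blinear_comb bA a (restrS mS H) (restrS mS H')) mulr0.
  rewrite (le_trans (hn_restrS _ _))// (le_trans (blinear_le bA _))// ler_wpM2l//.
  exact: hn_restrS.
apply: contrapT => BF; have [f [a [g [b]]]] := tensor_witness bB BF.
by apply; rewrite /B ip_restrS h.
Qed.

(** Restricting an elementary tensor to a cylinder restricts its first factor, and the inner product
    splits into a factor for T1, which vanishes, and one for T2. *)
Lemma kills_fst (al : set X1) (be : set Y1) (mal : measurable al) (mbe : measurable be)
    (S : set (X1 * X2)) (S' : set (Y1 * Y2)) (mS : measurable S) (mS' : measurable S') :
  S = fst @^-1` al -> S' = fst @^-1` be ->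
  (forall u v, ip (T1 (restrS mal u)) (conjS (restrS mbe v)) = 0) ->
  forall F G, ip (A (restrS mS F)) (conjS (restrS mS' G)) = 0.
Proof.
move=> SE SE' k; apply: restr_tens_op_eq0 => f a g b.
have -> : restrS mS (tensorS f a) = tensorS (restrS mal f) a.
  by apply: L2T_eq => z; rewrite /= /tensor /= SE mulrA.
rewrite (ip_eq_null _ (tens_op_tensor bT1 bT2 (restrS mal f) a)).
have -> : conjS (restrS mS' (tensorS g b)) = tensorS (conjS (restrS mbe g)) (conjS b).
  by apply: L2T_eq => z; rewrite /= /tensor /= SE' -rmorphM mulrA.
by rewrite ip_tensorS k mul0r.
Qed.

Lemma kills_snd (al : set X2) (be : set Y2) (mal : measurable al) (mbe : measurable be)
    (S : set (X1 * X2)) (S' : set (Y1 * Y2)) (mS : measurable S) (mS' : measurable S') :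
  S = snd @^-1` al -> S' = snd @^-1` be ->
  (forall u v, ip (T2 (restrS mal u)) (conjS (restrS mbe v)) = 0) ->
  forall F G, ip (A (restrS mS F)) (conjS (restrS mS' G)) = 0.
Proof.
move=> SE SE' k; apply: restr_tens_op_eq0 => f a g b.
have -> : restrS mS (tensorS f a) = tensorS f (restrS mal a).
  by apply: L2T_eq => z; rewrite /= /tensor /= SE mulrCA.
rewrite (ip_eq_null _ (tens_op_tensor bT1 bT2 f (restrS mal a))).
have -> : conjS (restrS mS' (tensorS g b)) = tensorS (conjS g) (conjS (restrS mbe b)).
  by apply: L2T_eq => z; rewrite /= /tensor /= SE' -rmorphM mulrCA.
by rewrite ip_tensorS k mulr0.
Qed.

End coordinates_of_tensor_operator.
End killing.

Section max_annihilator_kills.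
Context (R : realType) (d d' : measure_display).
Context (X : measurableType d) (Y : measurableType d').
Variables (mu : {measure set X -> \bar R}) (nu : {measure set Y -> \bar R}).

Lemma cseries_single (u : nat -> R[i]) : (forall i, u i.+1 = 0) -> cseries u = u 0%N.
Proof.
move=> u0; have b0 i : cmod (u i) <= cmod (u 0%N) * (i == 0%N)%:R.
  by case: i => [|i]; rewrite /= ?mulr1// u0 mulr0 ComplexField.Normc.normc0.
have s n : \sum_(i < n) cmod (u 0%N) * (i == 0%N :> nat)%:R <= cmod (u 0%N).
  case: n => [|n]; first by rewrite big_ord0 cmod_ge0.
  by rewrite big_ord_recl /= mulr1 big1 ?addr0// => i _; rewrite mulr0.
apply: (cseries_eqP b0) => [|e e0].
  by exists (cmod (u 0%N)) => n; rewrite /series /= big_mkord.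
exists 1%N => -[//|K] _; rewrite big_ord_recl big1 => [|i _]; last exact: u0.
by rewrite addr0 subrr ComplexField.Normc.normc0.
Qed.

Definition single (H : semiHilbert R) (u : H) (i : nat) : H := if i is 0%N then u else 0.

Lemma l2seq_single (u : L2S mu) : l2seq (single u).
Proof.
exists (hn u ^+ 2) => n; rewrite /series /= big_mkord; case: n => [|n].
  by rewrite big_ord0 sqr_ge0.
by rewrite big_ord_recl /= big1 ?addr0// => i _; rewrite hn0 expr0n.
Qed.

End max_annihilator_kills.

Lemma kernel_sum_single (R : realType) (d d' : measure_display)
    (X : measurableType d) (Y : measurableType d')
    (mu : {measure set X -> \bar R}) (nu : {measure set Y -> \bar R})
    (u : L2S mu) (v : L2S nu) z :
  kernel_sum (single u) (single v) z = (u : L2T mu) z.1 * (v : L2T nu) z.2.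
Proof. by rewrite /kernel_sum cseries_single// => i; rewrite mul0r. Qed.

(* The complement of a rectangle is a union of two rectangles, hence [u (x) v] vanishes on an
   omega-open neighbourhood of [k] as soon as the rectangle essentially misses [k]. *)
Lemma M_max_kills (R : realType) (d d' : measure_display)
    (X : measurableType d) (Y : measurableType d')
    (mu : {measure set X -> \bar R}) (nu : {measure set Y -> \bar R})
    (k : set (X * Y)) T (bT : bounded_operator mu nu T) (A : set X) (B : set Y)
    (mA : measurable A) (mB : measurable B) u v :
  M_max mu nu k T -> marginally_null mu nu (k `&` (A `*` B)) ->
  ip (oplift bT (restrS mA u)) (conjS (restrS mB v)) = 0.
Proof.
move=> kT kAB; set f := restrS mA u; set g := restrS mB v.
have [M bA] := oplift_blinear bT.
have n0 : marginally_null mu nu set0.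
  by exists set0, set0; split=> //; rewrite measure0.
have r : rep (single f) (single g) (kernel_sum (single f) (single g)).
  split; [exact: l2seq_single|exact: l2seq_single|].
  by apply: marginally_null_sub n0 => z /= /(_ erefl).
have r0 : rep (fun=> 0 : L2S mu) (fun=> 0 : L2S nu)
    (fun z => kernel_sum (single f) (single g) z - kernel_sum (single f) (single g) z).
  have s0 (d0 : measure_display) (Z : measurableType d0) (m : {measure set Z -> \bar R}) :
      l2seq (fun=> 0 : L2S m).
    by exists 0 => n; rewrite /series /= big1// => i _; rewrite hn0 expr0n.
  split=> //; apply: marginally_null_sub n0 => z /=; apply.
  by rewrite subrr /kernel_sum; rewrite -[LHS]cseries0; apply: eq_cseries => i; rewrite mul0r.
have <- : hpair (oplift bT) (single f) (single g) = ip (oplift bT f) (conjS g).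
  rewrite /hpair cseries_single// => i; apply: ip_nulll.
  by apply: (blinear_null bA); exact: hn0.
apply: (annihilator_hpair bT kT) (r); split; first by apply/GammaP; eexists; eexists; exact: r.
move=> e e0; exists (kernel_sum (single f) (single g)); split.
- by apply/GammaP; eexists; eexists; exact: r.
(* Adding k makes the inclusion hold literally; it changes the omega-open complement of the
   rectangle by a marginally null set. *)
- exists (~` (A `*` B) `|` k); split.
  + exists (fun n => if n is 0%N then ~` A else setT), (fun n => if n is 0%N then setT else ~` B).
    split; [by case=> [|n] //; exact: measurableC|by case=> [|n] //; exact: measurableC|].
    have U z : (\bigcup_n ((if n is 0%N then ~` A else setT) `*`
        (if n is 0%N then setT else ~` B))) z <-> ~ (A `*` B) z.
      split=> [[[|n] _ [/= h1 h2]] [/= h3 h4]//|nAB].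
      have [Az|Az] := pselect (A z.1); last by exists 0%N.
      by exists 1%N => //; split=> //= Bz; apply: nAB.
    apply: marginally_null_sub kAB => z [[[h|kz] /U h']|[/U h h']].
    * by exfalso; apply: h'.
    * by split=> //; exact: contrapT.
    * by exfalso; apply: h'; left.
  + by move=> z kz; right.
  + apply: marginally_null_sub kAB => z [h /=]; rewrite kernel_sum_single => fg.
    suff ABz : (A `*` B) z by split=> //; case: h.
    split; apply: contrapT => nz; apply: fg.
      by rewrite restrSE /cindic indicE memNset// !mul0r.
    by rewrite [X in _ * X]restrSE /cindic indicE memNset// mul0r mulr0.
- apply: (lt_Gamma_norm r0); rewrite (le_lt_trans _ e0)//.
  apply: rsum_le_bound => [i|n]; first by rewrite mulr_ge0 ?hn_ge0.
  by rewrite /series /= big1// => i _; rewrite hn0 mul0r.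
Qed.

(** * Tightness *)

Section compact_closed_images.
Context (T : Type) (P : topologicalType) (phi : T -> P).
Hypothesis phi_inj : injective phi.

(** Closedness is included because P is an arbitrary topological space here, in which compact sets
    need not be closed. *)
Definition kc (K : set T) := compact (phi @` K) /\ closed (phi @` K).

Lemma kc_set0 : kc set0.
Proof. by rewrite /kc image_set0; split; [exact: compact0|exact: closed0]. Qed.

Lemma kc_setU K L : kc K -> kc L -> kc (K `|` L).
Proof.
by move=> [K1 K2] [L1 L2]; rewrite /kc image_setU; split; [exact: compactU|exact: closedU].
Qed.

(** Injectivity of phi is what makes images commute with intersections. *)
Lemma kc_bigcap (K : nat -> set T) : (forall n, kc (K n)) -> kc (\bigcap_n K n).
Proof.
move=> hK; have E : phi @` (\bigcap_n K n) = \bigcap_n (phi @` K n).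
  apply/seteqP; split=> [_ [x hx <-] n _|y hy]; first by exists x => //; exact: hx.
  have [x Kx xy] := hy 0%N I; exists x => // n _.
  by have [x' Kx' x'y] := hy n I; rewrite (phi_inj (etrans xy (esym x'y))).
rewrite /kc E; have cl : closed (\bigcap_n (phi @` K n)).
  by apply: closed_bigI => n _; have [] := hK n.
split=> //; apply: (subclosed_compact cl (hK 0%N).1).
by move=> y; apply.
Qed.

Lemma kc_setI K L : kc K -> kc L -> kc (K `&` L).
Proof.
move=> hK hL; rewrite (_ : K `&` L = \bigcap_n (if n is 0%N then K else L)).
  by apply: kc_bigcap => -[].
apply/seteqP; split=> [x [Kx Lx] [|n] //|x h].
by split; [exact: (h 0%N)|exact: (h 1%N)].
Qed.

Lemma kc_bigsetU n (K : nat -> set T) : (forall i, kc (K i)) -> kc (\big[setU/set0]_(i < n) K i).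
Proof.
move=> hK; elim: n => [|n IH]; first by rewrite big_ord0; exact: kc_set0.
by rewrite big_ord_recr; exact: kc_setU.
Qed.

Lemma kc_fip (D : nat -> set T) : (forall n, kc (D n)) -> (forall n, D n.+1 `<=` D n) ->
  (forall n, D n !=set0) -> \bigcap_n D n !=set0.
Proof.
move=> hD dD /choice[x xD].
have mono m n : (m <= n)%N -> D n `<=` D m.
  elim: n => [|n IH]; first by rewrite leqn0 => /eqP ->.
  by rewrite leq_eqVlt => /predU1P[->//|/IH h y /dD/h].
(* A cluster point of the chosen points lies in every closed set phi(D n), and by injectivity it has
   the same preimage in all of them. *)
pose F := (phi \o x) @ \oo.
have FD n : F (phi @` D n).
  by exists n => // m /= nm; exists (x m) => //; exact: (mono n m nm).
have [p [_ Fp]] := (hD 0%N).1 F _ (FD 0%N).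
have pD n : (phi @` D n) p.
  by apply: (hD n).2 => B /(Fp _ _ (FD n)).
have [z Dz zp] := pD 0%N; exists z => n _.
by have [z' Dz' z'p] := pD n; rewrite (phi_inj (etrans zp (esym z'p))).
Qed.

End compact_closed_images.

Lemma kc_setX (T U : Type) (P Q : topologicalType) (phi : T -> P) (psi : U -> Q) K L :
  kc phi K -> kc psi L -> kc (fun z => (phi z.1, psi z.2)) (K `*` L).
Proof.
move=> [K1 K2] [L1 L2].
have E : (fun z => (phi z.1, psi z.2)) @` (K `*` L) = (phi @` K) `*` (psi @` L).
  apply/seteqP; split=> [_ [[x y] [/= Kx Ly] <-]|[p q] [/= [x Kx <-] [y Ly <-]]].
    by split; [exists x|exists y].
  by exists (x, y).
rewrite /kc E; split; first exact: compact_setX.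
rewrite (_ : _ `*` _ = fst @^-1` (phi @` K) `&` snd @^-1` (psi @` L)); last first.
  by apply/seteqP; split=> z [].
apply: closedI; apply: closed_comp => // z _; [exact: cvg_fst|exact: cvg_snd].
Qed.

(** The sides [A n] and [B n] need not be open; compactness of [K \ A n] and [L \ B n] takes the
    place of that. The parts D n left uncovered by the first n rectangles are compact and
    decreasing, and their intersection is empty, so one of them is empty. *)
Lemma compact_finite_cover (T U : Type) (P Q : topologicalType) (phi : T -> P) (psi : U -> Q)
    (A : nat -> set T) (B : nat -> set U) K L :
  injective phi -> injective psi -> kc phi K -> (forall n, kc phi (K `\` A n)) ->
  kc psi L -> (forall n, kc psi (L `\` B n)) ->
  K `*` L `<=` \bigcup_n (A n `*` B n) ->
  exists N, K `*` L `<=` \big[setU/set0]_(i < N) (A i `*` B i).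
Proof.
move=> iphi ipsi kK kA kL kB cov.
pose D n := (K `*` L) `\` \big[setU/set0]_(i < n) (A i `*` B i).
apply: contrapT => /forallNP h.
have D0 n : D n !=set0.
  by have /existsNP[z /not_implyP[h1 h2]] := h n; exists z.
(* The complement of a rectangle in K x L is a union of two compact rectangles, whence each D n is
   compact by induction. *)
have DS n : D n.+1 = D n `&` ((K `\` A n) `*` L `|` K `*` (L `\` B n)).
  rewrite /D big_ord_recr; apply/seteqP; split=> z.
    move=> [[Kz Lz] /not_orP[h1 h2]]; split=> //.
    have [Az|Az] := pselect (A n z.1); last by left.
    by right; split=> //; split=> // Bz; apply: h2.
  move=> [[[Kz Lz] h1] h2]; split=> // -[//|[/= Az Bz]].
  by case: h2 => [[[_ nA] _]|[_ [_ nB]]]; [exact: nA|exact: nB].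
have kD n : kc (fun z => (phi z.1, psi z.2)) (D n).
  elim: n => [|n IH].
    by rewrite /D big_ord0 setD0; exact: kc_setX.
  rewrite DS; apply: kc_setI => //.
    by move=> [x y] [x' y'] /= [/iphi -> /ipsi ->].
  by apply: kc_setU; exact: kc_setX.
have [||z hz] := kc_fip _ kD _ D0.
- by move=> [x y] [x' y'] /= [/iphi -> /ipsi ->].
- by move=> n; rewrite DS; exact: subIsetl.
have [n _ ABz] := cov z (hz 0%N I).1.
have [_] := hz n.+1 I; apply; rewrite big_ord_recr; by right.
Qed.

Section small_sets.
Context (R : realType) (d : measure_display) (X : measurableType d).
Variable mu : {measure set X -> \bar R}.

Lemma cvge0_lt (u : nat -> \bar R) (e : R) : u @ \oo --> 0%E -> 0 < e ->
  exists N, forall n, (N <= n)%N -> (u n < e%:E)%E.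
Proof.
move=> /fine_cvgP[f /cvgrPdist_lt h] e0; have [N _ hN] := filterI f (h _ e0).
exists N => n /hN [fn]; rewrite sub0r normrN => lt.
by rewrite -(fineK fn) lte_fin (le_lt_trans (ler_norm _)).
Qed.

(** Continuity from above for the parts of S not yet exhausted by the first N sets. *)
Lemma measure_bigsetU_tail (S : set X) (A : nat -> set X) (e : R) : measurable S ->
  (mu S < +oo)%E -> (forall n, measurable (A n)) -> 0 < e ->
  exists N, (mu ((S `&` \bigcup_n A n) `\` \big[setU/set0]_(i < N) A i) < e%:E)%E.
Proof.
move=> mS Soo mA e0; pose F n := (S `&` \bigcup_n A n) `\` \big[setU/set0]_(i < n) A i.
have mF n : measurable (F n).
  apply: measurableD; first by apply: measurableI => //; exact: bigcup_measurable.
  exact: bigsetU_measurable.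
have F0 : \bigcap_n F n = set0.
  apply/seteqP; split=> // x h; have [[_ [n _ An]] _] := h 0%N I.
  have [_] := h n.+1 I; apply; rewrite big_ord_recr; by right.
have cv : mu \o F @ \oo --> 0%E.
  rewrite -(measure0 mu) -F0; apply: nonincreasing_cvg_mu => //.
  + apply: le_lt_trans Soo; apply: le_measure; rewrite ?inE//.
    by move=> x [[]].
  + by rewrite F0.
  + apply/nonincreasing_seqP => n; apply/subsetPset => x [h1 h2]; split=> // h3.
    by apply: h2; rewrite big_ord_recr; left.
have [N hN] := cvge0_lt cv e0; exists N; exact: (hN N (leqnn N)).
Qed.

Lemma measure_bigcup_le (D : nat -> set X) (e : R) : (forall n, measurable (D n)) -> 0 <= e ->
  (forall n, (mu (D n) <= (e / (2 ^ n.+1)%:R)%:E)%E) -> (mu (\bigcup_n D n) <= e%:E)%E.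
Proof.
move=> mD e0 De.
apply: (@le_trans _ _ (\sum_(0 <= n <oo) mu (D n))%E).
  by apply: measure_sigma_subadditive => //; exact: bigcup_measurable.
by apply: le_trans (epsilon_trick0 xpredT e0); exact: lee_nneseries.
Qed.

Definition tight (P : topologicalType) (phi : X -> P) := forall A, measurable A ->
  (mu A < +oo)%E -> forall e : R, 0 < e ->
  exists K, [/\ measurable K, K `<=` A, kc phi K & (mu (A `\` K) < e%:E)%E].

Section tight_measure.
Variables (P : topologicalType) (phi : X -> P).
Hypothesis phi_inj : injective phi.

(** In the manner of Lusin: K is the union of compact parts of [S & A] and of [S \ A], so that A
    becomes relatively open and closed in K. *)
Lemma tight_approx (A S : set X) (e : R) : tight phi -> measurable A -> measurable S ->
  (mu S < +oo)%E -> 0 < e ->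
  exists K, [/\ measurable K, K `<=` S, kc phi (K `&` A), kc phi (K `\` A) &
    (mu (S `\` K) < e%:E)%E].
Proof.
move=> tphi mA mS Soo e0; have e2 : 0 < e / 2 by rewrite divr_gt0.
have mSA : measurable (S `&` A) by exact: measurableI.
have mSD : measurable (S `\` A) by exact: measurableD.
have [|K [mK KS kK Ke]] := tphi _ mSA _ _ e2.
  by apply: le_lt_trans Soo; apply: le_measure; rewrite ?inE//; exact: subIsetl.
have [|L [mL LS kL Le]] := tphi _ mSD _ _ e2.
  by apply: le_lt_trans Soo; apply: le_measure; rewrite ?inE//; exact: subIsetl.
exists (K `|` L); split.
- exact: measurableU.
- by move=> x [/KS[]|/LS[]].
- rewrite (_ : _ `&` _ = K)//; apply/seteqP; split=> x.
    by move=> [[//|/LS[]]].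
  by move=> Kx; split; [left|have [] := KS x Kx].
- rewrite (_ : _ `\` _ = L)//; apply/seteqP; split=> x.
    by move=> [[/KS[]//|//]].
  by move=> Lx; split; [right|have [] := LS x Lx].
- have -> : S `\` (K `|` L) = ((S `&` A) `\` K) `|` ((S `\` A) `\` L).
    apply/seteqP; split=> x.
      move=> [Sx /not_orP[Kx Lx]]; have [Ax|Ax] := pselect (A x); first by left.
      by right.
    move=> [[[Sx Ax] Kx]|[[Sx Ax] Lx]]; split=> // -[Kx'|Lx'] //.
      by have [] := LS x Lx'.
    by have [] := KS x Kx'.
  apply: (@le_lt_trans _ _ (mu ((S `&` A) `\` K) + mu ((S `\` A) `\` L))%E).
    by apply: measureU2; exact: measurableD.
  by rewrite (splitr e) EFinD lteD.
Qed.

(** Intersecting the sets obtained for each [A n] with error e / 2^(n+1) handles all of them at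
    once. *)
Lemma tight_seq (A : nat -> set X) (S : set X) (e : R) : tight phi ->
  (forall n, measurable (A n)) -> measurable S -> (mu S < +oo)%E -> 0 < e ->
  exists K, [/\ measurable K, K `<=` S, forall n, kc phi (K `&` A n),
    forall n, kc phi (K `\` A n) & (mu (S `\` K) <= e%:E)%E].
Proof.
move=> tphi mA mS Soo e0.
have en n : 0 < e / (2 ^ n.+1)%:R by rewrite divr_gt0// ltr0n expn_gt0.
have [K hK] := choice (fun n => tight_approx tphi (mA n) mS Soo (en n)).
have kK n : kc phi (K n).
  have [_ _ h1 h2 _] := hK n; rewrite -(setUIDK (K n) (A n)).
  exact: kc_setU.
exists (\bigcap_n K n); split.
- by apply: bigcap_measurable => // n _; have [] := hK n.
- by move=> x /(_ 0%N I); have [_ h _ _ _] := hK 0%N; exact: h.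
- move=> n; rewrite (_ : _ `&` _ = (\bigcap_n K n) `&` (K n `&` A n)).
    by apply: kc_setI => //; [exact: kc_bigcap|have [] := hK n].
  by rewrite setIA; congr (_ `&` _); apply/esym/setIidl => x; exact.
- move=> n; rewrite (_ : _ `\` _ = (\bigcap_n K n) `&` (K n `\` A n)).
    by apply: kc_setI => //; [exact: kc_bigcap|have [] := hK n].
  by apply/seteqP; split=> x [h1 h2]; split=> //; [split=> //; exact: h1|case: h2].
- rewrite setDE setC_bigcap setI_bigcupr; apply: measure_bigcup_le => [n||n].
  + by have [mK _ _ _ _] := hK n; apply: measurableI => //; exact: measurableC.
  + exact: ltW.
  + by have [_ _ _ _ /ltW] := hK n.
Qed.

End tight_measure.
End small_sets.

(** Inner regularity provides a compact subset of phi(A); it is closed since P is Hausdorff, so its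
    preimage is measurable. *)
Lemma tight_standard (R : realType) (d : measure_display) (X : measurableType d)
    (mu : {sigma_finite_measure set X -> \bar R}) : standard_measure_space mu ->
  exists (P : topologicalType) (phi : X -> P), injective phi /\ tight mu phi.
Proof.
move=> [P [phi [bphi [hP _] mphi _ inner]]]; have iphi := bij_inj bphi.
exists P, phi; split=> // A mA Aoo e e0.
have Afin : mu A \is a fin_num by rewrite ge0_fin_numE.
have := Afin; rewrite {1}(inner A mA) => /(ub_ereal_sup_adherent e0)[_ [K [cK KA] <-]].
rewrite -(inner A mA) => lt.
have KE : phi @` (phi @^-1` K) = K.
  apply/seteqP; split=> [_ [x hx <-]//|y Ky].
  by have [x Ax xy] := KA y Ky; exists x => //=; rewrite xy.
have clK : closed K by exact: compact_closed.
have mK : measurable (phi @^-1` K).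
  apply/mphi; rewrite KE -(setCK K); apply: sigma_algebraC.
  by apply: sub_sigma_algebra; exact: closed_openC.
have KA' : phi @^-1` K `<=` A by move=> x /KA[x' Ax' /iphi <-].
exists (phi @^-1` K); split=> //; first by rewrite /kc KE.
have KI : A `&` phi @^-1` K = phi @^-1` K by rewrite setIC; exact/setIidl.
rewrite measureD// KI lteBlDr; last first.
  by rewrite ge0_fin_numE//; apply: le_lt_trans Aoo; apply: le_measure; rewrite ?inE.
by rewrite addeC -lteBlDr.
Qed.

Section product_tight.
Context (R : realType) (d1 d2 : measure_display).
Context (X1 : measurableType d1) (X2 : measurableType d2).
Variables (m1 : {sigma_finite_measure set X1 -> \bar R}).
Variables (m2 : {sigma_finite_measure set X2 -> \bar R}).
Variables (P1 P2 : topologicalType) (phi1 : X1 -> P1) (phi2 : X2 -> P2).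
Hypotheses (i1 : injective phi1) (i2 : injective phi2).
Hypotheses (t1 : tight m1 phi1) (t2 : tight m2 phi2).
Let mu := (m1 \x m2)%E.
Let phi (z : X1 * X2) := (phi1 z.1, phi2 z.2).

Lemma injective_pair_map : injective phi.
Proof. by move=> [x y] [x' y'] [/i1 -> /i2 ->]. Qed.

(** Tightness of the product is proved by showing that the good sets form a sigma-algebra. Asking
    for compactness of both [K & A] and [K \ A] makes the condition symmetric under complements. *)
Definition approx (A : set (X1 * X2)) := measurable A /\
  forall S1 S2, measurable S1 -> measurable S2 -> (m1 S1 < +oo)%E -> (m2 S2 < +oo)%E ->
  forall e : R, 0 < e -> exists K, [/\ measurable K, K `<=` S1 `*` S2, kc phi (K `&` A),
    kc phi (K `\` A) & (mu ((S1 `*` S2) `\` K) < e%:E)%E].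

Lemma muX A B : measurable A -> measurable B -> mu (A `*` B) = (m1 A * m2 B)%E.
Proof. by move=> mA mB; exact: product_measure1E. Qed.

Lemma small_rectangles (a b : \bar R) (e : R) : (a < +oo)%E -> (b < +oo)%E -> (0 <= a)%E ->
  (0 <= b)%E -> 0 < e ->
  exists2 d : R, 0 < d & forall u v : \bar R, (0 <= u)%E -> (0 <= v)%E ->
    (u < d%:E)%E -> (v < d%:E)%E -> (u * b + a * v < e%:E)%E.
Proof.
move=> aoo boo a0 b0 e0.
have af : a \is a fin_num by rewrite ge0_fin_numE.
have bf : b \is a fin_num by rewrite ge0_fin_numE.
rewrite -(fineK af) -(fineK bf); have fa : 0 <= fine a by exact: fine_ge0.
have fb : 0 <= fine b by exact: fine_ge0.
move: (fine a) (fine b) fa fb => x y x0 y0.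
have D0 : 0 < x + y + 1 by rewrite ltr_wpDl// addr_ge0.
exists (e / (x + y + 1)); first exact: divr_gt0.
case=> [u| |] [v| |] //; rewrite !lee_fin !lte_fin => u0 v0 ud vd.
have key : u * y + x * v <= e / (x + y + 1) * (x + y).
  by rewrite mulrDr [leRHS]addrC lerD// ?[x * v]mulrC ler_wpM2r// ltW.
apply: le_lt_trans key _.
by rewrite mulrAC ltr_pdivrMr// ltr_pM2l// ltrDl.
Qed.

Lemma approx_rectangle A1 A2 : measurable A1 -> measurable A2 -> approx (A1 `*` A2).
Proof.
move=> mA1 mA2; split; first exact: measurableX.
move=> S1 S2 mS1 mS2 S1oo S2oo e e0.
have [d d0 hd] := small_rectangles S1oo S2oo (measure_ge0 m1 S1) (measure_ge0 m2 S2) e0.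
have [K1 [mK1 KS1 k1 k1' e1]] := tight_approx t1 mA1 mS1 S1oo d0.
have [K2 [mK2 KS2 k2 k2' e2]] := tight_approx t2 mA2 mS2 S2oo d0.
have kK2 : kc phi2 K2 by rewrite -(setUIDK K2 A2); exact: kc_setU.
exists (K1 `*` K2); split.
- exact: measurableX.
- by move=> z [/KS1 h1 /KS2 h2].
- by rewrite -setXI; exact: kc_setX.
- rewrite (_ : _ `\` _ = (K1 `\` A1) `*` K2 `|` (K1 `&` A1) `*` (K2 `\` A2)).
    by apply: kc_setU; exact: kc_setX.
  apply/seteqP; split=> z.
    move=> [[h1 h2] h3]; have [A1z|A1z] := pselect (A1 z.1); last by left.
    by right; split=> //; split=> // A2z; apply: h3.
  by move=> [[[h1 h2] h3]|[[h1 h2] [h3 h4]]]; split=> // -[].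
- apply: (@le_lt_trans _ _ (mu ((S1 `\` K1) `*` S2 `|` S1 `*` (S2 `\` K2)))).
    apply: le_measure; rewrite ?inE.
    + by apply: measurableD; exact: measurableX.
    + by apply: measurableU; apply: measurableX => //; exact: measurableD.
    + move=> z [[h1 h2] h3]; have [Kz|Kz] := pselect (K1 z.1); last by left.
      by right; split=> //; split=> // K2z; apply: h3.
  apply: (@le_lt_trans _ _ (mu ((S1 `\` K1) `*` S2) + mu (S1 `*` (S2 `\` K2)))%E).
    by apply: measureU2; apply: measurableX => //; exact: measurableD.
  by rewrite !muX//; try exact: measurableD; exact: hd.
Qed.

Lemma approxC A : approx A -> approx (~` A).
Proof.
move=> [mA hA]; split; first exact: measurableC.
move=> S1 S2 mS1 mS2 S1oo S2oo e e0.
have [K [mK KS k k' ek]] := hA S1 S2 mS1 mS2 S1oo S2oo e e0.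
by exists K; split=> //; rewrite ?setDE ?setCK// -setDE.
Qed.

Lemma mu_rectangle_lty S1 S2 : measurable S1 -> measurable S2 -> (m1 S1 < +oo)%E ->
  (m2 S2 < +oo)%E -> (mu (S1 `*` S2) < +oo)%E.
Proof. by move=> mS1 mS2 S1oo S2oo; rewrite muX// lte_mul_pinfty// ge0_fin_numE. Qed.

(** Within the intersection L of the sets K n, the part outside the union is an intersection of
    compact sets, but the part inside is only a countable union. It is replaced by a finite union of
    small defect, for which the other half of e is reserved. *)
Lemma approx_bigcup (A : nat -> set (X1 * X2)) : (forall n, approx (A n)) ->
  approx (\bigcup_n A n).
Proof.
move=> hA; have mA n : measurable (A n) by have [] := hA n.
split; first exact: bigcup_measurable.
move=> S1 S2 mS1 mS2 S1oo S2oo e e0.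
have Soo := mu_rectangle_lty mS1 mS2 S1oo S2oo.
have mS : measurable (S1 `*` S2) by exact: measurableX.
have e2 : 0 < e / 2 by rewrite divr_gt0.
have en n : 0 < (e / 2) / (2 ^ n.+1)%:R by rewrite divr_gt0// ltr0n expn_gt0.
have [K hK] := choice (fun n => (hA n).2 S1 S2 mS1 mS2 S1oo S2oo _ (en n)).
have mK n : measurable (K n) by have [] := hK n.
pose L := \bigcap_n K n.
have mL : measurable L by apply: bigcap_measurable.
have LS : L `<=` S1 `*` S2 by move=> x /(_ 0%N I); have [_ h _ _ _] := hK 0%N; exact: h.
have kK n : kc phi (K n).
  have [_ _ h1 h2 _] := hK n; rewrite -(setUIDK (K n) (A n)).
  exact: kc_setU.
have kL : kc phi L by apply: kc_bigcap => //; exact: injective_pair_map.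
have kLA n : kc phi (L `&` A n).
  rewrite (_ : _ `&` _ = L `&` (K n `&` A n)).
    by apply: kc_setI => //; [exact: injective_pair_map|have [] := hK n].
  by rewrite setIA; congr (_ `&` _); apply/esym/setIidl => x; exact.
have kLD : kc phi (L `\` \bigcup_n A n).
  rewrite (_ : _ `\` _ = \bigcap_n (K n `\` A n)).
    by apply: kc_bigcap => [|n]; [exact: injective_pair_map|have [] := hK n].
  apply/seteqP; split=> [x [Lx nA] n _|x h].
    by split; [exact: Lx|move=> Ax; apply: nA; exists n].
  by split=> [n _|[n _ Ax]]; [have [] := h n I|have [] := h n I].
have Loo : (mu L < +oo)%E by apply: le_lt_trans Soo; apply: le_measure; rewrite ?inE.
have [N hN] := measure_bigsetU_tail mL Loo mA e2.
pose B := \big[setU/set0]_(i < N) (L `&` A i).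
have BE : B = L `&` \big[setU/set0]_(i < N) A i by rewrite /B big_distrr.
have BA : B `<=` \bigcup_n A n.
  by rewrite BE => x [_]; rewrite -bigcup_mkord => -[n _ h]; exists n.
exists (B `|` (L `\` \bigcup_n A n)); split.
- apply: measurableU; last by apply: measurableD => //; exact: bigcup_measurable.
  by apply: bigsetU_measurable => i _; exact: measurableI.
- by move=> x [|[/LS//]]; rewrite BE => -[/LS].
- rewrite (_ : _ `&` _ = B); first exact: (kc_bigsetU N kLA).
  apply/seteqP; split=> [x [[Bx|[_ h]] h'] //|x Bx].
  by split; [left|exact: BA].
- rewrite (_ : _ `\` _ = L `\` \bigcup_n A n)//.
  apply/seteqP; split=> [x [[/BA Bx|Lx] h'] //|x [h1 h2]].
  by split; [right|].
- apply: (@le_lt_trans _ _ (mu (((S1 `*` S2) `\` L) `|`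
      ((L `&` \bigcup_n A n) `\` \big[setU/set0]_(i < N) A i)))).
    apply: le_measure; rewrite ?inE.
    + apply: measurableD => //; apply: measurableU.
        by apply: bigsetU_measurable => i _; exact: measurableI.
      by apply: measurableD => //; exact: bigcup_measurable.
    + apply: measurableU; first exact: measurableD.
      apply: measurableD; last exact: bigsetU_measurable.
      by apply: measurableI => //; exact: bigcup_measurable.
    + move=> x [Sx /not_orP[h1 h2]]; have [Lx|Lx] := pselect (L x); last by left.
      right; split; last by move=> h; apply: h1; rewrite BE.
      by split=> //; apply: contrapT => h; apply: h2.
  apply: (@le_lt_trans _ _ (mu ((S1 `*` S2) `\` L) +
      mu ((L `&` \bigcup_n A n) `\` \big[setU/set0]_(i < N) A i))%E).
    apply: measureU2; first exact: measurableD.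
    apply: measurableD; last exact: bigsetU_measurable.
    by apply: measurableI => //; exact: bigcup_measurable.
  have h1 : (mu ((S1 `*` S2) `\` L) <= (e / 2)%:E)%E.
    rewrite /L setDE setC_bigcap setI_bigcupr; apply: measure_bigcup_le => [n||n].
    + by apply: measurableI => //; exact: measurableC.
    + exact: ltW.
    + by have [_ _ _ _ /ltW] := hK n.
  by rewrite (splitr e) EFinD lee_ltD// ge0_fin_numE// (le_lt_trans h1) ?ltry.
Qed.

Lemma approx_measurable A : measurable A -> approx A.
Proof.
rewrite measurable_prod_measurableType; move: A; apply: smallest_sub.
  split.
  - by rewrite -(set0X (@setT X2)); apply: approx_rectangle.
  - by move=> A hA; rewrite setTD; exact: approxC.
  - exact: approx_bigcup.
by move=> _ [A mA [B mB <-]]; exact: approx_rectangle.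
Qed.

Lemma sigma_finite_prod : sigma_finite setT mu.
Proof.
have [S1 [mS1 S1oo S1nd S1T]] := sigma_finite_cover m1.
have [S2 [mS2 S2oo S2nd S2T]] := sigma_finite_cover m2.
exists (fun n => S1 n `*` S2 n) => [|n]; last first.
  by split; [exact: measurableX|exact: mu_rectangle_lty].
apply/seteqP; split=> // z _; have [n1 h1] := S1T z.1; have [n2 h2] := S2T z.2.
exists (maxn n1 n2) => //; split.
  by have /subsetPset := S1nd _ _ (leq_maxl n1 n2); apply.
by have /subsetPset := S2nd _ _ (leq_maxr n1 n2); apply.
Qed.

(** As A has finite measure, all but e / 2 of it lies in finitely many rectangles of finite measure;
    they are nested, so one rectangle contains them, and [approx] applies there. *)
Lemma tight_prod : tight mu phi.
Proof.
move=> A mA Aoo e e0; have e2 : 0 < e / 2 by rewrite divr_gt0.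
have [S1 [mS1 S1oo S1nd S1T]] := sigma_finite_cover m1.
have [S2 [mS2 S2oo S2nd S2T]] := sigma_finite_cover m2.
have mS n : measurable (S1 n `*` S2 n) by exact: measurableX.
have [N hN] := measure_bigsetU_tail mA Aoo mS e2.
have SN : \big[setU/set0]_(i < N) (S1 i `*` S2 i) `<=` S1 N `*` S2 N.
  rewrite -(bigcup_mkord N (fun i => S1 i `*` S2 i)) => z [n /= nN [h1 h2]].
  by split; [have /subsetPset := S1nd _ _ (ltnW nN)|have /subsetPset := S2nd _ _ (ltnW nN)]; apply.
have [K [mK KS k k' ek]] := (approx_measurable mA).2 _ _ (mS1 N) (mS2 N) (S1oo N) (S2oo N) _ e2.
exists (K `&` A); split=> //; first exact: measurableI.
have mSb : measurable ((A `&` \bigcup_n (S1 n `*` S2 n)) `\`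
    \big[setU/set0]_(i < N) (S1 i `*` S2 i)).
  apply: measurableD; last by apply: bigsetU_measurable.
  by apply: measurableI => //; exact: bigcup_measurable.
apply: (@le_lt_trans _ _ (mu (((A `&` \bigcup_n (S1 n `*` S2 n)) `\`
    \big[setU/set0]_(i < N) (S1 i `*` S2 i)) `|` ((S1 N `*` S2 N) `\` K)))).
  apply: le_measure; rewrite ?inE.
  - by apply: measurableD => //; exact: measurableI.
  - by apply: measurableU => //; apply: measurableD.
  - move=> z [Az nK].
    have [Sz|Sz] := pselect ((S1 N `*` S2 N) z).
      by right; split=> // Kz; apply: nK.
    left; split; last by move/SN.
    split=> //; have [n1 h1] := S1T z.1; have [n2 h2] := S2T z.2.
    exists (maxn n1 n2) => //; split.
      by have /subsetPset := S1nd _ _ (leq_maxl n1 n2); apply.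
    by have /subsetPset := S2nd _ _ (leq_maxr n1 n2); apply.
apply: (@le_lt_trans _ _ (mu ((A `&` \bigcup_n (S1 n `*` S2 n)) `\`
    \big[setU/set0]_(i < N) (S1 i `*` S2 i)) + mu ((S1 N `*` S2 N) `\` K))%E).
  by apply: measureU2 => //; exact: measurableD.
by rewrite (splitr e) EFinD lteD.
Qed.

End product_tight.

Lemma tight_exhaustion (R : realType) (d : measure_display) (X : measurableType d)
    (mu : {measure set X -> \bar R}) (P : topologicalType) (phi : X -> P)
    (A : nat -> set X) (X0 : set X) :
  sigma_finite setT mu -> injective phi -> tight mu phi -> (forall n, measurable (A n)) -> measurable X0 ->
  mu X0 = 0%E ->
  exists K : nat -> set X, [/\ forall n, measurable (K n), forall n, K n `<=` K n.+1,
    \forall x \ae mu, exists n, K n x, forall n, K n `<=` ~` X0 &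
    forall n, kc phi (K n) /\ forall j, kc phi (K n `\` A j)].
Proof.
move=> sfmu iphi tphi mA mX0 X00.
have /sigma_finiteP[S [SE Snd mSoo]] := sfmu.
have mS n : measurable (S n) by have [] := mSoo n.
have Soo n : (mu (S n) < +oo)%E by have [] := mSoo n.
have ST x : exists n, S n x by have : setT x by []; rewrite SE => -[n _ Sx]; exists n.
have mSX n : measurable (S n `\` X0) by exact: measurableD.
have SXoo n : (mu (S n `\` X0) < +oo)%E.
  by apply: le_lt_trans (Soo n); apply: le_measure; rewrite ?inE//; exact: subIsetl.
have en n : 0 < (n.+1%:R^-1 : R) by rewrite invr_gt0.
have [C hC] := choice (fun n => tight_seq iphi tphi mA (mSX n) (SXoo n) (en n)).
(* Running unions of the sets C n make the exhaustion increasing and keep the relative complements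
   of each A j compact. *)
pose K := nat_rect (fun=> set X) (C 0%N) (fun n Kn => Kn `|` C n.+1).
have CK n : C n `<=` K n by case: n => [|n] //= x; right.
have mC n : measurable (C n) by have [] := hC n.
have mK n : measurable (K n) by elim: n => //= n IH; exact: measurableU.
exists K; split=> //.
- by move=> n x; left.
- have mN : measurable (~` (\bigcup_n K n)).
    by apply: measurableC; exact: bigcup_measurable.
  exists (~` (\bigcup_n K n)); split=> //; last first.
    by move=> x /= h [n _ Kx]; apply: h; exists n.
  have NS : ~` (\bigcup_n K n) `<=` \bigcup_n (S n `\` \bigcup_n K n).
    by move=> x nK; have [n Sx] := ST x; exists n.
  have mSK n : measurable (S n `\` \bigcup_n K n).
    by apply: measurableD => //; exact: bigcup_measurable.
  have SK0 n : mu (S n `\` \bigcup_n K n) = 0%E.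
    apply/eqP; rewrite eq_le measure_ge0 andbT; apply/lee_addgt0Pr => e e0; rewrite add0e.
    have [N _ /(_ N (leqnn N)) /= hN] := near_infty_natSinv_lt (PosNum e0).
    set j := maxn n N; have [_ _ _ _ Cj] := hC j.
    apply: (@le_trans _ _ (mu (((S j `\` X0) `\` C j) `|` X0))).
      apply: le_measure; rewrite ?inE//.
      + by apply: measurableU => //; exact: measurableD.
      + move=> x [Sx nK]; have [X0x|X0x] := pselect (X0 x); first by right.
        left; split; last by move=> /CK Kx; apply: nK; exists j.
        by split=> //; have /subsetPset := Snd _ _ (leq_maxl n N); apply.
    rewrite measureU0//; last exact: measurableD.
    apply: le_trans Cj _; rewrite lee_fin (le_trans _ (ltW hN))//.
    by rewrite lef_pV2 ?posrE// ler_nat ltnS leq_maxr.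
  apply/eqP; rewrite eq_le measure_ge0 andbT.
  apply: (@le_trans _ _ (mu (\bigcup_n (S n `\` \bigcup_n K n)))).
    by apply: le_measure; rewrite ?inE//; exact: bigcup_measurable.
  apply: (@le_trans _ _ (\sum_(0 <= n <oo) mu (S n `\` \bigcup_n K n))%E).
    by apply: measure_sigma_subadditive => //; exact: bigcup_measurable.
  by rewrite eseries0// => n _ _; exact: SK0.
- have CX n : C n `<=` ~` X0 by move=> x; have [_ h _ _ _] := hC n; move=> /h[].
  by elim=> [|n IH] /=; [exact: CX|move=> x [/IH|/CX]].
- have kC n : kc phi (C n).
    by have [_ _ h1 h2 _] := hC n; rewrite -(setUIDK (C n) (A n)); exact: kc_setU.
  have kCA n j : kc phi (C n `\` A j) by have [_ _ _ h _] := hC n; exact: h.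
  elim=> [|n [IH1 IH2]]; first by split; [exact: kC|exact: kCA].
  by split=> [|j] /=; [exact: kc_setU|rewrite setDUl; exact: kc_setU].
Qed.

(** * Tensor products annihilating Psi *)

Section covering.
Context (R : realType) (d d' : measure_display).
Context (X : measurableType d) (Y : measurableType d').
Variables (mu : {measure set X -> \bar R}) (nu : {measure set Y -> \bar R}).
Variables (A : L2S mu -> L2S nu) (M : R) (bA : blinear A M).
Variables (f : nat -> L2S mu) (g : nat -> L2S nu).
Hypotheses (sf : l2seq f) (sg : l2seq g).

Lemma hpair_splitl (u u1 u2 : nat -> L2S mu) (v : nat -> L2S nu) :
  l2seq u1 -> l2seq u2 -> l2seq v -> (forall i, u i = u1 i + u2 i) ->
  hpair A u v = hpair A u1 v + hpair A u2 v.
Proof.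
move=> s1 s2 sv uE; rewrite /hpair -cseriesD; last 2 first.
- exact: asum_le (hpair_bound bA u1 v) (l2seq_bsum bA s1 sv).
- exact: asum_le (hpair_bound bA u2 v) (l2seq_bsum bA s2 sv).
apply: eq_cseries => i; rewrite -ipDl; apply: ip_eq_null; rewrite uE.
by have := blinear_comb bA 1 (u1 i) (u2 i); rewrite !scale1r.
Qed.

Lemma hpair_splitr (u : nat -> L2S mu) (v v1 v2 : nat -> L2S nu) :
  l2seq u -> l2seq v1 -> l2seq v2 -> (forall i, v i = v1 i + v2 i) ->
  hpair A u v = hpair A u v1 + hpair A u v2.
Proof.
move=> su s1 s2 vE; rewrite /hpair -cseriesD; last 2 first.
- exact: asum_le (hpair_bound bA u v1) (l2seq_bsum bA su s1).
- exact: asum_le (hpair_bound bA u v2) (l2seq_bsum bA su s2).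
apply: eq_cseries => i; rewrite -ipDr; congr (ip _ _); rewrite vE.
by apply: L2T_eq => x; rewrite /= rmorphD.
Qed.

(** Required on all measurable subrectangles, so that the property survives the cutting of
    rectangles. *)
Definition kills (S : set X) (S' : set Y) := forall K L (mK : measurable K) (mL : measurable L),
  K `<=` S -> L `<=` S' -> hpair A (restrS mK \o f) (restrS mL \o g) = 0.

Lemma kernel_sum_restr K L (mK : measurable K) (mL : measurable L) z :
  kernel_sum (restrS mK \o f) (restrS mL \o g) z <> 0 ->
  [/\ K z.1, L z.2 & kernel_sum f g z <> 0].
Proof.
move=> nz; have Kz : K z.1.
  apply: contrapT => h; apply: nz; rewrite -[RHS](cseries0 R); apply: eq_cseries => i.
  by rewrite restrSE /cindic indicE memNset// !mul0r.
have Lz : L z.2.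
  apply: contrapT => h; apply: nz; rewrite -[RHS](cseries0 R); apply: eq_cseries => i.
  by rewrite [X in _ * X]restrSE /cindic indicE memNset// mul0r mulr0.
split=> // e; apply: nz; rewrite -[RHS]e; apply: eq_cseries => i.
by rewrite !restrSE /cindic !indicE !mem_set// !mul1r.
Qed.

(** Induction on N: K x L is cut along the last rectangle into three rectangles. The pairing
    vanishes on the one inside, and the other two are covered by the first N. *)
Lemma hpair_finite_cover (C : nat -> set X) (D : nat -> set Y) N :
  (forall n, measurable (C n)) -> (forall n, measurable (D n)) -> (forall n, kills (C n) (D n)) ->
  forall K L (mK : measurable K) (mL : measurable L),
  K `*` L `<=` \big[setU/set0]_(i < N) (C i `*` D i) ->
  hpair A (restrS mK \o f) (restrS mL \o g) = 0.
Proof.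
move=> mC mD kCD; elim: N => [|N IH] K L mK mL cov.
  apply: (hpair_null bA); [exact: l2seq_restr|exact: l2seq_restr|].
  exists set0, set0; split=> //; rewrite ?measure0// => z /= /kernel_sum_restr[Kz Lz _].
  have KLz : (K `*` L) z by split.
  by have := cov z KLz; rewrite big_ord0.
have mKC : measurable (K `&` C N) by exact: measurableI.
have mKD : measurable (K `\` C N) by exact: measurableD.
have mLC : measurable (L `&` D N) by exact: measurableI.
have mLD : measurable (L `\` D N) by exact: measurableD.
have s (U : set X) (mU : measurable U) := l2seq_restr mU sf.
have s' (U : set Y) (mU : measurable U) := l2seq_restr mU sg.
rewrite (hpair_splitl (s _ mKC) (s _ mKD) (s' _ mL) (fun i => restrS_split mK mKC mKD (f i))).
rewrite (hpair_splitr (s _ mKC) (s' _ mLC) (s' _ mLD) (fun i => restrS_split mL mLC mLD (g i))).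
rewrite (kCD N _ _ mKC mLC) ?add0r//; try exact: subIsetr.
rewrite (IH _ _ mKC mLD) ?(IH _ _ mKD mL) ?addr0// => z [h1 h2].
- have KLz : (K `*` L) z by split=> //; case: h1.
  have := cov z KLz; rewrite big_ord_recr /= => -[//|[Cz _]].
  by case: h1.
- have KLz : (K `*` L) z by split=> //; [case: h1|case: h2].
  have := cov z KLz; rewrite big_ord_recr /= => -[//|[_ Dz]].
  by case: h2.
Qed.

Definition covered (W : set (X * Y)) := exists (C : nat -> set X) (D : nat -> set Y),
  [/\ forall n, measurable (C n), forall n, measurable (D n), forall n, kills (C n) (D n) &
  marginally_null mu nu (W `\` \bigcup_n (C n `*` D n))].

Lemma coveredU V W : covered V -> covered W -> covered (V `|` W).
Proof.
move=> [C [D [mC mD kCD n1]]] [C' [D' [mC' mD' kCD' n2]]].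
exists (fun n => if odd n then C n./2 else C' n./2), (fun n => if odd n then D n./2 else D' n./2).
split; [by move=> n; case: ifP|by move=> n; case: ifP|by move=> n; case: ifP|].
apply: marginally_null_sub (marginally_nullU n1 n2) => z [[Vz|Wz] h]; [left|right]; split=> // -[n _ hn].
- apply: h; exists n.*2.+1 => //; have -> : odd n.*2.+1 by rewrite /= odd_double.
  by rewrite /= uphalf_double.
- by apply: h; exists n.*2 => //; rewrite odd_double doubleK.
Qed.

(** On a subrectangle of one of the rectangles that make up E, the restricted kernel vanishes
    marginally almost everywhere, and [hpair_null] applies. *)
Lemma covered_vanishing h E : rep f g h -> omega_open mu nu E -> vanishes_on mu nu E h ->
  covered E.
Proof.
move=> [_ _ Nh] [C [D [mC mD NE]]] vE; exists C, D; split=> //; last first.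
  by apply: marginally_null_sub NE => z [Ez h']; left.
move=> n K L mK mL KC LD; apply: (hpair_null bA); [exact: l2seq_restr|exact: l2seq_restr|].
apply: marginally_null_sub (marginally_nullU Nh (marginally_nullU NE vE)).
move=> z /kernel_sum_restr[Kz Lz nz].
have [hz|hz] := pselect (h z = kernel_sum f g z); last by left.
have CDz : (\bigcup_n (C n `*` D n)) z by exists n => //; split; [exact: KC|exact: LD].
right; have [Ez|Ez] := pselect (E z); last by left; right.
by right; split=> //=; rewrite hz.
Qed.

Lemma kills_restr S S' (mS : measurable S) (mS' : measurable S') :
  (forall u v, ip (A (restrS mS u)) (conjS (restrS mS' v)) = 0) -> kills S S'.
Proof.
move=> h K L mK mL KS LS; rewrite /hpair -[RHS](cseries0 R); apply: eq_cseries => i.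
have E1 : restrS mK (f i) = restrS mS (restrS mK (f i)).
  by apply: L2T_eq => x; rewrite !restrSE mulrA cindicM (setIidr KS).
have E2 : restrS mL (g i) = restrS mS' (restrS mL (g i)).
  by apply: L2T_eq => x; rewrite !restrSE mulrA cindicM (setIidr LS).
transitivity (ip (A (restrS mK (f i))) (conjS (restrS mL (g i)))); first by [].
by rewrite E1 E2 h.
Qed.

Variables (P Q : topologicalType) (phi : X -> P) (psi : Y -> Q).
Hypotheses (iphi : injective phi) (ipsi : injective psi).
Hypotheses (sfmu : sigma_finite setT mu) (sfnu : sigma_finite setT nu).
Hypotheses (tphi : tight mu phi) (tpsi : tight nu psi).

(** Exhausting sets K n and L n are chosen such that each K n x L n has a finite subcover; the
    pairings of the restrictions vanish, and they converge to the pairing of f and g by Tannery's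
    theorem. *)
Lemma covered_hpair : covered setT -> hpair A f g = 0.
Proof.
move=> [C [D [mC mD kCD [X0 [Y0 [mX0 X00 mY0 Y00 cov]]]]]].
have [K [mK Kinc Kae KX0 kK]] := tight_exhaustion sfmu iphi tphi mC mX0 X00.
have [L [mL Linc Lae LY0 kL]] := tight_exhaustion sfnu ipsi tpsi mD mY0 Y00.
have KL0 n : hpair A (restrS (mK n) \o f) (restrS (mL n) \o g) = 0.
  (* K n and L n avoid the null sets X0 and Y0, so K n x L n is covered without exception. *)
  have [N hN] : exists N, K n `*` L n `<=` \big[setU/set0]_(i < N) (C i `*` D i).
    apply: (compact_finite_cover iphi ipsi (kK n).1 (kK n).2 (kL n).1 (kL n).2).
    move=> z [Kz Lz]; apply: contrapT => nz.
    have [[Xz _]|[_ Yz]] := cov z (conj I nz); first exact: (KX0 n _ Kz Xz).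
    exact: (LY0 n _ Lz Yz).
  exact: (hpair_finite_cover mC mD kCD (mK n) (mL n) hN).
have M0 : 0 <= M by case: bA.
pose a n i := ip (A (restrS (mK n) (f i))) (conjS (restrS (mL n) (g i))).
pose u i := ip (A (f i)) (conjS (g i)).
have ab n i : cmod (a n i) <= M * (hn (f i) * hn (g i)).
  rewrite (le_trans (cauchy_schwarz _ _))// hn_conjS mulrA ler_pM ?hn_ge0//; last exact: hn_restrS.
  by rewrite (le_trans (blinear_le bA _))// ler_wpM2l// hn_restrS.
have au i e : 0 < e -> exists N, forall n, (N <= n)%N -> cmod (a n i - u i) < e.
  move=> e0; pose c := M * hn (g i) + M * hn (f i) + 1.
  have c0 : 0 < c by rewrite ltr_wpDl// addr_ge0// mulr_ge0 ?hn_ge0.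
  have ec : 0 < e / c by rewrite divr_gt0.
  have [N1 h1] := hcv_restr mK (f i) Kinc Kae ec.
  have [N2 h2] := hcv_restr mL (g i) Linc Lae ec.
  exists (maxn N1 N2) => n; rewrite geq_max => /andP[/h1 {}h1 /h2 {}h2].
  have b1 : cmod (a n i - ip (A (f i)) (conjS (restrS (mL n) (g i)))) <= M * hn (g i) * (e / c).
    rewrite /a -ipBl (le_trans (cauchy_schwarz _ _))// hn_conjS mulrAC ler_pM ?hn_ge0//.
      by rewrite (le_trans (blinear_sub_le bA _ _))// ler_wpM2l// ltW.
    exact: hn_restrS.
  have b2 : cmod (ip (A (f i)) (conjS (restrS (mL n) (g i))) - u i) <= M * hn (f i) * (e / c).
    have -> : ip (A (f i)) (conjS (restrS (mL n) (g i))) - u i =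
        ip (A (f i)) (conjS (restrS (mL n) (g i) - g i)).
      rewrite /u -ipBr; congr (ip _ _); apply: L2T_eq => y.
      by rewrite /= rmorphB.
    rewrite (le_trans (cauchy_schwarz _ _))// hn_conjS ler_pM ?hn_ge0//; last exact: ltW.
    exact: (blinear_le bA).
  rewrite -(subrKA (ip (A (f i)) (conjS (restrS (mL n) (g i))))) (le_lt_trans (cmodD _ _))//.
  apply: (le_lt_trans (lerD b1 b2)); rewrite -mulrDl mulrCA gtr_pMr// ltr_pdivrMr// mul1r.
  by rewrite /c ltrDl.
apply: cmod_eq0; apply/eqP; rewrite eq_le cmod_ge0 andbT; apply/ler_addgt0Pr => e e0.
have [N /(_ N (leqnn N)) hN] := tannery ab (l2seq_bsum bA sf sg) au e0.
rewrite add0r ltW//; apply: le_lt_trans hN.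
by rewrite [cseries (a N)](KL0 N) sub0r cmodN.
Qed.

End covering.

(** Continuity in the norm of Gamma. Since h = h0 + (h - h0) holds for functions and not for the
    representing sequences, additivity of the pairing is taken from [hpair_additive]. *)
Lemma hpair_Psi (R : realType) (d d' : measure_display)
    (X : measurableType d) (Y : measurableType d')
    (mu : {measure set X -> \bar R}) (nu : {measure set Y -> \bar R})
    (A : L2S mu -> L2S nu) (M : R) (k : set (X * Y)) : blinear A M ->
  (forall h u v, vanishes_near mu nu k h -> rep u v h -> hpair A u v = 0) ->
  forall h u v, Psi mu nu k h -> rep u v h -> hpair A u v = 0.
Proof.
move=> bA near0 h f g [_ Ph] [sf sg Nh]; have M0 : 0 <= M by case: bA.
apply: cmod_eq0; apply/eqP; rewrite eq_le cmod_ge0 andbT; apply/ler_addgt0Pr => e e0.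
(* The pairing of h - h0 is at most 2 M times its norm, the 2 coming from [cseries_le]. *)
have C0 : 0 < 2 * M + 1 by rewrite ltr_wpDl// mulr_ge0.
have [h0 [/GammaP[f0 [g0 r0]] vh0 dh]] := Ph _ (divr_gt0 e0 C0).
have [f1 [g1 [[sf1 sg1 N1] fg1]]] := Gamma_norm_lt dh.
have [sf0 sg0 N0] := r0.
pose F j := if j is 0%N then f else if j is 1%N then f0 else f1.
pose G j := if j is 0%N then g else if j is 1%N then g0 else g1.
have -> : hpair A f g = hpair A f1 g1.
  rewrite -[RHS]add0r -(near0 _ _ _ vh0 r0).
  apply: (hpair_additive (F := F) (G := G) bA); [by case=> [|[|]]|by case=> [|[|]]|].
  apply: marginally_null_sub (marginally_nullU Nh (marginally_nullU N0 N1)) => z hz.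
  have [e1|] := pselect (h z = kernel_sum f g z); last by left.
  have [e2|] := pselect (h0 z = kernel_sum f0 g0 z); last by right; left.
  have [e3|] := pselect (h z - h0 z = kernel_sum f1 g1 z); last by right; right.
  by exfalso; apply: hz; rewrite /F /G -e1 -e2 -e3 addrC subrK.
have b0 i : 0 <= hn (f1 i) * hn (g1 i) by rewrite mulr_ge0 ?hn_ge0.
rewrite add0r (le_trans (cseries_le (hpair_bound bA f1 g1) (l2seq_bsum bA sf1 sg1)))//.
apply: (@le_trans _ _ (2 * (M * rsum (fun i => hn (f1 i) * hn (g1 i))))).
  rewrite ler_wpM2l//; apply: rsum_le_bound => [i|n]; first by rewrite mulr_ge0.
  rewrite /series /= -mulr_sumr ler_wpM2l//; apply: series_le_rsum => //.
  exact: bsum_hn_mul.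
move: fg1; set r := rsum _ => rlt; have r0' : 0 <= r.
  have := series_le_rsum 0 b0 (bsum_hn_mul sf1 sg1).
  by rewrite /series /= big_geq.
move: rlt; rewrite ltr_pdivlMr// => /ltW; apply: le_trans.
by rewrite mulrA [leRHS]mulrC ler_wpM2r// lerDl.
Qed.

Section tensor_annihilators.
Context (R : realType) (d1 d2 e1 e2 : measure_display).
Context (X1 : measurableType d1) (X2 : measurableType d2).
Context (Y1 : measurableType e1) (Y2 : measurableType e2).
Variables (m1 : {sigma_finite_measure set X1 -> \bar R}).
Variables (m2 : {sigma_finite_measure set X2 -> \bar R}).
Variables (n1 : {sigma_finite_measure set Y1 -> \bar R}).
Variables (n2 : {sigma_finite_measure set Y2 -> \bar R}).
Variables (k1 : set (X1 * Y1)) (k2 : set (X2 * Y2)).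
Local Notation mu := (m1 \x m2)%E.
Local Notation nu := (n1 \x n2)%E.
Let kappa := (@rho X1 X2 Y1 Y2) @` (k1 `*` k2).

Lemma tensor_operator (S : set ((X1 * X2) * (Y1 * Y2) -> R[i])) T1 T2
    (bT1 : bounded_operator m1 n1 T1) (bT2 : bounded_operator m2 n2 T2) (M1 M2 : R)
    (bA1 : blinear (oplift bT1) M1) (bA2 : blinear (oplift bT2) M2) :
  compact_operator m1 n1 T1 -> nonzero_operator m1 n1 T1 ->
  compact_operator m2 n2 T2 -> nonzero_operator m2 n2 T2 ->
  (forall h f g, S h -> rep f g h -> hpair (tens_op bA1 bA2) f g = 0) ->
  exists T, [/\ annihilator mu nu S T, compact_operator mu nu T & nonzero_operator mu nu T].
Proof.
move=> c1 z1 c2 z2 SA; have bA := tens_op_blinear bA1 bA2.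
have [e oe eK] := hcompact_approx bA1 (oplift_compact bT1 c1).
have cA := tens_op_compact bA1 bA2 oe (oplift_compact bT2 c2) eK.
have [f1 hf1] := oplift_nonzero bT1 z1; have [f2 hf2] := oplift_nonzero bT2 z2.
exists (unlift (tens_op bA1 bA2)); split.
- exact: (annihilator_unlift bA).
- exact: (unlift_compact bA).
- apply: (@unlift_nonzero _ _ _ _ _ _ _ _ (tensorS f1 f2)).
  rewrite (hn_null_eq (tens_op_tensor bA1 bA2 f1 f2)) hn_tensorS => /eqP.
  by rewrite mulf_eq0 => /orP[/eqP//|/eqP].
Qed.

Lemma tensor_M_min T1 T2 : M_min m1 n1 k1 T1 -> M_min m2 n2 k2 T2 ->
  compact_operator m1 n1 T1 -> nonzero_operator m1 n1 T1 ->
  compact_operator m2 n2 T2 -> nonzero_operator m2 n2 T2 ->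
  exists T, [/\ M_min mu nu kappa T, compact_operator mu nu T & nonzero_operator mu nu T].
Proof.
move=> a1 a2 c1 z1 c2 z2; have [bT1 _] := c1; have [bT2 _] := c2.
have [M1 bA1] := oplift_blinear bT1; have [M2 bA2] := oplift_blinear bT2.
apply: (tensor_operator (bA1 := bA1) (bA2 := bA2)) => // h f g kh r.
have [e oe eK] := hcompact_approx bA1 (oplift_compact bT1 c1).
have [p bp] := nat2_enum; have [sf sg _] := r.
apply: (tens_op_Phi bA1 bA2 oe eK sf sg bp (k1 := k1) (k2 := k2) _ _ _ kh r).
- by move=> x1 y1 x2 y2 h1 h2; apply/rho_image.
- by move=> h' u v; exact: (annihilator_hpair bT1 a1).
- by move=> h' u v; exact: (annihilator_hpair bT2 a2).
Qed.

Hypotheses (s1 : standard_measure_space m1) (s2 : standard_measure_space m2).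
Hypotheses (s1' : standard_measure_space n1) (s2' : standard_measure_space n2).
Hypotheses (o1 : omega_closed m1 n1 k1) (o2 : omega_closed m2 n2 k2).

Lemma tensor_M_max T1 T2 : M_max m1 n1 k1 T1 -> M_max m2 n2 k2 T2 ->
  compact_operator m1 n1 T1 -> nonzero_operator m1 n1 T1 ->
  compact_operator m2 n2 T2 -> nonzero_operator m2 n2 T2 ->
  exists T, [/\ M_max mu nu kappa T, compact_operator mu nu T & nonzero_operator mu nu T].
Proof.
move=> a1 a2 c1 z1 c2 z2; have [bT1 _] := c1; have [bT2 _] := c2.
have [M1 bA1] := oplift_blinear bT1; have [M2 bA2] := oplift_blinear bT2.
apply: (tensor_operator (bA1 := bA1) (bA2 := bA2)) => //.
have bA := tens_op_blinear bA1 bA2.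
apply: (hpair_Psi bA) => h f g [E [oE kE vE]] r; have [sf sg _] := r.
(* A rectangle of the union that represents the complement of k meets k in a marginally null set, as
   [M_max_kills] requires. *)
have miss (dd dd' : measure_display) (U : measurableType dd) (W : measurableType dd')
    (m : {measure set U -> \bar R}) (n : {measure set W -> \bar R}) (k : set (U * W))
    (C : nat -> set U) (D : nat -> set W) j :
    marginally_null m n ((~` k) `+` \bigcup_n (C n `*` D n)) ->
    marginally_null m n (k `&` (C j `*` D j)).
  by apply: marginally_null_sub => z [kz CDz]; right; split=> //; exists j.
have cov1 : covered (tens_op bA1 bA2) f g (pull fst fst (~` k1)).
  have [C [D [mC mD N]]] := o1.
  have mS (dd dd' : measure_display) (U : measurableType dd) (W : measurableType dd')
      (B : set U) : measurable B -> measurable ((@fst U W) @^-1` B).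
    by move=> mB; rewrite -[X in measurable X]setTI; exact: measurable_fst.
  exists (fun n => fst @^-1` C n), (fun n => fst @^-1` D n); split.
  - by move=> n; exact: mS.
  - by move=> n; exact: mS.
  - move=> n; apply: (@kills_restr _ _ _ _ _ _ _ _ f g _ _ (mS _ _ _ _ _ (mC n)) (mS _ _ _ _ _ (mD n))).
    apply: (@kills_fst _ _ _ _ _ _ _ _ _ _ _ _ _ _ _ bA1 _ _ bA2 _ _ (mC n) (mD n)) => // u v.
    exact: (M_max_kills _ _ _ _ _ a1 (miss _ _ _ _ _ _ _ _ _ n N)).
  - apply: marginally_null_sub (marginally_null_pull measurable_fst measurable_fst
      (@null_fst _ _ _ _ _ m1 m2) (@null_fst _ _ _ _ _ n1 n2) N).
    move=> z [h1 h2]; left; split=> // -[n _ h3]; by apply: h2; exists n.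
have cov2 : covered (tens_op bA1 bA2) f g (pull snd snd (~` k2)).
  have [C [D [mC mD N]]] := o2.
  have mS (dd dd' : measure_display) (U : measurableType dd) (W : measurableType dd')
      (B : set W) : measurable B -> measurable ((@snd U W) @^-1` B).
    by move=> mB; rewrite -[X in measurable X]setTI; exact: measurable_snd.
  exists (fun n => snd @^-1` C n), (fun n => snd @^-1` D n); split.
  - by move=> n; exact: mS.
  - by move=> n; exact: mS.
  - move=> n; apply: (@kills_restr _ _ _ _ _ _ _ _ f g _ _ (mS _ _ _ _ _ (mC n)) (mS _ _ _ _ _ (mD n))).
    apply: (@kills_snd _ _ _ _ _ _ _ _ _ _ _ _ _ _ _ bA1 _ _ bA2 _ _ (mC n) (mD n)) => // u v.
    exact: (M_max_kills _ _ _ _ _ a2 (miss _ _ _ _ _ _ _ _ _ n N)).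
  - apply: marginally_null_sub (marginally_null_pull measurable_snd measurable_snd
      (@null_snd _ _ _ _ _ m1 m2) (@null_snd _ _ _ _ _ n1 n2) N).
    move=> z [h1 h2]; left; split=> // -[n _ h3]; by apply: h2; exists n.
have [P1 [p1 [i1 t1]]] := tight_standard s1; have [P2 [p2 [i2 t2]]] := tight_standard s2.
have [Q1 [q1 [j1 u1]]] := tight_standard s1'; have [Q2 [q2 [j2 u2]]] := tight_standard s2'.
apply: (covered_hpair bA sf sg (injective_pair_map i1 i2) (injective_pair_map j1 j2)
  (sigma_finite_prod m1 m2) (sigma_finite_prod n1 n2) (tight_prod i1 i2 t1 t2)
  (tight_prod j1 j2 u1 u2)).
(* A point outside both pullbacks belongs to kappa, hence to E. On E the kernel vanishes, and on the
   pullbacks T1 and T2 provide the killing. *)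
rewrite (_ : setT = (E `|` pull fst fst (~` k1)) `|` pull snd snd (~` k2)).
  by apply: coveredU => //; apply: coveredU => //; exact: (covered_vanishing bA sf sg r oE vE).
apply/esym/seteqP; split=> // z _.
have [h1|h1] := pselect (k1 (z.1.1, z.2.1)); last by left; right.
have [h2|h2] := pselect (k2 (z.1.2, z.2.2)); last by right.
by left; left; apply: kE; apply/rho_image.
Qed.

End tensor_annihilators.

Local Open Scope ereal_scope.

Theorem theorem4p14 (R : realType) (d1 d2 e1 e2 : measure_display)
  (X1 : measurableType d1) (X2 : measurableType d2)
  (Y1 : measurableType e1) (Y2 : measurableType e2)
  (mu1 : {sigma_finite_measure set X1 -> \bar R})
  (mu2 : {sigma_finite_measure set X2 -> \bar R})
  (nu1 : {sigma_finite_measure set Y1 -> \bar R})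
  (nu2 : {sigma_finite_measure set Y2 -> \bar R})
  (hmu1 : standard_measure_space mu1) (hmu2 : standard_measure_space mu2)
  (hnu1 : standard_measure_space nu1) (hnu2 : standard_measure_space nu2)
  (kappa1 : set (X1 * Y1)) (kappa2 : set (X2 * Y2))
  (hkappa1 : omega_closed mu1 nu1 kappa1)
  (hkappa2 : omega_closed mu2 nu2 kappa2) :
  (operator_M_set (mu1 \x mu2) (nu1 \x nu2)
     ((@rho X1 X2 Y1 Y2) @` (kappa1 `*` kappa2))
   <-> operator_M_set mu1 nu1 kappa1 /\ operator_M_set mu2 nu2 kappa2)
  /\
  (operator_M1_set (mu1 \x mu2) (nu1 \x nu2)
     ((@rho X1 X2 Y1 Y2) @` (kappa1 `*` kappa2))
   <-> operator_M1_set mu1 nu1 kappa1 /\ operator_M1_set mu2 nu2 kappa2).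
Proof.
have ck := omega_closed_rho hkappa1 hkappa2.
split; split.
- move=> [_ [T [aT cT zT]]].
  have [[T1 h1] [T2 h2]] := factor_M_max aT cT zT.
  by split; split=> //; [exists T1|exists T2].
- move=> [[_ [T1 [a1 c1 z1]]] [_ [T2 [a2 c2 z2]]]]; split=> //.
  exact: (tensor_M_max hmu1 hmu2 hnu1 hnu2 hkappa1 hkappa2 a1 a2 c1 z1 c2 z2).
- move=> [_ [T [aT cT zT]]].
  have [[T1 h1] [T2 h2]] := factor_M_min aT cT zT.
  by split; split=> //; [exists T1|exists T2].
- move=> [[_ [T1 [a1 c1 z1]]] [_ [T2 [a2 c2 z2]]]]; split=> //.
  exact: (tensor_M_min a1 a2 c1 z1 c2 z2).
Qed.
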